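(* Let $G$ be a cubic brick which is not isomorphic to $K_4$, to $\overline{C_6}$, or to $R_8$. Then $G$ has a matching $M$ with $|M|\geq |V(G)|/7$ such that every edge of $M$ is removable in $G$.
   Context: All graphs are finite, simple and undirected. A connected graph is matching covered if every edge lies in some perfect matching. An edge $e$ of a matching covered graph $G$ is removable if $G-e$ is matching covered. For $X\subseteq V(G)$, $\partial(X)$ is the set of edges with exactly one end in $X$; it is tight if every perfect matching of $G$ contains exactly one edge of $\partial(X)$, and trivial if $|X|=1$ or $|V(G)\setminus X|=1$. A brick is a non-bipartite matching covered graph with no non-trivial tight cut (equivalently, a 3-connected graph $G$ such that $G-\{x,y\}$ has a perfect matching for all distinct $x,y$). $\overline{C_6}$ is the complement of the 6-cycle (the triangular prism). $R_8$ is the cubic brick on 8 vertices $u,v,w,x,y,z,u_1,v_1$ with edge set $\{uv,uw,vw,xy,xz,yz,wz,uu_1,u_1x,vv_1,v_1y,u_1v_1\}$ (two triangles $uvw$ and $xyz$ joined by the edge $wz$ and by the paths $uu_1x$, $vv_1y$, together with the edge $u_1v_1$); it has exactly one removable edge. *)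

(* Defs.v *)
From mathcomp Require Import all_boot.

Set Implicit Arguments.
Unset Strict Implicit.
Unset Printing Implicit Defensive.

Record sgraph := SGraph {
  vertex :> finType;
  adj : rel vertex;
  adj_sym : symmetric adj;
  adj_irr : irreflexive adj }.

(* Edges are two-element vertex sets, so that [trivIset] and [cover] express
   disjointness and spanning for sets of edges. *)
Definition edges (G : sgraph) : {set {set G}} :=
  [set [set x; y] | x in G, y in G & adj x y].

Definition isomorphic (G H : sgraph) : Prop :=
  exists2 f : G -> H, bijective f & forall x y, adj (f x) (f y) = adj x y.

Definition connected (G : sgraph) : Prop :=
  forall x y : G, connect (@adj G) x y.

Definition cubic (G : sgraph) : Prop :=
  forall x : G, #|[set y | adj x y]| = 3.

Definition matching (G : sgraph) (M : {set {set G}}) : Prop :=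
  M \subset edges G /\ trivIset M.

Definition perfect_matching (G : sgraph) (M : {set {set G}}) : Prop :=
  matching M /\ cover M = [set: G].

Definition cut (G : sgraph) (X : {set G}) : {set {set G}} :=
  [set d in edges G | #|d :&: X| == 1].

Definition bipartite (G : sgraph) : Prop :=
  exists X : {set G}, cut X = edges G.

Definition matching_covered (G : sgraph) : Prop :=
  connected G /\
  forall d, d \in edges G -> exists2 M, perfect_matching M & d \in M.

Section DelEdge.
Variables (G : sgraph) (d : {set G}).

Definition del_edge_adj : rel G := [rel x y | adj x y && ([set x; y] != d)].

Lemma del_edge_sym : symmetric del_edge_adj.
Proof. by move=> x y; rewrite /del_edge_adj /= adj_sym setUC. Qed.

Lemma del_edge_irr : irreflexive del_edge_adj.
Proof. by move=> x; rewrite /del_edge_adj /= adj_irr. Qed.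

Definition del_edge : sgraph := SGraph del_edge_sym del_edge_irr.
End DelEdge.

Definition removable (G : sgraph) (d : {set G}) : Prop :=
  d \in edges G /\ matching_covered (del_edge d).

Definition tight (G : sgraph) (X : {set G}) : Prop :=
  forall M, perfect_matching M -> #|M :&: cut X| = 1.

Definition trivial_cut (G : sgraph) (X : {set G}) : Prop :=
  #|X| = 1 \/ #|~: X| = 1.

Definition brick (G : sgraph) : Prop :=
  [/\ matching_covered G, ~ bipartite G
    & forall X : {set G}, tight X -> trivial_cut X].

Definition K4_adj : rel 'I_4 := [rel i j | i != j].

Lemma K4_sym : symmetric K4_adj.
Proof. by move=> i j; rewrite /K4_adj /= eq_sym. Qed.

Lemma K4_irr : irreflexive K4_adj.
Proof. by move=> i; rewrite /K4_adj /= eqxx. Qed.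

Definition K4 : sgraph := SGraph K4_sym K4_irr.

Definition C6_adj : rel 'I_6 := [rel i j | (j == ordS i) || (i == ordS j)].

Definition C6bar_adj : rel 'I_6 := [rel i j | (i != j) && ~~ C6_adj i j].

Lemma C6bar_sym : symmetric C6bar_adj.
Proof. by move=> i j; rewrite /C6bar_adj /C6_adj /= eq_sym orbC. Qed.

Lemma C6bar_irr : irreflexive C6bar_adj.
Proof. by move=> i; rewrite /C6bar_adj /= eqxx. Qed.

Definition C6bar : sgraph := SGraph C6bar_sym C6bar_irr.

(* The vertices u, v, w, x, y, z, u1, v1 are numbered 0, ..., 7 in this order. *)
Definition R8_edges : seq (nat * nat) :=
  [:: (0, 1); (0, 2); (1, 2); (3, 4); (3, 5); (4, 5); (2, 5);
      (0, 6); (6, 3); (1, 7); (7, 4); (6, 7)].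

Definition R8_adj : rel 'I_8 :=
  [rel i j | ((val i, val j) \in R8_edges) || ((val j, val i) \in R8_edges)].

Lemma R8_sym : symmetric R8_adj.
Proof. by move=> i j; rewrite /R8_adj /= orbC. Qed.

Lemma R8_irr : irreflexive R8_adj.
Proof. by case=> [[|[|[|[|[|[|[|[|]]]]]]]]]. Qed.

Definition R8 : sgraph := SGraph R8_sym R8_irr.

(* Main.v *)
Require Import Defs.
From mathcomp Require Import all_boot.
From mathcomp Require Import zify boolp.

Set Implicit Arguments.
Unset Strict Implicit.
Unset Printing Implicit Defensive.

(** If [e] is not removable, some edge [f] lies only in perfect matchings
    through [e], and Tutte's theorem gives a set [S] such that [f] is the only
    edge inside [S], the graph [G - S - e] splits into [|S|] odd parts whose
    cuts in [G] have size 3, and [e] joins two of these parts.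
    In a cubic brick two 3-cuts never cross, so the 3-cuts form a tree of
    "atoms": cubic graphs without nontrivial 3-cuts, obtained by contracting
    the shores of 3-cuts to single vertices (the big blocks below, the other
    vertices being real). Inside an atom, a non-removable edge between real
    vertices belongs to a doubleton: a pair of edges whose deletion makes the
    atom bipartite, the side not containing the edge having at most one big
    block, since otherwise some block would have a tight cut.
    An atom with [r] real vertices and [z] big blocks then has a matching of
    [n] removable edges with [r + 4 <= 7 n + 2 z], except for a triangle all of
    whose edges are non-removable; such a triangle is next to a [K4]-atom, whose
    removable edge pays for it. Summing over the tree bounds [|V(G)|] by [7 n],
    the prism and [R8] being the trees in which two such triangles have no,
    respectively only one, such [K4]-atom between them. *)

(** * Hall's and Tutte's theorems *)

(** An atom need not be a brick and may even be bipartite, so facts about removable edges of bricks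
    cannot be invoked inside it. Barriers and tight cuts are therefore always taken in [G], and only
    the outcome is projected to the atom. Cubicity makes the projection rigid: a barrier leaves no
    slack in the count of the [3 |S|] edge ends at [S], and a count modulo 3 inside a block decides
    on which side of the atom the block falls. Bipartite atoms reappear as a degenerate outcome of
    the projection and have to be excluded separately.

    The factor 7 comes from a triangle without removable edges next to a [K4]-atom. Together with
    the two real vertices of that atom it forms a shore of 5 vertices in which only one removable
    edge is guaranteed ([R8] contains such a shore), and 5 + 2 = 7, the summand 2 being what a shore
    pays for its cut. *)

Section Hall.
Variables (T I : finType) (t0 : T).

(** Induction on [#|O|]. A proper subfamily that meets its bound with equality can be represented on
    its own without harming the others. If there is none, every proper subfamily has an element to
    spare, so one index may take any element of its set. *)
Lemma hall (O : {set I}) (r : I -> {set T}) :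
  (forall Q : {set I}, Q \subset O -> #|Q| <= #|\bigcup_(i in Q) r i|) ->
  exists2 h : I -> T, {in O &, injective h} & {in O, forall i, h i \in r i}.
Proof.
have [n] := ubnP #|O|; elim: n => // n IHn in O r * => leOn hallO.
have [O0|[i0 Oi0]] := set_0Vmem O.
  by exists (fun=> t0) => i; rewrite O0 inE.
have splice (A : {set I}) (V : {set T}) : A \subset O -> 0 < #|A| ->
    (exists2 h : I -> T, {in A &, injective h} &
       {in A, forall i, (h i \in r i) && (h i \in V)}) ->
    (forall Q : {set I}, Q \subset O :\: A ->
       #|Q| <= #|\bigcup_(i in Q) (r i :\: V)|) ->
  exists2 h : I -> T, {in O &, injective h} & {in O, forall i, h i \in r i}.
  move=> sAO A0 [h1 inj1 rh1] hallD.
  have [|h2 inj2 rh2] := IHn _ _ _ hallD.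
    by have := cardsD O A; have := subset_leq_card sAO; rewrite (setIidPr sAO); lia.
  pose h i := if i \in A then h1 i else h2 i.
  have rh i : i \in O -> i \notin A -> (h2 i \in r i) && (h2 i \notin V).
    by move=> Oi nAi; have := rh2 i; rewrite !inE nAi Oi andbC => ->.
  exists h => [i j Oi Oj|i Oi]; rewrite /h.
    case: ifP => Ai; case: ifP => Aj.
    - exact: inj1.
    - move=> e; have /andP[_] := rh1 _ Ai; rewrite e.
      by have /andP[_ /negbTE->] := rh _ Oj (negbT Aj).
    - move=> e; have /andP[_] := rh1 _ Aj; rewrite -e.
      by have /andP[_ /negbTE->] := rh _ Oi (negbT Ai).
    - by apply: inj2; rewrite inE ?Ai ?Aj.
  by case: ifP => Ai; [case/andP: (rh1 _ Ai) | case/andP: (rh _ Oi (negbT Ai))].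
have [/existsP[Q /and4P[sQO Q0 ltQO /eqP eqQ]]|no_tight] :=
  boolP [exists Q : {set I}, [&& Q \subset O, 0 < #|Q|, #|Q| < #|O|
     & #|\bigcup_(i in Q) r i| == #|Q|]].
  apply: (splice Q (\bigcup_(i in Q) r i)) => //.
    have [||h inj rh] := IHn Q r.
    - exact: leq_trans ltQO _.
    - by move=> Q' sQ'; apply: hallO; apply: subset_trans sQO.
    exists h => // i Qi; rewrite rh //=; apply/bigcupP; exists i => //; exact: rh.
  move=> Q' sQ'.
  (* Hall's inequality for [Q :|: Q'], less the equality for [Q], is the inequality for [Q'] after
     the elements reached by [Q] are removed. *)
  have := hallO (Q :|: Q').
  rewrite subUset sQO (subset_trans sQ') ?subsetDl // => /(_ isT).
  rewrite bigcup_setU -(setID (\bigcup_(i in Q') r i) (\bigcup_(i in Q) r i)).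
  set N := \bigcup_(i in Q) r i; set N' := \bigcup_(i in Q') r i.
  have -> : N :|: (N' :&: N :|: N' :\: N) = N :|: N' :\: N.
    by apply/setP=> x; rewrite !inE; do 2!case: (_ \in _).
  have -> : \bigcup_(i in Q') (r i :\: N) = N' :\: N.
    apply/setP=> x; rewrite !inE; apply/bigcupP/andP => [[i Qi]|[xN /bigcupP[i Qi ri]]].
      by rewrite inE => /andP[-> ri]; split=> //; apply/bigcupP; exists i.
    by exists i; rewrite // inE xN.
  rewrite !cardsU eqQ.
  have -> : Q :&: Q' = set0.
    apply/setP=> i; rewrite !inE; apply/negP=> /andP[Qi /(subsetP sQ')].
    by rewrite inE Qi.
  by rewrite cards0 subn0; lia.
have [t rt] : exists t, t \in r i0.
  have := hallO [set i0]; rewrite sub1set Oi0 cards1 big_set1 => /(_ isT).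
  by case/card_gt0P => t; exists t.
apply: (splice [set i0] [set t]); rewrite ?sub1set ?cards1 //.
  exists (fun=> t) => [i j|i]; rewrite !inE; first by move=> /eqP-> /eqP->.
  by move=> /eqP->; rewrite rt eqxx.
move=> Q sQ.
have -> : \bigcup_(i in Q) (r i :\: [set t]) = (\bigcup_(i in Q) r i) :\ t.
  apply/setP=> x; rewrite !inE; apply/bigcupP/andP => [[i Qi]|[xN /bigcupP[i Qi ri]]].
    by rewrite !inE => /andP[-> ri]; split=> //; apply/bigcupP; exists i.
  by exists i; rewrite // !inE xN.
have sQO : Q \subset O := subset_trans sQ (subsetDl _ _).
have ltQ : #|Q| < #|O|.
  apply: proper_card; rewrite properE sQO; apply/subsetPn; exists i0 => //.
  by apply/negP => /(subsetP sQ); rewrite !inE eqxx.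
have [->|Qn0] := eqVneq #|Q| 0; first by [].
have := cardsD1 t (\bigcup_(i in Q) r i); have := hallO _ sQO.
move/existsPn: no_tight => /(_ Q); rewrite sQO lt0n Qn0 ltQ /=.
by case: (t \in _) => /=; move=> /eqP; lia.
Qed.
End Hall.

Section Tutte.
Variables (T : finType) (e : rel T).
Hypothesis e_sym : symmetric e.

Definition perfectly_matched (V : {set T}) :=
  exists m : T -> T, {in V, forall x, [/\ m x \in V, m (m x) = x & e x (m x)]}.

(* The members of [O] play the role of odd components of [V :\: S]: they need
   not be connected, it suffices that no edge leaves them inside [V :\: S]. *)
Definition odd_parts (V S : {set T}) (O : {set {set T}}) :=
  [/\ S \subset V, trivIset O &
    forall B, B \in O -> [/\ odd #|B|, B \subset V :\: S &
      forall x y, x \in B -> y \in V :\: S -> e x y -> y \in B]].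

Lemma odd_cover (O : {set {set T}}) :
  trivIset O -> (forall B, B \in O -> odd #|B|) -> odd #|cover O| = odd #|O|.
Proof.
move=> /eqP <- oddO; rewrite -sum1_card; apply: (big_ind2 (fun m n => odd m = odd n)) => //.
by move=> m1 m2 n1 n2 e1 e2; rewrite !oddD e1 e2.
Qed.

Lemma perfectly_matchedU (V W : {set T}) :
  [disjoint V & W] -> perfectly_matched V -> perfectly_matched W ->
  perfectly_matched (V :|: W).
Proof.
move=> dVW [m mP] [p pP]; exists (fun x => if x \in V then m x else p x) => x.
rewrite inE; case: ifP => [Vx _|Vx /= Wx].
  by have [mV mK ex] := mP _ Vx; rewrite inE mV.
have [pW pK ex] := pP _ Wx; rewrite inE pW orbT pK; split=> //.
by rewrite (disjointFl dVW pW).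
Qed.

Lemma perfectly_matched_bigcup (I : finType) (O : {set I}) (F : I -> {set T}) :
  {in O &, forall i j, i != j -> [disjoint F i & F j]} ->
  {in O, forall i, perfectly_matched (F i)} ->
  perfectly_matched (\bigcup_(i in O) F i).
Proof.
have [n] := ubnP #|O|; elim: n => // n IHn in O * => leOn dF pmF.
have [->|[i Oi]] := set_0Vmem O.
  by rewrite big_set0; exists id => x; rewrite inE.
rewrite (big_setD1 i) //=; apply: perfectly_matchedU.
- apply/bigcup_disjointP=> j /setD1P[ji Oj].
  by rewrite dF // eq_sym.
- exact: pmF.
- apply: IHn; first by move: leOn; rewrite (cardsD1 i) Oi.
    by move=> j k /setD1P[_ Oj] /setD1P[_ Ok]; apply: dF.
  by move=> j /setD1P[_ Oj]; apply: pmF.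
Qed.

Lemma odd_parts_rest (V S : {set T}) (O : {set {set T}}) (E := V :\: S :\: cover O) :
  odd_parts V S O ->
  [/\ forall x y, x \in E -> y \in V :\: S -> e x y -> y \in E,
      forall W, W \in O -> [disjoint W & E] &
      #|V| = #|S| + #|cover O| + #|E| ].
Proof.
move=> [sSV tO oP]; split=> [x y|W OW|].
- rewrite !in_setD => /and3P[xO xS xV] /andP[yS yV] exy; rewrite yS yV !andbT.
  apply: contra xO => /bigcupP[B OB By]; apply/bigcupP; exists B => //.
  have [_ _ cB] := oP _ OB; apply: cB By _ _; first by rewrite inE xS xV.
  by rewrite e_sym.
- rewrite disjoints_subset; apply/subsetP=> x Wx; rewrite !inE negb_and negbK.
  by apply/orP; left; apply/bigcupP; exists W.
have sOV : cover O \subset V :\: S by apply/bigcupsP=> B /oP[].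
rewrite -(cardsID S V) (setIidPr sSV) -(cardsID (cover O) (V :\: S)).
by rewrite (setIidPr sOV) addnA.
Qed.

Lemma odd_parts_add (V S : {set T}) (O : {set {set T}}) (B : {set T}) :
  odd_parts V S O -> odd #|B| -> B \subset V :\: S ->
  (forall x y, x \in B -> y \in V :\: S -> e x y -> y \in B) ->
  (forall W, W \in O -> [disjoint W & B]) ->
  odd_parts V S (B |: O) /\ #|B |: O| = #|O|.+1.
Proof.
move=> [sSV tO oP] oB sB cB dB; split; last first.
  rewrite cardsU1; case: (boolP (B \in O)) => //= /dB.
  by rewrite -setI_eq0 setIid => /eqP B0; rewrite B0 cards0 in oB.
split=> //.
  apply/trivIsetP=> X Y /setU1P[->|OX] /setU1P[->|OY]; rewrite ?eqxx //.
  - by rewrite disjoint_sym dB.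
  - by rewrite dB.
  - by move/trivIsetP: tO; apply.
by move=> W /setU1P[->|/oP].
Qed.

(** If the surplus is only 1, parity makes the rest outside [S] and [cover O] odd, and this rest is
    one more part. *)
Lemma odd_parts_parity (V S : {set T}) (O : {set {set T}}) :
  ~~ odd #|V| -> odd_parts V S O -> #|S| < #|O| ->
  exists2 O', odd_parts V S O' & #|S| + 2 <= #|O'|.
Proof.
move=> evV oSO ltSO; have [closedE disjE cardE] := odd_parts_rest oSO.
have [|] := leqP (#|S| + 2) #|O|; first by exists O.
rewrite addn2 ltnS => leO.
have eO : #|O| = #|S|.+1 by apply/eqP; rewrite eqn_leq leO.
case: (oSO) => sS tO oP.
have oE : odd #|V :\: S :\: cover O|.
  have := congr1 odd cardE; rewrite !oddD odd_cover => [||W /oP[]] //.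
  by rewrite eO /= (negbTE evV); do 2!case: (odd _).
have [||||o2 c2] := odd_parts_add oSO (B := V :\: S :\: cover O) => //.
  by apply: subsetDl.
exists ((V :\: S :\: cover O) |: O); first exact: o2.
by rewrite c2 eO.
Qed.

(** Among the pairs with [#|O| = #|S|] one with [S] largest is taken. Maximality shows that [S] and
    the parts exhaust [V] and that each part, minus any vertex, is perfectly matched by induction.
    Hall's theorem then assigns to each part its own neighbour in [S]. *)
Theorem tutte (V : {set T}) :
  (forall S O, odd_parts V S O -> #|O| <= #|S|) -> perfectly_matched V.
Proof.
have [n] := ubnP #|V|; elim: n => // n IHn in V * => leVn hV.
have parity S O : odd_parts V S O ->
    odd #|V| = odd #|S| (+) odd #|O| (+) odd #|V :\: S :\: cover O|.
  move=> oSO; have [_ _ ->] := odd_parts_rest oSO; rewrite !oddD odd_cover //.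
    by case: oSO.
  by case: oSO => _ _ oP B /oP[].
have part0 W : odd_parts W set0 set0.
  split; rewrite ?sub0set //; last by move=> B; rewrite inE.
  by apply/trivIsetP=> B C; rewrite inE.
have evV : ~~ odd #|V|.
  apply/negP=> oV; suff [/hV] : odd_parts V set0 (V |: set0) /\
      #|V |: set0| = #|@set0 {set T}|.+1.
    by move=> leV eqV; rewrite eqV !cards0 in leV.
  apply: odd_parts_add; rewrite ?setD0 //.
  by move=> W; rewrite inE.
pose tightSO (p : {set T} * {set {set T}}) := #|p.2| = #|p.1| /\ odd_parts V p.1 p.2.
have tight0 : `[< tightSO (set0, set0) >] by apply/asboolP; split; rewrite /= ?cards0.
case: (@arg_maxnP _ _ (fun p => `[< tightSO p >]) (fun p : {set T} * {set {set T}} => #|p.1|) tight0) => [[S O] /asboolP[/= eqSO oSO]] maxS.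
have {}maxS S' O' : odd_parts V S' O' -> #|O'| = #|S'| -> #|S'| <= #|S|.
  by move=> o1 eq1; apply: (maxS (S', O')); apply/asboolP.
have [closedE disjE cardE] := odd_parts_rest oSO.
have [sSV tO oP] := oSO.
(* The rest has even size. If it had a vertex [x], adding [x] to [S] and the remaining odd set to
   [O] would give a larger pair. *)
have E0 : V :\: S :\: cover O = set0.
  apply/eqP; rewrite -cards_eq0; apply/negPn/negP => En0.
  have [x Ex] : exists x, x \in V :\: S :\: cover O.
    by apply/set0Pn; rewrite -cards_eq0.
  have [xS xV] : x \notin S /\ x \in V by move: Ex; rewrite !inE; case/and3P.
  have cardEx := cardsD1 x (V :\: S :\: cover O); rewrite Ex in cardEx.
  have := parity _ _ oSO; rewrite eqSO addbb /= (negbTE evV) cardEx /= => oEx.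
  have oS' : odd_parts V (x |: S) O.
    split=> //; first by rewrite subUset sub1set xV.
    move=> B OB; have [oB sB cB] := oP _ OB; split=> //.
      apply/subsetP=> y By; have := subsetP sB _ By; rewrite !inE negb_or => /andP[-> ->].
      rewrite !andbT; apply: contraTneq By => ->.
      by rewrite (disjointFl (disjE _ OB) Ex).
    by move=> y z By; rewrite !inE negb_or -andbA => /and3P[_ zS zV]; apply: cB; rewrite // inE zS.
  have [||||oSO' cO'] := odd_parts_add oS' (B := (V :\: S :\: cover O) :\ x).
  - by rewrite -[odd _]negbK -oEx.
  - by apply/subsetP=> y; rewrite !inE negb_or => /and4P[-> _ -> ->].
  - move=> y z /setD1P[yx Ey]; rewrite !(inE, negb_or) -andbA => /and3P[zx zS zV] eyz.
    have := closedE _ _ Ey _ eyz; rewrite !inE zx zS zV; exact.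
  - by move=> W OW; apply: disjointWr (disjE _ OW); apply: subD1set.
  have := maxS _ _ oSO'; rewrite cO' cardsU1 xS eqSO add1n => /(_ erefl).
  by rewrite ltnn.
have VE : V = S :|: cover O.
  apply/setP=> x; have /setP/(_ x) := E0; rewrite !inE.
  have := subsetP sSV x; case: (x \in S) => /= [-> //|_].
  case: (boolP (x \in cover O)) => //= xO _.
  by case/bigcupP: xO => B /oP[_ /subsetP sB _] /sB; rewrite inE => /andP[].
have pmB B x : B \in O -> x \in B -> perfectly_matched (B :\ x).
  move=> OB Bx; have [oB sB cB] := oP _ OB.
  have /andP[xS xV] : (x \notin S) && (x \in V) by have := subsetP sB _ Bx; rewrite inE.
  have sBV : B \subset V by apply: subset_trans sB (subsetDl _ _).
  apply: IHn.
    rewrite ltnS in leVn; apply: leq_trans leVn; rewrite (cardsD1 x V) xV add1n ltnS.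
    by apply: subset_leq_card; apply: setSD.
  move=> S' O' oS'; rewrite leqNgt; apply/negP => ltSO.
  have {O' oS' ltSO}[O' oS' gtO'] : exists2 O', odd_parts (B :\ x) S' O' & #|S'| + 2 <= #|O'|.
    apply: odd_parts_parity oS' ltSO.
    by have := cardsD1 x B; rewrite Bx => cB'; move: oB; rewrite cB'.
  case: (oS') => sS' tO' oP'.
  have sS'B : S' \subset B by apply: subset_trans sS' (subD1set _ _).
  pose S2 := x |: (S :|: S').
  pose O2 := (O :\ B) :|: O'.
  have sBO' W : W \in O' -> W \subset B.
    by move=> /oP'[_ sW _]; apply: subset_trans sW (subset_trans (subsetDl _ _) (subD1set _ _)).
  have dO W : W \in O -> W != B -> [disjoint W & B] by move=> OW; move/trivIsetP: tO; apply.
  (* A deficient pair inside [B :\ x] is lifted to [V]: its surplus of 2 makes up for adding [x] to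
     [S] and losing the part [B], so [#|O2| >= #|S2| > #|S|], against maximality. *)
  have oS2 : odd_parts V S2 O2.
    split.
    - by rewrite !subUset sub1set xV sSV (subset_trans sS'B).
    - apply/trivIsetP=> W1 W2.
      move=> /setUP[/setD1P[W1B OW1]|OW1] /setUP[/setD1P[W2B OW2]|OW2] neq.
      + by move/trivIsetP: tO; apply.
      + by apply: disjointWr (sBO' _ OW2) (dO _ OW1 W1B).
      + by rewrite disjoint_sym; apply: disjointWr (sBO' _ OW1) (dO _ OW2 W2B).
      + by move/trivIsetP: tO'; apply.
    - move=> W /setUP[/setD1P[WB OW]|OW].
        have [oW sW cW] := oP _ OW; split=> //; last first.
          move=> y z Wy; rewrite !inE !negb_or -!andbA => /and4P[_ zS _ zV].
          by apply: cW => //; rewrite inE zS.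
        apply/subsetP=> y Wy; have := subsetP sW _ Wy; rewrite !inE !negb_or => /andP[-> ->].
        have yB : y \notin B by rewrite (disjointFr (dO _ OW WB) Wy).
        rewrite andbT /=; apply/andP; split; first by apply: contraNneq yB => ->.
        by apply: contra yB; apply: (subsetP sS'B).
      have [oW sW cW] := oP' _ OW; split=> //.
        apply/subsetP=> y Wy; have := subsetP sW _ Wy; rewrite !inE !negb_or.
        case/and3P=> -> -> By; have := subsetP sB _ By; rewrite inE => /andP[-> ->].
        by [].
      move=> y z Wy; rewrite !inE !negb_or -!andbA => /and4P[zx zS zS' zV] eyz.
      apply: (cW y) => //; rewrite !inE zS' zx /=.
      by apply: (cB y) eyz; [apply: (subsetP (sBO' _ OW)) | rewrite inE zS].
  have cS2 : #|S2| = #|S| + #|S'| + 1.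
    rewrite cardsU1 cardsU !inE (negbTE xS) /=.
    have -> : S :&: S' = set0.
      apply/setP=> y; rewrite !inE; apply/negP=> /andP[Sy /(subsetP sS'B) By].
      by have := subsetP sB _ By; rewrite inE Sy.
    have -> : x \notin S' by apply/negP=> /(subsetP sS'); rewrite !inE eqxx.
    by rewrite cards0 subn0 addnC.
  have cO2 : #|O2| = #|O| + #|O'| - 1.
    rewrite cardsU (cardsD1 B O) OB.
    have -> : (O :\ B) :&: O' = set0.
      apply/setP=> W; rewrite !inE; apply/negP=> /andP[/andP[WB OW] OW'].
      have [oW _ _] := oP _ OW; have := dO _ OW WB.
      by rewrite -setI_eq0 (setIidPl (sBO' _ OW')) => /eqP W0; rewrite W0 cards0 in oW.
    by rewrite cards0 subn0 add1n addSn subn1.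
  have := hV _ _ oS2; have := maxS _ _ oS2; rewrite cS2 cO2 eqSO.
  by clear -gtO'; lia.
pose r (B : {set T}) := [set s in S | [exists x in B, e s x]].
have [[v]|T0] : (exists v : T, v \in V) \/ V = set0.
- by have [|[v]] := set_0Vmem V; [right | left; exists v].
- move=> _; have [|h injh rh] := hall v (O := O) (r := r).
    (* To isolate the parts in [Q] it is enough to remove their neighbours in [S], so the hypothesis
       on [V] becomes Hall's inequality. *)
    move=> Q sQ; have tQ : odd_parts V (\bigcup_(B in Q) r B) Q.
      split.
      + by apply/bigcupsP=> B _; apply/subsetP=> s; rewrite inE => /andP[/(subsetP sSV)].
      + exact: trivIsetS sQ tO.
      + move=> B QB; have [oB sB cB] := oP _ (subsetP sQ _ QB); split=> //.
          apply/subsetP=> y By; have := subsetP sB _ By; rewrite !inE => /andP[yS ->].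
          rewrite andbT; apply/bigcupP=> -[C _]; rewrite inE (negbTE yS) //.
        move=> y z By; rewrite inE => /andP[zN zV] eyz; apply: (cB y z) => //.
        rewrite inE zV andbT; apply: contra zN => Sz; apply/bigcupP; exists B => //.
        by rewrite inE Sz; apply/exists_inP; exists y; rewrite // e_sym.
    exact: hV.
  have rP B : B \in O -> h B \in S /\ exists2 x, x \in B & e (h B) x.
    by move/rh; rewrite inE => /andP[-> /exists_inP].
  have hS : [set h B | B in O] = S.
    apply/eqP; rewrite eqEcard card_in_imset // eqSO leqnn andbT.
    by apply/subsetP=> _ /imsetP[B /rP[Sh _] ->].
  have -> : V = \bigcup_(B in O) (h B |: B).
    rewrite VE; apply/setP=> x; rewrite inE; apply/orP/bigcupP.
      case=> [|/bigcupP[B OB Bx]]; last by exists B => //; rewrite inE Bx orbT.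
      by rewrite -hS => /imsetP[B OB ->]; exists B => //; rewrite !inE eqxx.
    case=> B OB /setU1P[->|Bx]; first by left; case: (rP _ OB).
    by right; apply/bigcupP; exists B.
  apply: perfectly_matched_bigcup => [B C OB OC BC|B OB].
    have [[ShB _] [ShC _]] := (rP _ OB, rP _ OC).
    have [[_ sB _] [_ sC _]] := (oP _ OB, oP _ OC).
    rewrite -setI_eq0; apply/eqP/setP=> x; rewrite !inE; apply/negP=> /andP[].
    move=> /orP[/eqP->|Bx] /orP[/eqP|Cx].
    + by move/injh => /(_ OB OC) /eqP; rewrite (negbTE BC).
    + by have := subsetP sC _ Cx; rewrite inE ShB.
    + by move=> xE; have := subsetP sB _ Bx; rewrite xE inE ShC.
    + have /trivIsetP/(_ _ _ OB OC BC) := tO.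
      by rewrite -setI_eq0 => /eqP/setP/(_ x); rewrite !inE Bx Cx.
  have [Sh [x Bx ehx]] := rP _ OB.
  have [_ sB _] := oP _ OB.
  have hx : h B != x.
    by apply: contraTneq Bx => <-; apply/negP=> /(subsetP sB); rewrite inE Sh.
  have -> : h B |: B = [set h B; x] :|: (B :\ x).
    by rewrite -setUA setD1K.
  apply: perfectly_matchedU; last exact: pmB.
    rewrite -setI_eq0; apply/eqP/setP=> y; rewrite !inE; apply/negP=> /andP[].
    case/orP=> /eqP->; last by rewrite eqxx.
    by move=> /andP[_ /(subsetP sB)]; rewrite inE Sh.
  exists (fun y => if y == x then h B else x) => y; rewrite !inE.
  case/orP=> /eqP->; first by rewrite (negbTE hx) !eqxx orbT.
  by rewrite eqxx (negbTE hx) eqxx e_sym.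
by exists id => x; rewrite T0 inE.
Qed.
End Tutte.

(** * Counting edges *)

Lemma set2_inj (T : finType) (x y u v : T) :
  [set x; y] = [set u; v] -> (x = u /\ y = v) \/ (x = v /\ y = u).
Proof.
move=> e.
have : x \in [set u; v] by rewrite -e set21.
have : y \in [set u; v] by rewrite -e set22.
have : u \in [set x; y] by rewrite e set21.
have : v \in [set x; y] by rewrite e set22.
rewrite !inE => /orP[]/eqP? /orP[]/eqP? /orP[]/eqP? /orP[]/eqP?; subst; by [left|right].
Qed.

Section EdgeCount.
Variable G : sgraph.
Implicit Types (X Y Z : {set G}) (x y : G).

Lemma adjxx x : adj x x = false. Proof. exact: adj_irr. Qed.
Lemma adjC x y : adj x y = adj y x. Proof. exact: adj_sym. Qed.
Lemma adj_neq x y : adj x y -> x != y.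
Proof. by apply: contraTneq => ->; rewrite adjxx. Qed.

Lemma in_edges x y : ([set x; y] \in edges G) = adj x y.
Proof.
apply/imset2P/idP => [[u v _]|xy]; last by exists x y; rewrite ?inE.
rewrite inE /= => uv /set2_inj[[-> ->]//|[-> ->]]; by rewrite adjC.
Qed.

Lemma edgesP (h : {set G}) : reflect (exists x y, h = [set x; y] /\ adj x y) (h \in edges G).
Proof.
apply: (iffP idP) => [/imset2P[x y _]|[x [y [-> ?]]]]; last by rewrite in_edges.
by rewrite inE /= => xy ->; exists x, y.
Qed.

(* An edge with both ends in [X :&: Y] is counted twice. *)
Definition dg X Y := \sum_(x in X) \sum_(y in Y) (adj x y : nat).
Definition bd X := dg X (~: X).

Lemma dgE X Y : dg X Y = #|[set p : G * G | [&& p.1 \in X, p.2 \in Y & adj p.1 p.2]]|.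
Proof.
rewrite /dg pair_big_dep /= -sum1_card big_mkcond [RHS]big_mkcond /=.
by apply: eq_bigr => -[x y] _; rewrite !inE /=; do 2!case: (_ \in _) => //=; case: adj.
Qed.

Lemma dgC X Y : dg X Y = dg Y X.
Proof. by rewrite /dg exchange_big; do 2!apply: eq_bigr => ? _; rewrite adjC. Qed.

Lemma dgIDl A X Y : dg X Y = dg (X :&: A) Y + dg (X :\: A) Y.
Proof. by rewrite /dg (big_setID A). Qed.

Lemma dgIDr A X Y : dg X Y = dg X (Y :&: A) + dg X (Y :\: A).
Proof. by rewrite dgC (dgIDl A) !(dgC X). Qed.

Lemma dgUl X Y Z : [disjoint X & Y] -> dg (X :|: Y) Z = dg X Z + dg Y Z.
Proof. by move=> dXY; rewrite /dg -bigU //; apply: eq_bigl => x; rewrite inE. Qed.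

Lemma dgUr X Y Z : [disjoint X & Y] -> dg Z (X :|: Y) = dg Z X + dg Z Y.
Proof. by move=> dXY; rewrite dgC dgUl // !(dgC _ Z). Qed.

Lemma dg0l X : dg set0 X = 0. Proof. by rewrite /dg big_set0. Qed.
Lemma dg0r X : dg X set0 = 0. Proof. by rewrite dgC dg0l. Qed.

Lemma dg_gt0P X Y : reflect (exists x y, [/\ x \in X, y \in Y & adj x y]) (0 < dg X Y).
Proof.
rewrite lt0n sum_nat_eq0 negb_forall; apply: (iffP existsP) => [[x]|[x [y [Xx Yy xy]]]].
  rewrite negb_imply sum_nat_eq0 negb_forall => /andP[Xx /existsP[y]].
  by rewrite negb_imply eqb0 negbK => /andP[Yy xy]; exists x, y.
exists x; rewrite Xx sum_nat_eq0 negb_forall; apply/existsP; exists y.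
by rewrite Yy xy.
Qed.

Lemma dg_eq0P X Y : reflect (forall x y, x \in X -> y \in Y -> ~~ adj x y) (dg X Y == 0).
Proof.
apply: (iffP idP) => [/eqP e x y Xx Yy|h]; first apply/negP=> xy.
  by have : 0 < dg X Y by [apply/dg_gt0P; exists x, y]; rewrite e.
rewrite eqn0Ngt; apply/dg_gt0P=> -[x [y [Xx Yy]]]; apply/negP; exact: h.
Qed.

Lemma dg_le_edges X Y x y : x \in X -> y \in Y -> adj x y -> 0 < dg X Y.
Proof. by move=> *; apply/dg_gt0P; exists x, y. Qed.

Lemma dgS X X' Y Y' : X \subset X' -> Y \subset Y' -> dg X Y <= dg X' Y'.
Proof.
move=> /setIidPr sX /setIidPr sY.
by rewrite (dgIDl X X') (dgIDr Y (X' :&: X)) sX sY -addnA leq_addr.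
Qed.

Lemma dg1 x Y : dg [set x] Y = #|[set y in Y | adj x y]|.
Proof.
rewrite /dg big_set1 -sum1_card big_mkcond [RHS]big_mkcond /=.
by apply: eq_bigr => y _; rewrite inE; case: (y \in Y); case: adj.
Qed.

Lemma dg11 x y : dg [set x] [set y] = adj x y.
Proof. by rewrite /dg !big_set1. Qed.

Lemma dg_even X : ~~ odd (dg X X).
Proof.
have [n] := ubnP #|X|; elim: n => // n IHn in X *.
have [->|[x Xx]] := set_0Vmem X; first by rewrite dg0l.
rewrite (cardsD1 x) Xx ltnS => /IHn.
have dx : [disjoint [set x] & X :\ x] by rewrite disjoints1 !inE eqxx.
move: (X :\ x) dx (setD1K Xx) => Y dx <-.
rewrite dgUl // !dgUr // dg11 adjxx (dgC Y [set x]).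
by rewrite add0n addnA addnn oddD odd_double.
Qed.

Lemma bdC X : bd (~: X) = bd X.
Proof. by rewrite /bd setCK dgC. Qed.

Lemma in_cut X x y : ([set x; y] \in cut X) = adj x y && ((x \in X) != (y \in X)).
Proof.
rewrite inE in_edges; case: (boolP (adj x y)) => //= /adj_neq xy.
rewrite setIUl cardsU -!setIA.
have -> : [set x] :&: (X :&: ([set y] :&: X)) = set0.
  by apply/setP=> z; rewrite !inE; case: eqP => // ->; rewrite (negbTE xy) andbF.
rewrite cards0 subn0.
have s1 z : #|[set z] :&: X| = (z \in X).
  case: (boolP (z \in X)) => zX; first by rewrite (setIidPl _) ?sub1set ?cards1.
  apply/eqP; rewrite cards_eq0; apply/eqP/setP=> u; rewrite !inE.
  by case: eqP => // ->; rewrite (negbTE zX).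
by rewrite !s1; do 2!case: (_ \in X).
Qed.

Lemma card_cut X : #|cut X| = bd X.
Proof.
pose P := [set p : G * G | [&& p.1 \in X, p.2 \notin X & adj p.1 p.2]].
have -> : cut X = [set [set p.1; p.2] | p in P].
  apply/setP=> h; apply/idP/imsetP => [hX|[[x y]]]; last first.
    by rewrite inE /= => /and3P[Xx Xy xy] ->; rewrite in_cut xy Xx (negbTE Xy).
  have /edgesP[x [y [hE xy]]] : h \in edges G by move: hX; rewrite inE => /andP[].
  move: hX; rewrite hE in_cut => /andP[_]; case: (boolP (x \in X)) => Xx Xy.
    by exists (x, y) => //; rewrite inE /= Xx xy andbT; case: (y \in X) Xy.
  exists (y, x); last by rewrite setUC.
  by rewrite inE /= Xx adjC xy andbT; case: (y \in X) Xy.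
rewrite card_in_imset => [|[x y] [u v]]; last first.
  rewrite !inE /= => /and3P[Xx Xy xy] /and3P[Xu Xv uv] /set2_inj[[-> ->]//|[xv]].
  by rewrite -xv Xx in Xv.
rewrite /bd dgE; congr #|pred_of_set _|; apply/setP=> p; rewrite !inE.
by [].
Qed.

Lemma dg_set2_le X Y a b :
  (forall u v, u \in X -> v \in Y -> adj u v -> [set u; v] = [set a; b]) ->
  dg X Y <= ((a \in X) && (b \in Y)) + ((b \in X) && (a \in Y)).
Proof.
move=> h; rewrite dgE.
have c1 c d : #|[set p : G * G | (p == (c, d)) && ((c \in X) && (d \in Y))]|
    <= (c \in X) && (d \in Y).
  case: (_ && _); last by rewrite leqn0 cards_eq0; apply/eqP/setP=> p; rewrite !inE andbF.
  rewrite /= -(cards1 (c, d)); apply: subset_leq_card.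
  by apply/subsetP=> p; rewrite !inE andbT.
apply: leq_trans (leq_add (c1 a b) (c1 b a)).
apply: leq_trans (leq_card_setU _ _); apply: subset_leq_card.
apply/subsetP=> -[u v]; rewrite !inE /= => /and3P[Xu Yv uv].
by case: (set2_inj (h _ _ Xu Yv uv)) => -[<- <-]; rewrite eqxx Xu Yv ?orbT.
Qed.

Lemma dg_cover (K : {set {set G}}) X :
  trivIset K -> \sum_(B in K) dg B X = dg (cover K) X.
Proof. by move=> tK; rewrite /dg big_trivIset. Qed.

Section Cubic.
Hypothesis cubicG : cubic G.

Lemma dgT X : dg X setT = 3 * #|X|.
Proof.
rewrite /dg (eq_bigr (fun=> 3)) => [|x _]; first by rewrite sum_nat_const mulnC.
rewrite -(cubicG x) -sum1_card big_mkcond [RHS]big_mkcond /=.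
by apply: eq_bigr => y _; rewrite !inE; case: adj.
Qed.

Lemma dg_split A X : dg X A + dg X (~: A) = 3 * #|X|.
Proof. by rewrite -dgT (dgIDr A X setT) setTI setTD. Qed.

Lemma bd_split X : dg X X + bd X = 3 * #|X|.
Proof. exact: dg_split. Qed.

Lemma odd_bd X : odd (bd X) = odd #|X|.
Proof.
have := congr1 odd (bd_split X); rewrite oddD oddM /=.
by rewrite (negbTE (dg_even X)).
Qed.

Lemma bd1 x : bd [set x] = 3.
Proof. by have := bd_split [set x]; rewrite dg11 adjxx cards1. Qed.

Lemma bdU X Y : [disjoint X & Y] -> bd (X :|: Y) + 2 * dg X Y = bd X + bd Y.
Proof.
move=> dXY; have := bd_split (X :|: Y); rewrite dgUl // !dgUr //.
have := bd_split X; have := bd_split Y; rewrite (dgC Y X).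
by rewrite cardsU (eqP (_ : X :&: Y == set0)) ?setI_eq0 // cards0; lia.
Qed.

(** Submodularity of the cut function with its exact defect. Applied to [Y] and to [~: Y], it
    handles both ways of uncrossing. *)
Lemma bd_cross X Y :
  bd X + bd Y = bd (X :&: Y) + bd (X :|: Y) + 2 * dg (X :\: Y) (Y :\: X).
Proof.
have d1 : [disjoint X :&: Y & X :\: Y].
  by rewrite -setI_eq0; apply/eqP/setP=> x; rewrite !inE; do 2!case: (_ \in _).
have d2 : [disjoint X :&: Y & Y :\: X].
  by rewrite -setI_eq0; apply/eqP/setP=> x; rewrite !inE; do 2!case: (_ \in _).
have d3 : [disjoint X :\: Y & Y :\: X].
  by rewrite -setI_eq0; apply/eqP/setP=> x; rewrite !inE; do 2!case: (_ \in _).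
have d4 : [disjoint X & Y :\: X].
  by rewrite -setI_eq0; apply/eqP/setP=> x; rewrite !inE; do 2!case: (_ \in _).
have := bdU d1; have := bdU d2; have := bdU d4.
have -> : X :|: (Y :\: X) = X :|: Y by apply/setP=> x; rewrite !inE; do 2!case: (_ \in _).
have -> : (X :&: Y) :|: (Y :\: X) = Y by apply/setP=> x; rewrite !inE; do 2!case: (_ \in _).
have -> : (X :&: Y) :|: (X :\: Y) = X by apply/setP=> x; rewrite !inE; do 2!case: (_ \in _).
by rewrite (dgIDl Y X); lia.
Qed.

End Cubic.

(** * Perfect matchings as involutions *)

Section Mate.

(** In this form the matching edges leaving [X] are counted by the vertices of [X] that are matched
    outside. *)
Definition mate (m : G -> G) := forall x, m (m x) = x /\ adj x (m x).

Lemma mate_perfect (m : G -> G) : mate m -> perfect_matching [set [set x; m x] | x in G].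
Proof.
move=> mP; split; [split|].
- by apply/subsetP=> _ /imsetP[x _ ->]; rewrite in_edges; case: (mP x).
- apply/trivIsetP=> _ _ /imsetP[x _ ->] /imsetP[y _ ->]; apply: contraR.
  rewrite -setI_eq0 => /set0Pn[z]; rewrite !inE => /andP[/orP[]/eqP-> /orP[]/eqP].
  + by move->.
  + by move->; have [-> _] := mP y; rewrite setUC.
  + by move<-; have [-> _] := mP x; rewrite setUC.
  + by move/(congr1 m); have [-> _] := mP x; have [-> _] := mP y; move->.
- apply/setP=> x; rewrite inE; apply/bigcupP; exists [set x; m x]; rewrite ?set21 //.
  by apply/imsetP; exists x.
Qed.

Lemma perfect_mate (M : {set {set G}}) : perfect_matching M ->
  exists2 m, mate m & M = [set [set x; m x] | x in G].
Proof.
move=> [[sM tM] cM].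
have mex x : exists y, [set x; y] \in M.
  have : x \in cover M by rewrite cM.
  case/bigcupP=> B MB; have /edgesP[u [v [eB _]]] := subsetP sM _ MB; rewrite eB in MB *.
  rewrite !inE => /orP[]/eqP->; first by exists v.
  by exists u; rewrite setUC.
have [m mP] := fin_all_exists mex.
have uniq x y z : [set x; y] \in M -> [set x; z] \in M -> y = z.
  move=> My Mz; have := My; have := Mz; move/(subsetP sM); rewrite in_edges => /adj_neq xz.
  move/(subsetP sM); rewrite in_edges => /adj_neq xy.
  have eqB : [set x; y] = [set x; z].
    apply/eqP; apply/negPn/negP=> neq; move/trivIsetP/(_ _ _ My Mz neq): tM.
    by rewrite -setI_eq0 => /eqP/setP/(_ x); rewrite !inE eqxx.
  by case: (set2_inj eqB) => -[//]; move=> /eqP; rewrite (negbTE xz).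
exists m => [x|].
  split; last by have := subsetP sM _ (mP x); rewrite in_edges.
  by apply: (uniq (m x)); rewrite // setUC.
apply/setP=> B; apply/idP/imsetP => [MB|[x _ ->//]].
have /edgesP[u [v [eB _]]] := subsetP sM _ MB; exists u => //.
by rewrite eB; congr [set u; _]; apply: (uniq u); rewrite // -eB.
Qed.

Lemma card_mate_cut (m : G -> G) X : mate m ->
  #|[set [set x; m x] | x in G] :&: cut X| = #|[set x in X | m x \notin X]|.
Proof.
move=> mP.
have -> : [set [set x; m x] | x in G] :&: cut X =
    [set [set x; m x] | x in [set x in X | m x \notin X]].
  apply/setP=> B; rewrite inE; apply/andP/imsetP.
    case=> /imsetP[x _ ->]; rewrite in_cut => /andP[xy].
    case: (boolP (x \in X)) => Xx Xm; first by exists x; rewrite // inE Xx; case: (_ \in X) Xm.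
    exists (m x); last by have [-> _] := mP x; rewrite setUC.
    by rewrite inE; have [-> _] := mP x; rewrite Xx; case: (_ \in X) Xm.
  case=> x; rewrite inE => /andP[Xx Xm] ->; split; first by apply/imsetP; exists x.
  by rewrite in_cut Xx (negbTE Xm); case: (mP x) => _ ->.
rewrite card_in_imset // => x y; rewrite !inE => /andP[Xx _] /andP[_ Xy].
by move=> /set2_inj[[]//|[xy]]; rewrite -xy Xx in Xy.
Qed.

End Mate.
End EdgeCount.

(** Stated with edge cuts; in cubic graphs edge and vertex connectivity agree. *)
Definition three_connected (G : sgraph) :=
  forall X : {set G}, X != set0 -> X != setT -> 3 <= bd X.

Lemma set0_neq (T : finType) (X : {set T}) x : x \in X -> X != set0.
Proof. by move=> Xx; apply/set0Pn; exists x. Qed.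

Lemma setT_neq (T : finType) (X : {set T}) x : x \notin X -> X != setT.
Proof. by apply: contraNneq => ->; rewrite inE. Qed.

Section MateCount.
Variables (G : sgraph) (m : G -> G).
Hypothesis mP : mate m.
Implicit Types X Y : {set G}.

Lemma mate_graph_sym : symmetric [rel x y | y == m x].
Proof. by move=> x y /=; apply/eqP/eqP=> ->; case: (mP x) (mP y) => [? ?] []. Qed.

Lemma mate_graph_irr : irreflexive [rel x y | y == m x].
Proof. by move=> x /=; apply/negbTE/adj_neq; case: (mP x). Qed.

(** This is [dg_even] in the graph whose edges are those of the matching. *)
Lemma odd_mate X : odd #|[set x in X | m x \notin X]| = odd #|X|.
Proof.
pose H := SGraph mate_graph_sym mate_graph_irr.
have dgH : @dg H X X = #|[set x in X | m x \in X]|.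
  rewrite /dg -sum1_card big_mkcond [RHS]big_mkcond /=; apply: eq_bigr => x _.
  rewrite inE; case: (x \in X) => //=; rewrite -big_mkcondr /=.
  case: (boolP (m x \in X)) => Xm.
    rewrite (bigD1 (m x)) ?Xm ?eqxx //= big1 ?addn0 // => y.
    by case/andP=> /andP[_ /eqP->]; rewrite eqxx.
  by rewrite big1 // => y /andP[Xy /eqP ym]; rewrite -ym Xy in Xm.
have := @dg_even H X; rewrite dgH => /negbTE ev.
rewrite -[in RHS](cardsID [set x | m x \in X] X) oddD.
have -> : X :&: [set x | m x \in X] = [set x in X | m x \in X].
  by apply/setP=> x; rewrite !inE.
have -> : X :\: [set x | m x \in X] = [set x in X | m x \notin X].
  by apply/setP=> x; rewrite !inE andbC.
by rewrite ev.
Qed.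

Lemma mate_leq_dg X Y : #|[set x in X | m x \in Y]| <= dg X Y.
Proof.
have inj : injective (fun x => (x, m x)) by move=> x y /(congr1 fst).
rewrite dgE -(card_imset _ inj).
apply: subset_leq_card; apply/subsetP=> z /imsetP[x]; rewrite inE => /andP[Xx Ym] -> {z}.
by rewrite inE /= Xx Ym; case: (mP x).
Qed.

Lemma mate_out_leq X : #|[set x in X | m x \notin X]| <= bd X.
Proof.
apply: leq_trans (mate_leq_dg X (~: X)); apply: subset_leq_card.
by apply/subsetP=> x; rewrite !inE.
Qed.
End MateCount.

Lemma connected_bd (G : sgraph) (X : {set G}) :
  connected G -> X != set0 -> X != setT -> 0 < bd X.
Proof.
move=> cG /set0Pn[x Xx] XT.
have [y Xy] : exists y, y \notin X.
  by move: XT; rewrite -subTset => /subsetPn[y _]; exists y.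
rewrite lt0n; apply/negP=> /dg_eq0P bd0.
have cl : closed (@adj G) X.
  move=> u v uv; apply/idP/idP => Xu; apply/negPn/negP=> Xv.
    by have := bd0 u v Xu; rewrite inE Xv uv => /(_ isT).
  by have := bd0 v u Xu; rewrite inE Xv adjC uv => /(_ isT).
by have := closed_connect cl (cG x y); rewrite Xx (negbTE Xy).
Qed.

Section Brick.
Variable G : sgraph.
Hypotheses (cubicG : cubic G) (brickG : brick G).
Implicit Types X Y : {set G}.

Lemma brick_tight X :
  (forall m, @mate G m -> #|[set x in X | m x \notin X]| = 1) -> #|X| = 1 \/ #|~: X| = 1.
Proof.
move=> h; case: brickG => _ _; apply=> M /perfect_mate[m mP ->].
by rewrite card_mate_cut // h.
Qed.

Lemma even_card : ~~ odd #|G|.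
Proof. by have := odd_bd cubicG [set: G]; rewrite /bd setCT dg0r cardsT => <-. Qed.

(** With [bd X = 1] the set [X] is odd, so each perfect matching crosses exactly once. The tight cut
    is then trivial, but the cut of a single vertex has size 3. *)
Lemma brick_bd1 X : X != set0 -> X != setT -> bd X != 1.
Proof.
move=> X0 XT; apply/eqP=> b1.
have : #|X| = 1 \/ #|~: X| = 1.
  apply: brick_tight => m mP; have := odd_mate mP X; have := mate_out_leq mP X.
  by rewrite b1 -(odd_bd cubicG X) b1; case: #|_| => [|[]].
by case=> /eqP/cards1P[x e]; [move: b1 | move: b1; rewrite -bdC]; rewrite e bd1.
Qed.

(** Suppose [bd X = 2] and [x] in [X] is an end of a cut edge. Parity and [brick_bd1] force
    [bd (X :\ x) = 3], with two of the three edges going to [x]. A perfect matching uses at most one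
    of these two, so at most two of the three, hence exactly one by parity: a nontrivial tight
    cut. *)
Lemma brick_three_connected : three_connected G.
Proof.
move=> X X0 XT; have := brick_bd1 X0 XT.
have bd0 : 0 < bd X by apply: connected_bd => //; case: brickG => -[].
rewrite leqNgt => b1; apply/negP => blt.
have {b1 bd0 blt} b2 : bd X = 2 by move: b1 bd0 blt; case: (bd X) => [|[|[|]]].
have : 0 < bd X by rewrite b2.
case/dg_gt0P=> x [y [Xx]]; rewrite inE => Xy xy.
have dx : [disjoint [set x] & X :\ x] by rewrite disjoints1 !inE eqxx.
have := bdU cubicG dx; rewrite setD1K // b2 bd1 //.
have cx := cardsD1 x X; rewrite Xx in cx.
have := odd_bd cubicG X; rewrite b2 cx /= => oY.
have {}oY : odd #|X :\ x| by move: oY; case: odd.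
have Y0 : X :\ x != set0 by rewrite -cards_eq0; move: oY; case: #|_|.
have YT : X :\ x != setT by apply: (@setT_neq _ _ x); rewrite !inE eqxx.
have := brick_bd1 Y0 YT; have := odd_bd cubicG (X :\ x).
have dxo : dg [set x] (X :\ x) + dg [set x] (~: X) = 3.
  have := dg_split cubicG X [set x]; rewrite cards1 muln1 => <-.
  by rewrite (dgIDr [set x] [set x] X) (setIidPr _) ?sub1set // dg11 adjxx.
have dxo1 : 0 < dg [set x] (~: X) by apply: (dg_le_edges (x := x) (y := y)); rewrite ?inE.
have bX : dg [set x] (~: X) + dg (X :\ x) (~: X) = 2.
  by rewrite -b2 -dgUl // setD1K.
move=> o1 n1 e1.
have {}e1 : dg [set x] (X :\ x) = 2.
  move: o1 n1 e1; rewrite oY; move: dxo dxo1.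
  by case: (bd _) => [|[|[|[|]]]] //=; lia.
have : #|X :\ x| = 1 \/ #|~: (X :\ x)| = 1.
  apply: brick_tight => m mP.
  have : odd #|[set z in X :\ x | m z \notin X :\ x]|.
    by rewrite odd_mate.
  have : #|[set z in X :\ x | m z \notin X :\ x]| <= 2.
    have le1 := mate_leq_dg mP (X :\ x) (~: X).
    have le2 : #|[set z in X :\ x | m z \in [set x]]| <= 1.
      rewrite /= -[leqRHS](cards1 (m x)); apply: subset_leq_card; apply/subsetP=> z.
      by rewrite !inE => /andP[_ /eqP <-]; case: (mP z) => ->.
    have : #|[set z in X :\ x | m z \notin X :\ x]| <=
        #|[set z in X :\ x | m z \in ~: X]| + #|[set z in X :\ x | m z \in [set x]]|.
      apply: leq_trans (leq_card_setU _ _); apply: subset_leq_card.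
      apply/subsetP=> z; rewrite !inE; case: (z == x) => //=; case: (z \in X) => //=.
      by case: (m z == x); case: (m z \in X).
    by lia.
  by case: #|_| => [|[|[|]]].
case=> [/eqP/cards1P[z e]|].
  by move: e1; rewrite e dg11; case: adj.
have : [set x; y] \subset ~: (X :\ x).
  by apply/subsetP=> z; rewrite !inE => /orP[]/eqP->; rewrite ?eqxx // (negbTE Xy) andbF.
move/subset_leq_card; rewrite cards2 (_ : x != y) ?adj_neq //.
by move=> + e; rewrite e.
Qed.

End Brick.

Section ThreeConnected.
Variable G : sgraph.
Hypotheses (cubicG : cubic G) (conG : three_connected G).
Implicit Types X Y : {set G}.

Lemma even_bd X : X != set0 -> X != setT -> ~~ odd #|X| -> 4 <= bd X.
Proof.
move=> X0 XT; rewrite -(odd_bd cubicG X); have := conG X0 XT.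
by case: (bd X) => [|[|[|[|]]]].
Qed.

(** Both sets are odd and the graph has even order. So either [X :&: Y] and [X :|: Y] are both even,
    or [X :&: ~: Y] and [X :|: ~: Y] are. If the sets cross, the even pair has cuts of total size at
    least 8, while submodularity allows 6. *)
Lemma laminar X Y : bd X = 3 -> bd Y = 3 ->
  [\/ X :&: Y = set0, X \subset Y, Y \subset X | X :|: Y = setT].
Proof.
move=> bX bY.
have cross := bd_cross cubicG X Y; have cross' := bd_cross cubicG X (~: Y).
case: (eqVneq (X :&: Y) set0) => [|I0]; first by constructor 1.
case: (boolP (X \subset Y)) => [|/subsetPn[x Xx Yx]]; first by constructor 2.
case: (boolP (Y \subset X)) => [|/subsetPn[y Yy Xy]]; first by constructor 3.
case: (eqVneq (X :|: Y) setT) => [|UT]; first by constructor 4.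
exfalso; have oX := odd_bd cubicG X; have oY := odd_bd cubicG Y.
rewrite bX in oX; rewrite bY in oY.
have IT : X :&: Y != setT by apply: (@setT_neq _ _ x); rewrite inE (negbTE Yx) andbF.
have U0 : X :|: Y != set0 by apply: (@set0_neq _ _ x); rewrite inE Xx.
have D0 : X :&: ~: Y != set0 by apply: (@set0_neq _ _ x); rewrite !inE Xx.
have DT : X :&: ~: Y != setT by apply: (@setT_neq _ _ y); rewrite !inE (negbTE Xy).
have C0 : X :|: ~: Y != set0 by apply: (@set0_neq _ _ x); rewrite !inE Xx.
have CT : X :|: ~: Y != setT by apply: (@setT_neq _ _ y); rewrite !inE (negbTE Xy) Yy.
rewrite bdC bX bY in cross'; rewrite bX bY in cross.
have := congr1 odd (cardsID Y X); rewrite oddD -oX setDE.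
have := congr1 odd (cardsUI X Y); rewrite !oddD -oX -oY /=.
have := congr1 odd (cardsUI X (~: Y)); rewrite !oddD -oX /=.
have := congr1 odd (cardsC Y); rewrite !oddD -oY (negbTE (even_card cubicG)) /=.
have := @even_bd _ I0 IT; have := @even_bd _ U0 UT.
have := @even_bd _ D0 DT; have := @even_bd _ C0 CT.
clear -cross cross'; move: cross cross'.
by do 5!case: (odd _) => //=; lia.
Qed.

End ThreeConnected.

(** * Barriers of non-removable edges *)

(** The edge [[set a; b]] is the non-removable one, and [[set x; y]] occurs in no perfect matching
    without it. [S] is a Tutte set of the graph without [x], [y] and the edge [[set a; b]], enlarged
    by [x] and [y]; [K] holds its odd parts. The dependence itself is kept as [bar_mate] because the
    triangle argument needs it again. *)
Record barrier (G : sgraph) (a b x y : G) (S : {set G}) (K : {set {set G}}) : Prop :=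
  Barrier {
    bar_adj : adj x y;
    bar_x : x \in S;
    bar_y : y \in S;
    bar_a : a \notin S;
    bar_b : b \notin S;
    bar_triv : trivIset K;
    bar_cover : cover K = ~: S;
    bar_bd : forall B, B \in K -> bd B = 3;
    bar_in : forall u v, u \in S -> v \in S -> adj u v -> [set u; v] = [set x; y];
    bar_out : forall B u v, B \in K -> u \in B -> v \notin B -> v \notin S -> adj u v ->
      [set u; v] = [set a; b];
    bar_sep : forall B, B \in K -> a \in B -> b \notin B;
    bar_mate : forall m, @mate G m -> m x = y -> m a = b }.

(** The chain [3 * o <= bds <= dSc + ext <= 3 * s - dSS + 2 <= 3 * s <= 3 * o] closes up, so no
    inequality in it has slack. *)
Lemma barrier_arith (o s s0 dSS dSc dSe ext bds ab : nat) :
  s0 + 2 <= o -> s = s0 + 2 -> 2 <= dSS -> ext <= ab -> dSS + (dSc + dSe) = 3 * s ->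
  3 * o <= bds -> bds <= dSc + ext -> ab <= 2 ->
  o = s /\ [/\ dSS = 2, dSe = 0 & ext = 2 /\ bds = 3 * o].
Proof. by move=> *; split; last split; lia. Qed.

Section Barrier.
Variable G : sgraph.
Hypotheses (cubicG : cubic G) (conG : three_connected G).
Variables a b : G.
Hypothesis ab : adj a b.
Local Notation d := [set a; b].
Local Notation H := (del_edge [set a; b]).

Lemma del_adjE (u v : G) : @adj H u v = @adj G u v && ([set u; v] != d).
Proof. by []. Qed.

Lemma del_edge_connected : connected H.
Proof.
move=> x y; pose X : {set G} := [set z | connect (@adj H) x z].
apply/negPn/negP=> nxy.
have Xx : x \in X by rewrite inE connect0.
have Xy : y \notin X by rewrite inE.
have := conG (set0_neq Xx) (setT_neq Xy); rewrite -card_cut.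
suff /subset_leq_card : cut X \subset [set d] by rewrite cards1; lia.
apply/subsetP=> h hX; rewrite inE; apply/negPn/negP=> hd.
have /edgesP[u [v [hE uv]]] : h \in edges G by move: hX; rewrite inE => /andP[].
move: hX hd; rewrite hE in_cut uv /= !inE => neq hd.
have uvH : @adj H u v by rewrite del_adjE uv.
move/negP: neq; apply; apply/eqP; apply/idP/idP => c; apply: (connect_trans c).
  exact: connect1.
by apply: connect1; rewrite adj_sym.
Qed.

(** Deleting one edge cannot disconnect the graph, so non-removability must come from an edge that
    lies in no perfect matching avoiding [d]. *)
Lemma not_removable_dep : ~ removable d ->
  exists x y, [/\ adj x y, [set x; y] != d &
    forall m : G -> G, mate m -> m x = y -> m a = b].
Proof.
move=> nr; have [h /andP[hE /asboolPn hM]] : exists h, (h \in edges H) &&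
    ~~ `[< exists2 M, @perfect_matching H M & h \in M >].
  apply: contrapT => nh; apply: nr; split; first by rewrite in_edges.
  split=> [|h hE]; first exact: del_edge_connected.
  by apply: contrapT => hM; apply: nh; exists h; rewrite hE; apply/asboolPn.
have /edgesP[x [y [{hE}hE]]] := hE; rewrite del_adjE => /andP[xy xyd].
exists x, y; split=> // m mP mxy; apply: contrapT => mab; apply: hM.
have mH : @mate H m.
  move=> z; have [mK zm] := mP z; split=> //; rewrite del_adjE zm /=.
  apply/eqP=> /set2_inj[[za mzb]|[zb mza]]; apply: mab; first by rewrite -za.
  by rewrite -mza mK.
exists [set [set x; m x] | x in H]; first exact: mate_perfect.
by apply/imsetP; exists x; rewrite // hE mxy.
Qed.

(** A perfect matching of the graph without [x], [y] and the edge [d], completed by the edge from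
    [x] to [y], would avoid [d], contrary to the dependence. Tutte's theorem therefore supplies a
    deficient set, and [barrier_arith] forces the structure. *)
Lemma not_removable_barrier : ~ removable d -> exists x y S K, barrier a b x y S K.
Proof.
move=> /not_removable_dep[x [y [xy xyd dep]]]; exists x, y.
have xny := adj_neq xy.
pose V := ~: [set x; y].
have evV : ~~ odd #|V|.
  have := cardsC [set x; y]; rewrite cards2 xny /= => /(congr1 odd).
  by rewrite oddD (negbTE (even_card cubicG)) /= => ->.
have [S0 [O [oSO ltSO]]] : exists (S0 : {set G}) (O : {set {set G}}), odd_parts (@adj H) V S0 O /\ #|S0| < #|O|.
  apply: contrapT => nSO.
  have [S0 O oSO|p pP] := @tutte _ (@adj H) (@adj_sym H) V.
    by rewrite leqNgt; apply/negP=> lt; apply: nSO; exists S0, O.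
  pose m z := if z == x then y else if z == y then x else p z.
  have mx : m x = y by rewrite /m eqxx.
  have mP z : m (m z) = z /\ @adj H z (m z).
    rewrite /m; case: (eqVneq z x) => [->|zx].
      by rewrite eq_sym (negbTE xny) eqxx; split; rewrite // del_adjE xy.
    case: (eqVneq z y) => [->|zy].
      by rewrite eqxx; split; rewrite // del_adjE adjC xy setUC.
    have Vz : z \in V by rewrite !inE (negbTE zx).
    have [Vp pK zp] := pP z Vz; move: Vp; rewrite !inE => /norP[/negbTE-> /negbTE->].
    by [].
  have mab : m a = b.
    by apply: dep => // z; have [? /andP[]] := mP z.
  by have [_ /andP[_]] := mP a; rewrite mab eqxx.
have {O oSO ltSO}[O oSO leSO] : exists2 O : {set {set G}}, odd_parts (@adj H) V S0 O & #|S0| + 2 <= #|O| by exact: (odd_parts_parity (@adj_sym H) evV oSO ltSO).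
have [sSV tO oP] := oSO.
pose S := [set x; y] :|: S0.
have cS : #|S| = #|S0| + 2.
  rewrite cardsU cards2 xny (_ : _ :&: S0 = set0) ?cards0 ?subn0 1?addnC //.
  apply/setP=> z; rewrite !inE; apply/negP=> /andP[zxy Sz].
  by have := subsetP sSV _ Sz; rewrite !inE zxy.
have nS z : (z \in V :\: S0) = (z \notin S).
  by rewrite !inE; case: (z == x); case: (z == y); case: (z \in S0).
have Sx : x \in S by rewrite !inE eqxx.
have Sy : y \in S by rewrite !inE eqxx orbT.
clearbody S.
have cutO B u v : B \in O -> u \in B -> v \notin B -> v \notin S -> adj u v ->
    [set u; v] = d.
  move=> OB Bu Bv Sv uv; apply/eqP/negPn/negP=> uvd; have [_ _ cB] := oP B OB.
  have := cB u v Bu; rewrite nS Sv del_adjE uv uvd => /(_ isT isT) Bv'.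
  by rewrite Bv' in Bv.
have OS B : B \in O -> B \subset ~: S.
  by move=> /oP[_ sB _]; apply/subsetP=> z /(subsetP sB); rewrite nS in_setC.
have bdO B : B \in O -> 3 <= bd B.
  move=> OB; have [oB _ _] := oP B OB; apply: conG.
    by apply/eqP=> B0; rewrite B0 cards0 in oB.
  by apply: (@setT_neq _ _ x); apply/negP=> /(subsetP (OS B OB)); rewrite inE Sx.
(* Counts [d] when it leaves [B]. No other edge leaves a part except towards [S], and [d]
   contributes at most 2 over all parts. *)
pose ext (B : {set G}) := ((a \in B) && (b \notin B)) + ((b \in B) && (a \notin B)).
have bd_ext B : B \in O -> bd B <= dg B S + ext B.
  move=> OB; rewrite /bd (dgIDr S).
  have -> : ~: B :&: S = S.
    by apply/setIidPr; rewrite subsetC OS.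
  rewrite leq_add2l; have := @dg_set2_le G B (~: B :\: S) a b.
  rewrite !inE => h; apply: leq_trans (h _) _.
    by move=> u v Bu; rewrite !inE => /andP[Sv Bv]; apply: (cutO B).
  by rewrite /ext; do 2!case: (_ \in B); do 2!case: (_ \in S).
have pred_cover z : \sum_(B in O) (z \in B) = (z \in cover O).
  case: (boolP (z \in cover O)) => [/bigcupP[B OB Bz]|zO].
    rewrite (bigD1 B) //= Bz big1 ?addn0 // => C /andP[OC CB].
    by rewrite (disjointFl (trivIsetP tO _ _ OC OB CB)).
  rewrite big1 // => B OB; case: (boolP (z \in B)) => // Bz.
  by case/bigcupP: zO; exists B.
have dSS2 : 2 <= dg S S.
  rewrite dgE; have <- : #|[set (x, y); (y, x)]| = 2.
    by rewrite cards2 xpair_eqE (negbTE xny).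
  apply: subset_leq_card; apply/subsetP=> p; rewrite !inE => /orP[]/eqP-> /=.
    by rewrite Sx Sy.
  by rewrite Sx Sy adjC.
have sum_ext_le : \sum_(B in O) ext B <= (a \in cover O) + (b \in cover O).
  rewrite -!pred_cover -big_split /=; apply: leq_sum => B _.
  by rewrite /ext; do 2!case: (_ \in B).
have sum_dg : \sum_(B in O) dg B S = dg S (cover O) by rewrite dg_cover // dgC.
have coverS : cover O \subset ~: S by apply/bigcupsP.
have dgS_split : dg S (~: S) = dg S (cover O) + dg S (~: S :\: cover O).
  by rewrite (dgIDr (cover O)) (setIidPr coverS).
have tot := bd_split cubicG S; rewrite /bd dgS_split in tot.
have low : 3 * #|O| <= \sum_(B in O) bd B.
  by rewrite mulnC -sum_nat_const; apply: leq_sum.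
have upp : \sum_(B in O) bd B <= dg S (cover O) + \sum_(B in O) ext B.
  by rewrite -sum_dg -big_split /=; apply: leq_sum.
have leab : (a \in cover O) + (b \in cover O) <= 2 by do 2!case: (_ \in _).
have [eqS [SSe Se [exte bde]]] : #|O| = #|S| /\ [/\ dg S S = 2,
    dg S (~: S :\: cover O) = 0 & \sum_(B in O) ext B = 2 /\ \sum_(B in O) bd B = 3 * #|O|].
  exact: (barrier_arith leSO cS dSS2 sum_ext_le tot low upp leab).
have [aO bO] : a \in cover O /\ b \in cover O.
  by move: sum_ext_le; rewrite exte; case: (a \in _); case: (b \in _).
have sep B : B \in O -> a \in B -> b \notin B.
  move=> OB Ba; apply/negP=> Bb; have : \sum_(C in O) ext C = 0; last by rewrite exte.
  rewrite big1 // => C OC; have [->|CB] := eqVneq C B; first by rewrite /ext Ba Bb.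
  have dCB := trivIsetP tO _ _ OC OB CB.
  by rewrite /ext (disjointFl dCB Ba) (disjointFl dCB Bb).
have cover_eq : cover O = ~: S.
  apply/eqP; rewrite eqEsubset coverS /=; apply/subsetP=> z Sz.
  (* The uncovered rest sends no edge to [S], as [Se] says, and could reach a part only through [d],
     whose ends are both covered. Its cut would be empty. *)
  apply/negPn/negP=> zO; pose E := ~: S :\: cover O.
  have Ez : z \in E by rewrite inE zO Sz.
  have : 3 <= bd E.
    apply: conG; first exact: set0_neq Ez.
    by apply: (@setT_neq _ _ x); rewrite !inE Sx andbF.
  rewrite /bd (dgIDr S) (_ : ~: E :&: S = S); last first.
    by apply/setP=> u; rewrite !inE negb_and !negbK; case: (u \in cover O); case: (u \in S).
  rewrite dgC Se add0n; suff /eqP -> : dg E (~: E :\: S) == 0 by [].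
  apply/dg_eq0P=> u v Eu Ev; apply/negP=> uv.
  have vO : v \in cover O by move: Ev; rewrite 2!inE /E in_setD in_setC; case: (v \in cover O); case: (v \in S).
  move/bigcupP: vO => [B OB Bv].
  have uO : u \notin cover O by move: Eu; rewrite inE => /andP[].
  have uB : u \notin B by apply: contra uO => Bu; apply/bigcupP; exists B.
  have uS : u \notin S by move: Eu; rewrite !inE => /andP[].
  have := cutO B v u OB Bv uB uS; rewrite adjC => /(_ uv) /set2_inj[[_ ua]|[_ ub]].
    by rewrite ua bO in uO.
  by rewrite ub aO in uO.
exists S, O; split=> //.
- by have := subsetP coverS _ aO; rewrite inE.
- by have := subsetP coverS _ bO; rewrite inE.
- move=> B OB; apply/eqP; rewrite eqn_leq bdO // andbT leqNgt; apply/negP=> gtB.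
  have : \sum_(C in O) bd C > 3 * #|O|; last by rewrite bde ltnn.
  rewrite mulnC -sum_nat_const (bigD1 B) //= [X in _ < X](bigD1 B) //=.
  by rewrite -addSn leq_add // leq_sum // => C /andP[OC _]; apply: bdO.
- move=> u v Su Sv uv; apply/eqP/negPn/negP=> neq.
  have : 3 <= dg S S; last by rewrite SSe.
  rewrite dgE; have <- : #|(u, v) |: [set (x, y); (y, x)]| = 3.
    rewrite cardsU1 cards2 !inE !xpair_eqE (negbTE xny) /=.
    have [/andP[/eqP ux /eqP vy]|_] := boolP ((u == x) && (v == y)).
      by rewrite ux vy eqxx in neq.
    have [/andP[/eqP ux /eqP vy]|//] := boolP ((u == y) && (v == x)).
    by rewrite ux vy setUC eqxx in neq.
  apply: subset_leq_card; apply/subsetP=> p; rewrite !in_setU !in_set1 inE.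
  case/or3P=> /eqP-> /=; first by rewrite Su Sv.
    by rewrite Sx Sy.
  by rewrite Sx Sy adjC.
Qed.
End Barrier.

(** * Contracting the blocks of an atom *)

Definition saturated (T : finType) (P : {set {set T}}) (X : {set T}) :=
  forall B, B \in P -> B \subset X \/ [disjoint B & X].

(* The last condition says that contracting the blocks leaves no nontrivial
   cut of size three. *)
Record atom (G : sgraph) (P : {set {set G}}) : Prop := Atom {
  atom_partition : partition P [set: G];
  atom_bd : forall B, B \in P -> bd B = 3;
  atom_card : 3 <= #|P|;
  atom_irr : forall X, saturated P X -> bd X = 3 -> X \in P \/ ~: X \in P }.

Section Quotient.
Variables (G : sgraph) (P : {set {set G}}).
Hypotheses (cubicG : cubic G) (conG : three_connected G) (atomP : atom P).

Let partP := atom_partition atomP.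
Let coverP : cover P = [set: G].
Proof. by case/and3P: partP => /eqP. Qed.
Let trivP : trivIset P.
Proof. by case/and3P: partP. Qed.

Definition block := {B : {set G} | B \in P}.

(** A simple graph suffices for the contraction: by [dg_adj] below, two blocks are never joined by
    two edges. *)
Definition block_adj : rel block :=
  [rel B C | (B != C) && (0 < dg (val B) (val C))].

Lemma block_adj_sym : symmetric block_adj.
Proof. by move=> B C; rewrite /block_adj /= eq_sym dgC. Qed.

Lemma block_adj_irr : irreflexive block_adj.
Proof. by move=> B; rewrite /block_adj /= eqxx. Qed.

Definition quotient : sgraph := SGraph block_adj_sym block_adj_irr.

Lemma pblock_in x : pblock P x \in P.
Proof. by rewrite pblock_mem // coverP inE. Qed.

Definition blk x : quotient := Sub (pblock P x) (pblock_in x).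

Lemma in_blk x : x \in val (blk x).
Proof. by rewrite /= mem_pblock coverP inE. Qed.

Lemma blkE x (B : quotient) : (x \in val B) = (blk x == B).
Proof.
apply/idP/eqP => [Bx|<-]; last exact: in_blk.
by apply: val_inj => /=; apply: (def_pblock trivP (valP B) Bx).
Qed.

Lemma block_ex B : B \in P -> exists C : quotient, val C = B.
Proof. by move=> PB; exists (Sub B PB). Qed.

Lemma block_neq0 (B : quotient) : exists x, blk x = B.
Proof.
have := bd_split cubicG (val B); rewrite (atom_bd atomP (valP B)).
have [B0|[x Bx] _] := set_0Vmem (val B); first by rewrite B0 cards0 muln0 addnC.
by exists x; apply/eqP; rewrite -blkE.
Qed.

Definition lift (U : {set quotient}) : {set G} := [set x | blk x \in U].

Lemma lift1 B : lift [set B] = val B.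
Proof. by apply/setP=> x; rewrite !inE blkE. Qed.

Lemma liftC U : lift (~: U) = ~: lift U.
Proof. by apply/setP=> x; rewrite !inE. Qed.

Lemma lift_saturated U : saturated P (lift U).
Proof.
move=> _ /block_ex[B <-]; case: (boolP (B \in U)) => UB; [left|right].
  by apply/subsetP=> x; rewrite blkE inE => /eqP->.
rewrite disjoints_subset; apply/subsetP=> x; rewrite blkE !inE => /eqP->.
exact: UB.
Qed.

Lemma lift_eq0 U : (lift U == set0) = (U == set0).
Proof.
apply/eqP/eqP => [U0|->]; last by apply/setP=> x; rewrite !inE.
apply/setP=> B; rewrite inE; have [x <-] := block_neq0 B.
by have /setP/(_ x) := U0; rewrite !inE.
Qed.

Lemma lift_eqT U : (lift U == setT) = (U == setT).
Proof. by rewrite -(inj_eq (@setC_inj _)) -liftC setCT lift_eq0 -setCT (inj_eq (@setC_inj _)). Qed.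

Lemma card_quotient : #|quotient| = #|P|.
Proof. exact: card_sig. Qed.

(** The union of the two blocks is even, and a third block keeps it from being the whole graph.
    Hence [6 - 2 * dg (val B) (val C)], the size of its cut, is at least 4. *)
Lemma dg_adj (B C : quotient) : B != C -> dg (val B) (val C) = adj B C.
Proof.
move=> BC; rewrite /adj /= /block_adj /= BC /=.
suff : dg (val B) (val C) <= 1 by case: (dg _ _) => [|[]].
have dBC : [disjoint val B & val C].
  apply: (trivIsetP trivP); rewrite ?(valP B) ?(valP C) //.
have := bdU cubicG dBC; rewrite !(atom_bd atomP (valP _)).
have [b Bb] := block_neq0 B.
have nT : val B :|: val C != setT.
  have [D] : exists D, D \notin [set B; C].
    apply: contrapT => h.
    have : #|quotient| <= #|[set B; C]|.
      rewrite -cardsT; apply/subset_leq_card/subsetP=> D _.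
      by apply: contrapT => nD; apply: h; exists D; apply/negP.
    by rewrite card_quotient leqNgt cards2 BC (atom_card atomP).
  have [d Dd] := block_neq0 D; rewrite !inE => /norP[DB DC].
  by apply: (@setT_neq _ _ d); rewrite inE !blkE Dd (negbTE DB).
have n0 : val B :|: val C != set0.
  by apply: (@set0_neq _ _ b); rewrite inE blkE Bb eqxx.
have ev : ~~ odd #|val B :|: val C|.
  rewrite cardsU (eqP (_ : _ :&: _ == set0)) ?setI_eq0 // cards0 subn0 oddD.
  by rewrite -!(odd_bd cubicG) !(atom_bd atomP (valP _)).
have := even_bd cubicG conG n0 nT ev; lia.
Qed.

Lemma dg_lift (U : {set quotient}) X : dg (lift U) X = \sum_(B in U) dg (val B) X.
Proof.
rewrite /dg (partition_big blk (mem U)) /= => [|x]; last by rewrite inE.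
apply: eq_bigr => B UB; apply: eq_bigl => x; rewrite inE blkE.
case: (eqVneq (blk x) B) => [->|_]; rewrite ?andbF // andbT; exact: UB.
Qed.

Lemma dg_quotient (U W : {set quotient}) :
  [disjoint U & W] -> dg U W = dg (lift U) (lift W).
Proof.
move=> dUW; rewrite dg_lift [LHS]/dg; apply: eq_bigr => B UB.
rewrite dgC dg_lift; apply: eq_bigr => C WC; rewrite dgC dg_adj //.
by apply: contraTneq WC => <-; rewrite (disjointFr dUW UB).
Qed.

Lemma bd_quotient (U : {set quotient}) : bd U = bd (lift U).
Proof. by rewrite /bd dg_quotient ?liftC // -setI_eq0 setICr. Qed.

Lemma quotient_cubic : cubic quotient.
Proof.
move=> B; have := bd_quotient [set B]; rewrite lift1 (atom_bd atomP (valP B)) => <-.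
rewrite /bd dg1; congr #|pred_of_set _|; apply/setP=> C; rewrite !inE.
by case: eqP => // ->; rewrite adjxx.
Qed.

Lemma quotient_three_connected : three_connected quotient.
Proof.
move=> U U0 UT; rewrite bd_quotient; apply: conG; first by rewrite lift_eq0.
by rewrite lift_eqT.
Qed.

Lemma quotient_irr (U : {set quotient}) : bd U = 3 -> #|U| = 1 \/ #|~: U| = 1.
Proof.
rewrite bd_quotient => bU.
have l1 W : lift W \in P -> #|W| = 1.
  move=> /block_ex[B eB]; apply/eqP/cards1P; exists B; apply/setP=> C.
  rewrite inE; have [x <-] := block_neq0 C.
  by have /setP/(_ x) := eB; rewrite blkE inE => <-.
by case: (atom_irr atomP (@lift_saturated U) bU); rewrite -?liftC => /l1; [left|right].
Qed.

Lemma card_coblock (B : quotient) : 1 < #|~: val B|.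
Proof.
have : 1 < #|[set~ B]|.
  by have := atom_card atomP; rewrite -card_quotient cardsC1; case: #|_|.
case/card_gt1P=> C [D []]; rewrite !inE => CB DB CD.
have [c Cc] := block_neq0 C; have [d Dd] := block_neq0 D.
apply/card_gt1P; exists c, d; rewrite !inE !blkE Cc Dd; split=> //.
by apply: contraNneq CD => cd; rewrite -Cc -Dd cd.
Qed.

Lemma adj_blk x y : adj x y -> blk x != blk y -> adj (blk x) (blk y).
Proof.
move=> xy neq; rewrite /adj /= /block_adj /= neq /=.
by apply: dg_le_edges xy; apply: in_blk.
Qed.

Lemma adj_blkP (B C : quotient) : adj B C ->
  B != C /\ exists x y, [/\ blk x = B, blk y = C & adj x y].
Proof.
move=> BC; split; first exact: adj_neq.
move: BC; rewrite /adj /= /block_adj /= => /andP[BC /dg_gt0P[x [y [Bx Cy xy]]]].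
by exists x, y; split=> //; apply/eqP; rewrite -blkE.
Qed.

End Quotient.

(** Deleting both edges leaves a bipartite graph with colour classes [S] and [~: S]; each edge lies
    inside one class. *)
Record doubleton (A : sgraph) (S : {set A}) (x y a b : A) : Prop := Doubleton {
  dbl_x : x \in S; dbl_y : y \in S; dbl_xy : adj x y;
  dbl_a : a \notin S; dbl_b : b \notin S; dbl_ab : adj a b;
  dbl_cut : forall u v, adj u v -> (u \in S) = (v \in S) ->
    [set u; v] = [set x; y] \/ [set u; v] = [set a; b] }.

Definition big_blocks (G : sgraph) (P : {set {set G}}) : {set quotient P} :=
  [set B | 1 < #|(val B : {set G})|].

(** Eliminating [dKS] and [dSo] gives [3 * SB + 2 * out = 3 * KB + inner + 3] with [out <= 3].
    Modulo 3 this leaves [out] equal to 0 or 3 for [inner = 0], and equal to 1 for [inner = 2]. *)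
Lemma block_arith1 (out dKS KB SB inner dSo : nat) :
  3 * KB = dKS + out -> 3 = dSo + out -> 3 * SB = inner + dKS + dSo ->
  inner = 0 -> out = 3 /\ dSo = 0 \/ out = 0 /\ SB = KB.+1.
Proof. lia. Qed.

Lemma block_arith2 (out dKS KB SB inner dSo : nat) :
  3 * KB = dKS + out -> 3 = dSo + out -> 3 * SB = inner + dKS + dSo ->
  inner = 2 -> out = 1.
Proof. lia. Qed.

(** * Projecting a barrier of the graph to an atom *)

Section Link.
Variable G : sgraph.
Hypotheses (cubicG : cubic G) (brickG : brick G).
Let conG := brick_three_connected cubicG brickG.
Variable P : {set {set G}}.
Hypothesis atomP : atom P.
Local Notation quotient := (quotient P).
Local Notation blk := (blk atomP).
Variables (a b x y : G) (S : {set G}) (K : {set {set G}}).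
Hypothesis bar : barrier a b x y S K.

Let blkE := blkE atomP.

(** The number of cut edges of the block whose inner end avoids [S]. Values 0 and 1 put the block on
    the side of [S] in the atom, larger ones on the other side. *)
Definition out (B : quotient) := dg (val B :\: S) (~: val B).

Hypothesis split_xy : forall B : quotient, (a \in val B) || (b \in val B) ->
  ~~ ((x \in val B) && (y \in val B)).

Lemma part_sub C : C \in K -> C \subset ~: S.
Proof. by move=> KC; rewrite -(bar_cover bar) (bigcup_sup C). Qed.

(** By [laminar] no block crosses [C]. A block that together with [C] covers the graph would contain
    [x], [y] and one of [a], [b], against [split_xy]. So [C] lies in a block or is a union of
    blocks, and [atom_irr] then makes it a block or the complement of one; the complement is
    excluded by [split_xy] again. *)
Lemma part_block C : C \in K -> exists B : quotient, C \subset val B.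
Proof.
move=> KC; apply: contrapT => nB.
have xC : x \notin C by apply/negP=> /(subsetP (part_sub KC)); rewrite inE (bar_x bar).
have yC : y \notin C by apply/negP=> /(subsetP (part_sub KC)); rewrite inE (bar_y bar).
have abC : (a \notin C) || (b \notin C).
  by have := bar_sep bar KC; case: (a \in C) => //= ->.
have satC : saturated P C.
  move=> _ /block_ex[B <-].
  case: (laminar cubicG conG (bar_bd bar KC) (atom_bd atomP (valP B))).
  - by move=> CB0; right; rewrite -setI_eq0 setIC CB0.
  - by move=> CB; case: nB; exists B.
  - by left.
  - move=> CBT; have inB z : z \notin C -> z \in val B.
      by move=> zC; have := in_setT z; rewrite -CBT inE (negbTE zC).
    by have := @split_xy B; rewrite (inB x) // (inB y) //; case/orP: abC => /inB->; rewrite ?orbT => /(_ isT).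
case: (atom_irr atomP satC (bar_bd bar KC)) => /block_ex[B eB].
  by apply: nB; exists B; rewrite eB.
by have := @split_xy B; rewrite eB !inE abC xC yC => /(_ isT).
Qed.

Section Types.
Variable B : quotient.
Hypotheses (aB : a \notin val B) (bB : b \notin val B).
Local Notation V := (val B).

Let KB := [set C in K | C \subset V].

Lemma cover_parts_in : cover KB = V :\: S.
Proof.
apply/setP=> z; apply/bigcupP/idP.
  case=> C; rewrite !inE => /andP[KC CB] Cz; rewrite (subsetP CB) // andbT.
  by have := subsetP (part_sub KC) _ Cz; rewrite inE.
rewrite inE => /andP[Sz Bz].
have : z \in cover K by rewrite (bar_cover bar) inE.
case/bigcupP=> C KC Cz; exists C; rewrite // !inE KC /=.
have [D CD] := part_block KC; have := subsetP CD _ Cz.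
by move: Bz; rewrite !blkE => /eqP-> /eqP->.
Qed.

Lemma no_cross u v : u \in V :\: S -> v \notin S ->
  (forall C, C \in KB -> u \in C -> v \notin C) -> ~~ adj u v.
Proof.
rewrite -cover_parts_in => /bigcupP[C KC Cu] Sv /(_ _ KC Cu) vC; apply/negP=> uv.
have /andP[KC' CB] : (C \in K) && (C \subset V) by move: KC; rewrite inE.
have Bu := subsetP CB _ Cu.
case: (set2_inj (bar_out bar KC' Cu vC Sv uv)) => -[e _].
  by have := aB; rewrite -e Bu.
by have := bB; rewrite -e Bu.
Qed.

Let trivKB : trivIset KB.
Proof. by apply: trivIsetS (bar_triv bar); apply/subsetP=> C; rewrite inE => /andP[]. Qed.

Lemma parts_count : 3 * #|KB| = dg (V :\: S) (V :&: S) + out B.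
Proof.
have -> : out B = dg (V :\: S) (S :\: V).
  rewrite /out (dgIDr S) [X in _ + X](_ : _ = 0) ?addn0.
    by congr dg; apply/setP=> z; rewrite !inE andbC.
  apply/eqP/dg_eq0P=> u v Vu; rewrite !inE => /andP[Sv Vv]; apply: no_cross => // C.
  by rewrite inE => /andP[_ CB] _; apply: contra Vv; apply: (subsetP CB).
rewrite setIC -dgIDr -cover_parts_in -dg_cover // mulnC -sum_nat_const.
apply: eq_bigr => C KC; have /andP[KC' CB] : (C \in K) && (C \subset V) by move: KC; rewrite inE.
rewrite -(bar_bd bar KC') /bd (dgIDr S) [X in _ + X](_ : _ = 0) ?addn0.
  by congr dg; apply/setIidPr; rewrite subsetC part_sub.
apply/eqP/dg_eq0P=> u v Cu; rewrite !inE => /andP[Sv Cv]; apply: no_cross => //.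
  by rewrite -cover_parts_in; apply/bigcupP; exists C.
move=> D; rewrite inE => /andP[KD _] Du; suff -> : D = C by [].
apply/eqP/negPn/negP=> DC; have := trivIsetP (bar_triv bar) _ _ KD KC' DC.
by move/disjointFr/(_ Du); rewrite Cu.
Qed.

Lemma inner_count : dg (V :&: S) (V :&: S) = if (x \in V) && (y \in V) then 2 else 0.
Proof.
have xy := bar_adj bar; have [Sx Sy] := (bar_x bar, bar_y bar).
have le := @dg_set2_le G (V :&: S) (V :&: S) x y.
rewrite !inE Sx Sy !andbT (andbC (y \in V)) in le.
have {}le : dg (V :&: S) (V :&: S) <= ((x \in V) && (y \in V)) + ((x \in V) && (y \in V)).
  by apply: le => u v; rewrite !inE => /andP[_ Su] /andP[_ Sv]; apply: bar_in bar _ _ Su Sv.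
case: ifP le => [/andP[Vx Vy]|_]; last by case: (dg _ _).
have : 0 < dg (V :&: S) (V :&: S).
  by apply: (dg_le_edges (x := x) (y := y)); rewrite // inE ?Vx ?Vy.
by have := dg_even (V :&: S); case: (dg _ _) => [|[|[|]]].
Qed.

(** No edge leaves [V] from outside [S], so each odd part in [V] sends a matching edge into
    [V :&: S]. Only one vertex of [V :&: S] can then be matched outside [V]: the cut is tight, hence
    trivial, and [card_coblock] tells which side is the single vertex. *)
Lemma block_tight : out B = 0 -> #|V :&: S| = #|KB|.+1 -> #|V| = 1.
Proof.
move=> out0 cS.
have noout u v : u \in V -> u \notin S -> v \notin V -> ~~ adj u v.
  move=> Vu Su Vv; have /eqP/dg_eq0P := out0; apply; first by rewrite inE Su Vu.
  by rewrite inE.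
suff [//|V1] : #|V| = 1 \/ #|~: V| = 1.
  by have := card_coblock cubicG atomP B; rewrite V1.
apply: (brick_tight brickG) => m mP.
have odd1 : odd #|[set z in V | m z \notin V]|.
  by rewrite (odd_mate mP) -(odd_bd cubicG) (atom_bd atomP (valP B)).
suff : #|[set z in V | m z \notin V]| <= 1 by move: odd1; case: #|_| => [|[]].
have adjm z : adj z (m z) by have [] := mP z.
have mK z : m (m z) = z by have [] := mP z.
have parts_le : #|KB| <= #|[set z in V :\: S | m z \in V :&: S]|.
  apply: (@leq_trans (\sum_(C in KB) #|[set z in C | m z \in V :&: S]|)).
    rewrite -sum1_card; apply: leq_sum => C KC.
    have /andP[KC' CB] : (C \in K) && (C \subset V) by move: KC; rewrite inE.
    have : odd #|[set z in C | m z \notin C]|.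
      by rewrite (odd_mate mP) -(odd_bd cubicG) (bar_bd bar KC').
    case: (set_0Vmem [set z in C | m z \notin C]) => [->|[z]]; first by rewrite cards0.
    rewrite inE => /andP[Cz Cm] _; apply/card_gt0P; exists z.
    have Vz := subsetP CB _ Cz.
    have Sz : z \notin S by have := subsetP (part_sub KC') _ Cz; rewrite inE.
    have Vm : m z \in V by apply/negPn/negP=> Vm; have := noout _ _ Vz Sz Vm; rewrite adjm.
    rewrite !inE Cz Vm /=; apply/negPn/negP=> Sm.
    have /negP[] : ~~ adj z (m z); last exact: adjm.
    apply: no_cross => //; first by rewrite inE Sz.
    move=> D; rewrite inE => /andP[KD _] Dz; suff -> : D = C by [].
    apply/eqP/negPn/negP=> DC; have := trivIsetP (bar_triv bar) _ _ KD KC' DC.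
    by move/disjointFr/(_ Dz); rewrite Cz.
  rewrite -cover_parts_in -[X in _ <= X]sum1_card.
  rewrite (eq_bigl (fun z => (z \in cover KB) && (m z \in V :&: S))); last first.
    by move=> z; rewrite inE.
  rewrite big_mkcondr big_trivIset //=; apply: leq_sum => C _.
  by rewrite -sum1_card big_mkcond [X in _ <= X]big_mkcond /=; apply: leq_sum => z _; rewrite inE; case: (_ \in C).
have img : #|[set z in V :\: S | m z \in V :&: S]| <= #|[set z in V :&: S | m z \in V]|.
  rewrite -(card_imset _ (can_inj mK)); apply: subset_leq_card.
  apply/subsetP=> z /imsetP[w]; rewrite !inE => /and3P[/andP[_ Vw] Vm Sm] -> {z}.
  by rewrite Vm Sm mK.
have : #|[set z in V | m z \notin V]| <= #|[set z in V :&: S | m z \notin V]|.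
  apply: subset_leq_card; apply/subsetP=> z; rewrite !inE => /andP[Vz Vm].
  rewrite Vz Vm andbT /=; apply/negPn/negP=> Sz.
  by have := noout _ _ Vz Sz Vm; rewrite adjm.
have := cardsID [set z | m z \in V] (V :&: S).
have -> : V :&: S :&: [set z | m z \in V] = [set z in V :&: S | m z \in V].
  by apply/setP=> z; rewrite !inE.
have -> : V :&: S :\: [set z | m z \in V] = [set z in V :&: S | m z \notin V].
  by apply/setP=> z; rewrite !inE andbC.
rewrite cS; move: parts_le img; clear; lia.
Qed.

Lemma block_types :
  [\/ [/\ out B = 3, ~~ ((x \in V) && (y \in V)) & forall p q, p \in S -> p \in V -> q \notin V -> ~~ adj p q],
      out B = 0 /\ (exists2 s, s \in S & V = [set s])
    | [/\ out B = 1, x \in V & y \in V]].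
Proof.
have cB : 3 = dg (V :&: S) (~: V) + out B.
  by rewrite -(atom_bd atomP (valP B)) /bd (dgIDl S).
have cS : 3 * #|V :&: S| = dg (V :&: S) (V :&: S) + dg (V :\: S) (V :&: S) + dg (V :&: S) (~: V).
  by rewrite -(dg_split cubicG V) (dgIDr S (V :&: S) V) (dgC (V :&: S) (V :\: S)).
have ic := inner_count; move: ic; case: ifP => [/andP[Vx Vy]|/negbT nV] ic.
  by constructor 3; split=> //; apply: block_arith2 parts_count cB cS ic.
case: (block_arith1 parts_count cB cS ic) => [[o3 d0]|[o0 cVS]].
  constructor 1; split=> // p q Sp Vp Vq; have /eqP/dg_eq0P := d0; apply; rewrite inE ?Vp //.
constructor 2; split=> //; have V1 := block_tight o0 cVS.
have /eqP/cards1P[s Vs] := V1; exists s => //.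
have : 0 < #|V :&: S| by rewrite cVS.
by case/card_gt0P=> z; rewrite Vs !inE => /andP[/eqP->].
Qed.
End Types.

(* The case [out B = 1] is the only way a nontrivial block can lie on the side
   of [S]; it then contains both [x] and [y]. *)
Lemma link (u1 u2 : G) (SA := [set B : quotient | out B <= 1]) :
  adj u1 u2 -> blk u1 != blk u2 -> (a \in val (blk u1)) || (b \in val (blk u1)) ->
  u2 \notin S ->
  (forall B : quotient, (a \in val B) || (b \in val B) -> 1 < out B /\
     forall p q, p \in S -> p \in val B -> q \notin val B -> adj p q -> p = u1 /\ q = u2) ->
  (forall p q, blk p != blk q -> [set p; q] = [set a; b] -> [set p; q] = [set u1; u2]) ->
  #|SA :&: big_blocks P| <= 1 /\
  ((exists X Y, doubleton SA X Y (blk u1) (blk u2)) \/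
   [/\ forall B C, adj B C -> (B \in SA) != (C \in SA), blk u1 \notin SA, blk u2 \in SA
      & blk u2 \in big_blocks P]).
Proof.
move=> u12 nu12 abu1 Su2 outab abu.
have nab (B : quotient) : B \in SA -> (a \notin val B) /\ (b \notin val B).
  rewrite inE leqNgt => oB; apply/norP; apply: contra oB; by case/outab.
have typ (B : quotient) : B \in SA ->
    (out B = 0 /\ exists2 s, s \in S & val B = [set s]) \/ [/\ out B = 1, x \in val B & y \in val B].
  move=> SB; have [aB bB] := nab _ SB; case: (block_types aB bB); [|by left|by right].
  by move=> [oB _ _]; move: SB; rewrite inE oB.
have inSA p q : p \in S -> adj p q -> blk p != blk q ->
    blk p \in SA \/ (p = u1 /\ q = u2).
  move=> Sp pq npq; have qp : q \notin val (blk p) by rewrite blkE eq_sym.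
  have pp : p \in val (blk p) by rewrite blkE.
  case: (boolP ((a \in val (blk p)) || (b \in val (blk p)))) => [/outab[_ h]|/norP[aB bB]].
    by right; apply: h.
  case: (block_types aB bB) => [[_ _ /(_ p q Sp pp qp)]|[o0 _]|[o1 _ _]]; rewrite ?pq //.
    by left; rewrite inE o0.
  by left; rewrite inE o1.
have cross p q : p \notin S -> q \notin S -> adj p q -> blk p != blk q ->
    [set p; q] = [set u1; u2].
  move=> Sp Sq pq npq; apply: (abu _ _ npq).
  have : p \in cover K by rewrite (bar_cover bar) inE.
  case/bigcupP=> C KC Cp; apply: (bar_out bar KC Cp) => //.
  have [D CD] := part_block KC; apply: contra npq => Cq.
  by have := subsetP CD _ Cp; have := subsetP CD _ Cq; rewrite !blkE => /eqP-> /eqP->.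
have u1SA : blk u1 \notin SA by apply/negP=> /nab[h1 h2]; rewrite (negbTE h1) (negbTE h2) in abu1.
have singleton_in (B : quotient) p : (exists2 s, s \in S & val B = [set s]) -> blk p = B -> p \in S.
  by move=> [s Ss eB] /eqP; rewrite -blkE eB inE => /eqP->.
have pair_blk p q r t : [set p; q] = [set r; t] -> [set blk p; blk q] = [set blk r; blk t].
  by case/set2_inj=> -[-> ->]; rewrite // setUC.
have same B C : adj B C -> B \notin SA -> C \notin SA -> [set B; C] = [set blk u1; blk u2].
  case/(@adj_blkP _ _ atomP) => npq [p [q [eB eC pq]]]; rewrite -eB -eC in npq * => SB SC.
  case: (boolP (p \in S)) => Sp.
    by case: (inSA _ _ Sp pq npq) => [h|[-> ->]//]; rewrite h in SB.
  case: (boolP (q \in S)) => Sq.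
    have [||qSA|[-> ->]] := inSA q p Sq; [by rewrite adjC|by rewrite eq_sym| |].
      by rewrite qSA in SC.
    by rewrite setUC.
  exact/pair_blk/cross.
have bigSA (B : quotient) : B \in SA -> B \in big_blocks P -> [/\ out B = 1, x \in val B & y \in val B].
  by move=> SB; rewrite inE; case: (typ _ SB) => // -[_ [s _ ->]]; rewrite cards1.
have xny := adj_neq (bar_adj bar).
split.
  rewrite -(cards1 (blk x)); apply: subset_leq_card; apply/subsetP=> B.
  by rewrite !in_setI in_set1 => /andP[SB /(bigSA _ SB)[_ xB _]]; rewrite eq_sym -blkE.
have fat (B : quotient) : x \in val B -> y \in val B -> B \in big_blocks P.
  by move=> xB yB; rewrite inE; apply/card_gt1P; exists x, y.
have out_uniq (B : quotient) p q p' q' : out B = 1 -> p \in val B -> p \notin S -> q \notin val B -> adj p q ->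
    p' \in val B -> p' \notin S -> q' \notin val B -> adj p' q' -> p = p' /\ q = q'.
  move=> oB pB pS qB pq pB' pS' qB' pq'.
  suff /andP[/eqP-> /eqP->] : (p == p') && (q == q') by [].
  apply/negPn/negP=> neq.
  have : 1 < out B; last by rewrite oB.
  rewrite /out dgE; apply/card_gt1P; exists (p, q), (p', q'); rewrite !inE /=.
  by rewrite pB pS qB pq pB' pS' qB' pq'; split=> //; apply: contraNneq neq => -[-> ->]; rewrite !eqxx.
(* If [blk u2] is in [SA], it must be the block of [x] and [y], because [u2] is not in [S]. Its only
   exit from outside [S] is then the edge from [u2] to [u1], and no edge of the quotient stays on
   one side. *)
case: (boolP (blk u2 \in SA)) => u2SA; [right|left].
  have [o2 x2 y2] : [/\ out (blk u2) = 1, x \in val (blk u2) & y \in val (blk u2)].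
    by case: (typ _ u2SA) => // -[_ /singleton_in/(_ erefl) Su2']; rewrite Su2' in Su2.
  split=> //; last exact: fat.
  have nSASA p q : adj p q -> blk p != blk q -> blk p \in SA -> blk q \in SA ->
      p \in S -> False.
    move=> pq npq pSA qSA Sp.
    case: (boolP (q \in S)) => Sq.
      have := bar_in bar Sp Sq pq; move: x2 y2; rewrite !blkE => /eqP ex /eqP ey.
      by move/pair_blk; rewrite ex ey => /set2_inj[[e1 e2]|[e1 e2]]; rewrite e1 e2 eqxx in npq.
    case: (typ _ qSA) => [[_ /singleton_in/(_ erefl) Sq']|[oq xq _]].
      by rewrite Sq' in Sq.
    have eq2 : blk q = blk u2.
      by move: xq x2; rewrite !blkE => /eqP<- /eqP.
    have [qu2 pu1] : q = u2 /\ p = u1.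
      apply: (out_uniq (blk u2)); rewrite ?blkE ?eqxx ?eq2 1?adjC //; first by rewrite -eq2.
    by rewrite pu1 (negbTE u1SA) in pSA.
  move=> B C BC; apply/negP=> /eqP eBC.
  case: (boolP (B \in SA)) => SB; last first.
    have SC : C \notin SA by rewrite -eBC.
    have /set2_inj[[eB eC]|[eB eC]] := same _ _ BC SB SC.
      by rewrite eC u2SA in SC.
    by rewrite eB u2SA in SB.
  have SC : C \in SA by rewrite -eBC.
  have [npq [p [q [eB eC pq]]]] := adj_blkP atomP BC; rewrite -eB -eC in npq SB SC.
  case: (boolP (p \in S)) => Sp; first exact: (nSASA p q).
  case: (boolP (q \in S)) => Sq; first by apply: (nSASA q p); rewrite // 1?adjC 1?eq_sym.
  have /pair_blk/set2_inj[[e1 e2]|[e1 e2]] := cross _ _ Sp Sq pq npq.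
    by rewrite e1 (negbTE u1SA) in SB.
  by rewrite e2 (negbTE u1SA) in SC.
have nu2SA := u2SA.
have dblI X Y : X \in SA -> Y \in SA -> adj X Y ->
    (forall B C, adj B C -> B \in SA -> C \in SA -> [set B; C] = [set X; Y]) ->
    doubleton SA X Y (blk u1) (blk u2).
  move=> SX SY XY h; split=> //; first exact: adj_blk.
  move=> B C BC; case: (boolP (B \in SA)) => SB SC; [left|right].
    exact: h.
  by apply: same; rewrite // -SC.
have inSA' p q : p \in S -> adj p q -> blk p != blk q -> blk q \in SA -> blk p \in SA.
  by move=> Sp pq npq qSA; case: (inSA _ _ Sp pq npq) => // -[_ qu]; rewrite qu (negbTE u2SA) in qSA.
have [Sx Sy xy] := And3 (bar_x bar) (bar_y bar) (bar_adj bar).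
(* When one block contains both [x] and [y], their edge disappears in the quotient. Its place in the
   doubleton is taken by the only edge that leaves this block from outside [S]. *)
case: (eqVneq (blk x) (blk y)) => [exy|nxy].
  have xin : x \in val (blk x) by rewrite blkE.
  have yin : y \in val (blk x) by rewrite blkE exy.
  have xyab : ~~ ((a \in val (blk x)) || (b \in val (blk x))).
    by apply/negP=> /split_xy; rewrite xin yin.
  have [aB bB] := norP xyab.
  have oB : out (blk x) = 1.
    case: (block_types aB bB) => [[_]|[o0 [s _ es]]|[] //]; first by rewrite xin yin.
    by move: xin yin; rewrite es !inE => /eqP xs /eqP ys; rewrite xs ys eqxx in xny.
  have : 0 < out (blk x) by rewrite oB.
  case/dg_gt0P=> q [p []]; rewrite in_setD in_setC => /andP[Sq qB] pB qp.
  have eq : blk q = blk x by apply/eqP; rewrite -blkE.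
  have npq : blk p != blk x by rewrite -blkE.
  have xSA : blk x \in SA by rewrite inE oB.
  have Sp : p \in S.
    apply/negPn/negP=> Sp; have := cross q p Sq Sp qp; rewrite eq eq_sym => /(_ npq).
    move/pair_blk/set2_inj=> [[e1 _]|[e1 _]].
      by rewrite -e1 eq xSA in u1SA.
    by rewrite -e1 eq xSA in u2SA.
  have pSA : blk p \in SA by apply: (inSA' p q); rewrite ?eq // adjC.
  exists (blk p), (blk x); apply: dblI => //.
    by rewrite -eq; apply: adj_blk; rewrite ?eq // adjC.
  have main r t : adj r t -> blk r != blk t -> blk r \in SA -> blk t \in SA -> r \in S ->
      [set blk r; blk t] = [set blk p; blk x].
    move=> rt nrt rSA tSA Sr; case: (boolP (t \in S)) => St.
      have /pair_blk/set2_inj[[e1 e2]|[e1 e2]] := bar_in bar Sr St rt.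
        by rewrite e1 e2 exy eqxx in nrt.
      by rewrite e1 e2 exy eqxx in nrt.
    case: (typ _ tSA) => [[_ /singleton_in/(_ erefl) St']|[ot xt _]].
      by rewrite St' in St.
    have et : blk t = blk x by apply/esym/eqP; rewrite -blkE.
    have [-> ->] : t = q /\ r = p.
      by apply: (out_uniq (blk x)); rewrite ?blkE ?et ?eq // 1?adjC // -et.
    by rewrite eq.
  move=> B C BC SB SC.
  have [npq' [r [t [eB eC rt]]]] := adj_blkP atomP BC; rewrite -eB -eC in npq' SB SC *.
  case: (boolP (r \in S)) => Sr; first exact: main.
  case: (boolP (t \in S)) => St.
    by rewrite setUC; apply: main; rewrite // 1?adjC 1?eq_sym.
  have /pair_blk/set2_inj[[e1 e2]|[e1 e2]] := cross _ _ Sr St rt npq'.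
    by rewrite e1 (negbTE u1SA) in SB.
  by rewrite e1 (negbTE u2SA) in SB.
have xSA : blk x \in SA by case: (inSA x y Sx xy nxy) => // -[_ yu]; rewrite -yu Sy in Su2.
have ySA : blk y \in SA.
  case: (inSA y x) => //; rewrite 1?adjC 1?eq_sym // => -[_ xu].
  by rewrite -xu Sx in Su2.
exists (blk x), (blk y); apply: dblI => //; first exact: adj_blk.
have single (B : quotient) r : B \in SA -> blk r = B -> r \in S.
  move=> SB rB; case: (typ _ SB) => [[_ /singleton_in/(_ rB)] //|[_ xB yB]].
  by move: nxy; move: xB yB; rewrite !blkE => /eqP-> /eqP->; rewrite eqxx.
move=> B C BC SB SC; have [npq' [r [t [eB eC rt]]]] := adj_blkP atomP BC.
rewrite -eB -eC; apply: pair_blk.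
by apply: (bar_in bar) rt; [apply: single eB | apply: single eC].
Qed.
End Link.

(** * Doubletons in a graph without nontrivial 3-cuts *)

Section Doubleton.
Variable A : sgraph.
Hypotheses (cubicA : cubic A) (conA : three_connected A).
Implicit Types (S U : {set A}) (t u v w x y a b c : A).

Lemma doubletonC S x y a b : doubleton S x y a b -> doubleton (~: S) a b x y.
Proof.
case=> Sx Sy xy Sa Sb ab h; split; rewrite ?inE ?Sx ?Sy //.
move=> u v uv; rewrite !inE => /negb_inj/(h _ _ uv)[]; by [right|left].
Qed.

Lemma doubletonS S x y a b : doubleton S x y a b -> doubleton S x y b a.
Proof.
case=> Sx Sy xy Sa Sb ab h; split=> //; first by rewrite adjC.
by move=> u v uv /(h _ _ uv); rewrite (setUC [set b]).
Qed.

Lemma neighbours3 u p q r v : adj u p -> adj u q -> adj u r -> p != q -> p != r -> q != r ->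
  adj u v -> [|| v == p, v == q | v == r].
Proof.
move=> up uq ur pq pr qr uv.
have sub : [set p; q; r] \subset [set z | adj u z].
  by apply/subsetP=> z; rewrite !inE -orbA => /or3P[]/eqP->.
have c3 : #|[set p; q; r]| = 3.
  by rewrite setUC cardsU1 cards2 pq !inE negb_or eq_sym pr eq_sym qr.
have /eqP eN : [set p; q; r] == [set z | adj u z] by rewrite eqEcard sub cubicA c3.
by have : v \in [set z | adj u z] by [rewrite inE]; rewrite -eN !inE -orbA.
Qed.

Lemma third_neighbour t a b : adj t a -> adj t b -> a != b ->
  exists c, [/\ adj t c, c != a & c != b].
Proof.
move=> ta tb ab; have := cardsD1 a [set z | adj t z]; rewrite cubicA inE ta.
have := cardsD1 b ([set z | adj t z] :\ a); rewrite !inE eq_sym ab tb /= => -> [].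
move/esym/eqP/cards1P=> [c ec]; exists c.
by have := set11 c; rewrite -ec !inE => /and3P[-> -> ->].
Qed.

Hypothesis irrA : forall U : {set A}, bd U = 3 -> #|U| = 1 \/ #|~: U| = 1.

(* The symmetric difference of the two sides is bounded by the four edges of
   the two doubletons; removing [t] from its side leaves a cut of size three. *)
Lemma adjacent_doubletons S1 S2 x1 y1 x2 y2 t a1 a2 c :
  doubleton S1 x1 y1 t a1 -> doubleton S2 x2 y2 t a2 -> a1 != a2 ->
  adj t c -> c != a1 -> c != a2 ->
  [/\ c \in [set x1; y1], c \in [set x2; y2] & [set x1; y1] != [set x2; y2]].
Proof.
move=> D1 D2 a12 tc ca1 ca2.
have [Sx1 Sy1 xy1 St1 Sa1 ta1 cut1] := D1; have [Sx2 Sy2 xy2 St2 Sa2 ta2 cut2] := D2.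
pose W := [set z | (z \in S1) != (z \in S2)].
have Wt : t \notin W by rewrite inE (negbTE St1) (negbTE St2).
have tf1 : t \notin [set x1; y1].
  by rewrite !inE; apply/norP; split; apply: contraNneq St1 => ->.
have tf2 : t \notin [set x2; y2].
  by rewrite !inE; apply/norP; split; apply: contraNneq St2 => ->.
have cutW u v : adj u v -> (u \in W) != (v \in W) ->
    [\/ [set u; v] = [set x1; y1], [set u; v] = [set x2; y2],
      [set u; v] = [set t; a1] | [set u; v] = [set t; a2]].
  move=> uv; rewrite !inE => neq.
  have [e|n1] := eqVneq (u \in S1) (v \in S1).
    by case: (cut1 _ _ uv e); [constructor 1|constructor 3].
  have [e|n2] := eqVneq (u \in S2) (v \in S2).
    by case: (cut2 _ _ uv e); [constructor 2|constructor 4].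
  by move: neq n1 n2; do 4!case: (_ \in _).
(* Both [t] and [a1] avoid [S1]. If [a1] avoided [S2] as well, the edge from [t] to [a1] would
   belong to the second doubleton. *)
have Wa1 : a1 \in W.
  rewrite inE (negbTE Sa1) eq_sym eqbF_neg negbK; apply/negPn/negP=> Sa.
  have [] := cut2 t a1 ta1; first by rewrite (negbTE St2) (negbTE Sa).
    by move=> e; move: tf2; rewrite -e set21.
  by move/set2_inj=> [[_ e]|[_ e]]; [rewrite e eqxx in a12 | rewrite e adjxx in ta1].
have Wa2 : a2 \in W.
  rewrite inE (negbTE Sa2) eqbF_neg negbK; apply/negPn/negP=> Sa.
  have [] := cut1 t a2 ta2; first by rewrite (negbTE St1) (negbTE Sa).
    by move=> e; move: tf1; rewrite -e set21.
  by move/set2_inj=> [[_ e]|[_ e]]; [rewrite e eqxx in a12 | rewrite e adjxx in ta2].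
have Wc : c \notin W.
  apply/negP=> Wc; have := cutW t c tc; rewrite (negbTE Wt) Wc => /(_ isT)[] e.
  - by move: tf1; rewrite -e set21.
  - by move: tf2; rewrite -e set21.
  - by case/set2_inj: e => [[_ e]|[_ e]]; [rewrite e eqxx in ca1 | rewrite e adjxx in tc].
  - by case/set2_inj: e => [[_ e]|[_ e]]; [rewrite e eqxx in ca2 | rewrite e adjxx in tc].
pose Y := ~: W :\ t.
have Yc : c \in Y by rewrite !inE in Wc *; rewrite Wc andbT eq_sym (adj_neq tc).
have subY : cut Y \subset [set x1; y1] |: [set [set x2; y2]; [set t; c]].
  have key u v : adj u v -> u \in Y -> v \notin Y ->
      [set u; v] \in [set x1; y1] |: [set [set x2; y2]; [set t; c]].
    move=> uv; rewrite in_setD1 in_setC => /andP[ut Wu].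
    rewrite in_setD1 in_setC negb_and !negbK => /orP[/eqP vt|Wv].
      have tu : adj t u by rewrite adjC -vt.
      have : [|| u == a1, u == a2 | u == c].
        by apply: (neighbours3 ta1 ta2 tc) => //; rewrite eq_sym.
      case/or3P=> /eqP eu; first by rewrite eu Wa1 in Wu.
        by rewrite eu Wa2 in Wu.
      by rewrite eu vt setUC !inE eqxx !orbT.
    have vt : v != t by apply: contraTneq Wv => ->.
    have := cutW u v uv; rewrite (negbTE Wu) Wv => /(_ isT)[]e.
    - by rewrite !inE e eqxx.
    - by rewrite !inE e eqxx orbT.
    - by case/set2_inj: e => [[e _]|[_ e]]; [rewrite e eqxx in ut | rewrite e eqxx in vt].
    - by case/set2_inj: e => [[e _]|[_ e]]; [rewrite e eqxx in ut | rewrite e eqxx in vt].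
  apply/subsetP=> h hY; have /edgesP[u [v [hE uv]]] : h \in edges A.
    by move: hY; rewrite inE => /andP[].
  move: hY; rewrite hE in_cut uv /=; case: (boolP (u \in Y)) => Yu.
    by rewrite eq_sym eqb_id => Yv; apply: key.
  rewrite eq_sym eqbF_neg negbK => Yv; rewrite setUC; apply: key => //.
  by rewrite adjC.
have Y0 := set0_neq Yc.
have YT : Y != setT by apply: (@setT_neq _ _ t); rewrite !inE eqxx.
have cardF : #|[set x1; y1] |: [set [set x2; y2]; [set t; c]]| <= 3.
  by rewrite cardsU1 cards2; do 2!case: (~~ _).
have bY : bd Y = 3.
  apply/eqP; rewrite eqn_leq conA // andbT -card_cut.
  exact: leq_trans (subset_leq_card subY) cardF.
have eqY : cut Y = [set x1; y1] |: [set [set x2; y2]; [set t; c]].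
  by apply/eqP; rewrite eqEcard subY card_cut bY.
have card3 := cardF; rewrite -eqY card_cut bY in card3.
have neqf : [set x1; y1] != [set x2; y2].
  apply/eqP=> e; have := card_cut Y; rewrite eqY bY e setUA setUid cards2.
  by case: (~~ _).
have Y1 : Y = [set c].
  case: (irrA bY) => [/eqP/cards1P[z ez]|nY1].
    by rewrite ez; move: Yc; rewrite ez inE => /eqP->.
  have : [set t; a1] \subset ~: Y.
    by apply/subsetP=> z; rewrite !inE => /orP[]/eqP->; rewrite ?eqxx //; move: Wa1; rewrite inE => ->; rewrite andbF.
  by move/subset_leq_card; rewrite cards2 nY1 (adj_neq ta1).
have inf f : f \in cut Y -> c \in f.
  rewrite Y1 inE => /andP[_]; apply: contraTT => nc.
  by rewrite (_ : f :&: _ = set0) ?cards0 //; apply/eqP; rewrite setI_eq0 disjoint_sym disjoints1.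
by split=> //; apply: inf; rewrite eqY !inE eqxx ?orbT.
Qed.

Definition in_doubleton u v := `[< exists S x y, doubleton S x y u v >].

Lemma in_doubletonC u v : in_doubleton u v = in_doubleton v u.
Proof.
by apply/asboolP/asboolP=> -[S [x [y D]]]; exists S, x, y; apply: doubletonS.
Qed.

Lemma in_doubleton_mate S x y a b : doubleton S x y a b -> in_doubleton x y.
Proof. by move/doubletonC=> D; apply/asboolP; exists (~: S), a, b. Qed.

(** For any two of the doubletons, [adjacent_doubletons] puts the third neighbour of [t] into both
    partner edges. Each partner edge therefore joins two neighbours of [t], so [t] and its
    neighbours span a [K4], which no edge can leave. *)
Lemma three_doubletons t a1 a2 a3 : adj t a1 -> adj t a2 -> adj t a3 ->
  a1 != a2 -> a1 != a3 -> a2 != a3 ->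
  in_doubleton t a1 -> in_doubleton t a2 -> in_doubleton t a3 -> #|A| = 4.
Proof.
move=> ta1 ta2 ta3 a12 a13 a23 /asboolP[S1 [x1 [y1 D1]]] /asboolP[S2 [x2 [y2 D2]]].
case/asboolP=> S3 [x3 [y3 D3]].
have [f13 f23 _] : [/\ a3 \in [set x1; y1], a3 \in [set x2; y2] & [set x1; y1] != [set x2; y2]].
  by apply: adjacent_doubletons D1 D2 a12 ta3 _ _; rewrite eq_sym.
have [f12 f32 _] : [/\ a2 \in [set x1; y1], a2 \in [set x3; y3] & [set x1; y1] != [set x3; y3]].
  by apply: adjacent_doubletons D1 D3 a13 ta2 _ _; rewrite // eq_sym.
have [f21 f31 _] := adjacent_doubletons D2 D3 a23 ta1 a12 a13.
have mk p q x y : p \in [set x; y] -> q \in [set x; y] -> p != q -> adj x y -> adj p q.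
  rewrite !inE => /orP[]/eqP-> /orP[]/eqP->; rewrite ?eqxx // => _ //.
  by rewrite adjC.
have e23 := mk _ _ _ _ f12 f13 a23 (dbl_xy D1).
have e13 := mk _ _ _ _ f21 f23 a13 (dbl_xy D2).
have e12 := mk _ _ _ _ f31 f32 a12 (dbl_xy D3).
have nt a : adj t a -> t != a by exact: adj_neq.
have [a1t a2t a3t] : [/\ adj a1 t, adj a2 t & adj a3 t] by rewrite !(adjC _ t).
have [e21 e31 e32] : [/\ adj a2 a1, adj a3 a1 & adj a3 a2].
  by rewrite (adjC a2) !(adjC a3).
pose X := t |: [set a1; a2; a3].
suff XT : X = setT.
  have := congr1 (fun X : {set A} => #|X|) XT; rewrite cardsT => <-.
  rewrite /X cardsU1 setUC cardsU1 cards2 a12 !inE !negb_or (nt _ ta1) (nt _ ta2) (nt _ ta3).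
  by rewrite eq_sym a13 eq_sym a23.
apply/eqP/negPn/negP=> XT; have := conA _ XT.
have X0 : X != set0 by apply: (@set0_neq _ _ t); rewrite !inE eqxx.
move/(_ X0); suff -> : bd X = 0 by [].
apply/eqP/dg_eq0P=> u v; rewrite !inE -!orbA => Xu Xv; apply/negP=> uv; move: Xv.
have n1 := nt _ ta1; have n2 := nt _ ta2; have n3 := nt _ ta3.
case/or4P: Xu uv => /eqP-> uv; apply/negP; rewrite negbK.
- by case/or3P: (neighbours3 ta1 ta2 ta3 a12 a13 a23 uv) => /eqP->; rewrite eqxx ?orbT.
- by case/or3P: (neighbours3 a1t e12 e13 n2 n3 a23 uv) => /eqP->; rewrite eqxx ?orbT.
- by case/or3P: (neighbours3 a2t e21 e23 n1 n3 a13 uv) => /eqP->; rewrite eqxx ?orbT.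
- by case/or3P: (neighbours3 a3t e31 e32 n1 n2 a12 uv) => /eqP->; rewrite eqxx ?orbT.
Qed.

Hypothesis card_neq4 : #|A| <> 4.

(** Being in a doubleton depends on the atom alone, being removable also on its big blocks. Plain
    edges between real vertices are always removable, so the matching is sought among them. *)
Definition plain : rel A := [rel u v | adj u v && ~~ in_doubleton u v].

Lemma plain_sym : symmetric plain.
Proof. by move=> u v; rewrite /plain /= adjC in_doubletonC. Qed.

Lemma plain_irr : irreflexive plain.
Proof. by move=> u; rewrite /plain /= adjxx. Qed.

Definition plain_graph := SGraph plain_sym plain_irr.

Lemma neighbours_ex t : exists a b c, [/\ adj t a, adj t b & adj t c] /\
  [/\ a != b, a != c & b != c].
Proof.
have : 1 < #|[set z | adj t z]| by rewrite cubicA.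
case/card_gt1P=> a [b []]; rewrite !inE => ta tb ab.
have [c [tc ca cb]] := third_neighbour ta tb ab.
by exists a, b, c; split; split; rewrite // eq_sym.
Qed.

Lemma plain_ex t : exists c, plain t c.
Proof.
have [a [b [c [[ta tb tc] [ab ac bc]]]]] := neighbours_ex t.
apply: contrapT => np; apply: card_neq4; apply: (three_doubletons ta tb tc) => //.
- by apply/negPn/negP=> nd; apply: np; exists a; rewrite /plain /= ta.
- by apply/negPn/negP=> nd; apply: np; exists b; rewrite /plain /= tb.
- by apply/negPn/negP=> nd; apply: np; exists c; rewrite /plain /= tc.
Qed.

(* A vertex with a single plain edge is joined by it to a vertex of the same
   kind: the two edges of a rung of a ladder-like part of [A]. *)
Lemma plain_pendant t c : plain t c -> (forall u, plain t u -> u = c) ->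
  forall w, plain c w -> w = t.
Proof.
move=> /andP[tc ndc] uniq w /andP[cw ndw].
have [a [ta ac]] : exists a, adj t a /\ a != c.
  have [a [b [d [[ta tb td] [ab ad bd]]]]] := neighbours_ex t.
  case: (eqVneq a c) => [e|]; last by exists a.
  by exists b; rewrite tb eq_sym -e ab.
have [b [tb ba bc]] := third_neighbour ta tc ac.
have nd u : adj t u -> u != c -> in_doubleton t u.
  move=> tu; apply: contraR => ndu; apply/eqP/uniq.
  by rewrite /plain /= tu ndu.
have /asboolP[S1 [x1 [y1 D1]]] := nd _ ta ac.
have /asboolP[S2 [x2 [y2 D2]]] := nd _ tb bc.
have [f1 f2 f12] : [/\ c \in [set x1; y1], c \in [set x2; y2] & [set x1; y1] != [set x2; y2]].
  by apply: adjacent_doubletons D1 D2 _ tc _ _; rewrite eq_sym.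
have other S x y a' : doubleton S x y t a' -> c \in [set x; y] ->
    exists z, [/\ [set x; y] = [set c; z], adj c z, z != t & in_doubleton c z].
  move=> D; have xy := dbl_xy D; have nxy := in_doubleton_mate D.
  have Sx := dbl_x D; have Sy := dbl_y D; have St := dbl_a D.
  rewrite !inE => /orP[]/eqP ec; rewrite ec.
    by exists y; split=> //; apply: contraNneq St => <-.
  exists x; split; [by rewrite setUC|by rewrite adjC| |by rewrite in_doubletonC].
  by apply: contraNneq St => <-.
have [z1 [e1 cz1 z1t nd1]] := other _ _ _ _ D1 f1.
have [z2 [e2 cz2 z2t nd2]] := other _ _ _ _ D2 f2.
have z12 : z1 != z2 by apply: contraNneq f12 => e; rewrite e1 e2 e.
have ct : adj c t by rewrite adjC.
have := neighbours3 ct cz1 cz2 _ _ z12 cw; rewrite ![t == _]eq_sym => /(_ z1t z2t).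
by case/or3P=> /eqP e //; move: ndw; rewrite e ?nd1 ?nd2.
Qed.
End Doubleton.

Lemma card_cover_edges (G : sgraph) (M : {set {set G}}) :
  M \subset edges G -> trivIset M -> #|cover M| = 2 * #|M|.
Proof.
move=> sM /eqP <-; rewrite mulnC -sum_nat_const; apply: eq_bigr => h /(subsetP sM)/edgesP.
by case=> x [y [-> /adj_neq xy]]; rewrite cards2 xy.
Qed.

Lemma cubic_card (G : sgraph) (x : G) : cubic G -> 4 <= #|G| /\ ~~ odd #|G|.
Proof.
move=> cubicG; split; last exact: even_card.
have : #|x |: [set y | adj x y]| = 4 by rewrite cardsU1 cubicG inE adjxx.
by move=> <-; rewrite -cardsT subset_leq_card ?subsetT.
Qed.

(** * Matchings of removable edges inside one atom *)

Section AtomMatching.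
Variable A : sgraph.
Hypotheses (cubicA : cubic A) (conA : three_connected A).
Hypothesis irrA : forall U : {set A}, bd U = 3 -> #|U| = 1 \/ #|~: U| = 1.
Hypothesis card_neq4 : #|A| <> 4.
Variables (Z : {set A}) (rem : rel A).
Hypothesis rem_sym : symmetric rem.
Hypothesis not_rem : forall u v, adj u v -> u \notin Z -> v \notin Z -> ~~ rem u v ->
  exists S x y, doubleton S x y u v /\ #|S :&: Z| <= 1.
Hypothesis not_balanced : Z != set0 -> #|~: Z| = #|Z| ->
  (forall u v, u \notin Z -> v \notin Z -> ~~ adj u v) -> False.

Local Notation Q := (plain_graph A).

Lemma plain_rem u v : u \notin Z -> v \notin Z -> plain u v -> rem u v.
Proof.
move=> Zu Zv /andP[uv nd]; apply: contraR nd => /(not_rem uv Zu Zv)[S [x [y [D _]]]].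
by apply/asboolP; exists S, x, y.
Qed.

(** If no edge between real vertices is removable, all plain neighbours of [u] and of [v] are big,
    and the doubleton of their edge puts them into [S], which has only one big block [c]. So [c] is
    the sole plain neighbour of [u], and [plain_pendant] makes [u] the sole plain neighbour of [c],
    although [v] is another. *)
Lemma rem_ex u v : adj u v -> u \notin Z -> v \notin Z ->
  exists u' v', [/\ adj u' v', u' \notin Z, v' \notin Z & rem u' v'].
Proof.
move=> uv Zu Zv; apply: contrapT => nrem.
have nr u' v' : adj u' v' -> u' \notin Z -> v' \notin Z -> ~~ rem u' v'.
  by move=> uv' Zu' Zv'; apply/negP=> r; apply: nrem; exists u', v'.
have [S [x [y [D SZ]]]] := not_rem uv Zu Zv (nr _ _ uv Zu Zv).
have plainS a b c : doubleton S x y a b -> a \notin Z -> b \notin Z -> plain a c ->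
    c \in S :&: Z.
  move=> Dab Za Zb /[dup] pac /andP[ac _].
  have Zc : c \in Z by apply/negPn/negP=> Zc; have := nr _ _ ac Za Zc; rewrite plain_rem.
  rewrite inE Zc andbT; apply/negPn/negP=> Sc; have [Sx Sy _ Sa _ _ cutS] := Dab.
  case: (cutS a c ac); first by rewrite (negbTE Sa) (negbTE Sc).
    by move=> e; have := set21 a c; rewrite e !inE => /orP[]/eqP e'; move: Sa; rewrite e' ?Sx ?Sy.
  case/set2_inj=> -[e1 e2]; first by move: Zb; rewrite -e2 Zc.
  by move: ac; rewrite e2 adjxx.
have uniq c d : c \in S :&: Z -> d \in S :&: Z -> c = d.
  by move=> Sc Sd; apply: (card_le1_eqP SZ).
have [c pc] := plain_ex cubicA conA irrA card_neq4 u.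
have [d pd] := plain_ex cubicA conA irrA card_neq4 v.
have cS := plainS _ _ _ D Zu Zv pc; have dS := plainS _ _ _ (doubletonS D) Zv Zu pd.
have edc := uniq _ _ dS cS; rewrite edc in pd.
have := plain_pendant cubicA conA irrA pc; rewrite plain_sym in pd.
move=> /(_ (fun w pw => uniq _ _ (plainS _ _ _ D Zu Zv pw) cS) _ pd) e.
by move: uv; rewrite e adjxx.
Qed.

(* A maximal matching of plain edges avoiding [Z]. A vertex it misses with
   only one plain edge is the only plain neighbour of a vertex of [Z]. *)
Lemma plain_matching : exists M : {set {set A}},
  [/\ M \subset edges A, trivIset M,
      forall u v, [set u; v] \in M -> [/\ u \notin Z, v \notin Z & rem u v]
    & 2 * #|~: Z| <= 8 * #|M| + 3 * #|Z|].
Proof.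
pose good (M : {set {set A}}) :=
  [&& M \subset edges Q, trivIset M & [forall h in M, h \subset ~: Z]].
have good0 : good set0.
  apply/and3P; split; first by rewrite sub0set.
    by apply/trivIsetP=> h k; rewrite inE.
  by apply/forall_inP=> h; rewrite inE.
case: (@arg_maxnP _ _ good (fun M : {set {set A}} => #|M|) good0).
move=> M /and3P[sM tM /forall_inP ZM] maxM.
have sQA : edges Q \subset edges A.
  apply/subsetP=> h /edgesP[u [v [-> /andP[uv _]]]].
  by rewrite (@in_edges A u v).
exists M; split=> //; first exact: subset_trans sM sQA.
  move=> u v Muv; have := ZM _ Muv; rewrite subUset !sub1set !inE => /andP[Zu Zv].
  split=> //; apply: plain_rem => //; have := subsetP sM _ Muv.
  by rewrite (@in_edges Q u v).
have cZ : cover M \subset ~: Z by apply/bigcupsP.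
have cM : #|cover M| = 2 * #|M| by apply: card_cover_edges => //; apply: subset_trans sM sQA.
pose U := ~: Z :\: cover M.
have cU : #|~: Z| = #|cover M| + #|U| by rewrite -(cardsID (cover M)) (setIidPr cZ).
have noUU u v : u \in U -> v \in U -> ~~ plain u v.
  rewrite !inE => /andP[Mu Zu] /andP[Mv Zv]; apply/negP=> puv.
  have nM : [set u; v] \notin M.
    by apply: contra Mu => h; apply/bigcupP; exists [set u; v]; rewrite ?set21.
  have : good ([set u; v] |: M).
    apply/and3P; split.
    - by rewrite subUset sM sub1set (@in_edges Q u v) andbT.
    - have dM h : h \in M -> [disjoint [set u; v] & h].
        move=> Mh; rewrite -setI_eq0; apply/eqP/setP=> w; rewrite !inE.
        apply/negP=> /andP[/orP[]/eqP-> wh].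
          by case/negP: Mu; apply/bigcupP; exists h.
        by case/negP: Mv; apply/bigcupP; exists h.
      apply/trivIsetP=> h k /setU1P[->|Mh] /setU1P[->|Mk]; rewrite ?eqxx //.
      + by move=> _; apply: dM.
      + by move=> _; rewrite disjoint_sym; apply: dM.
      + exact: (trivIsetP tM).
    - apply/forall_inP=> h /setU1P[->|/ZM //].
      by rewrite subUset !sub1set !inE Zu.
  by move/maxM; rewrite /geq /= cardsU1 nM add1n ltnn.
have partner m : m \in cover M -> exists m', plain m m' /\ m' \in cover M.
  case/bigcupP=> h Mh hm; have /edgesP[p [q [eh pq]]] := subsetP sM _ Mh.
  have hp : p \in cover M by apply/bigcupP; exists h => //; rewrite eh set21.
  have hq : q \in cover M by apply/bigcupP; exists h => //; rewrite eh set22.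
  move: hm; rewrite eh !inE => /orP[]/eqP->; first by exists q.
  by exists p; rewrite plain_sym.
have dg_le (m : A) (X : {set A}) : @dg Q [set m] X <= #|[set v in X | @adj A m v]|.
  rewrite (@dg1 Q); apply: subset_leq_card; apply/subsetP=> v; rewrite !inE.
  by case/andP=> -> /andP[-> _].
have dg_le3 (m : A) (X : {set A}) : @dg Q [set m] X <= 3.
  apply: leq_trans (dg_le m X) _; rewrite -(cubicA m); apply: subset_leq_card.
  by apply/subsetP=> v; rewrite !inE => /andP[].
(* One of the three neighbours of [m] is its partner in [M]. *)
have dgM (m : A) : m \in cover M -> @dg Q [set m] U <= 2.
  move=> Mm; have [m' [/andP[mm' _] Mm']] := partner _ Mm.
  apply: leq_trans (dg_le m U) _; rewrite -ltnS -(cubicA m) (cardsD1 m' [set z | adj m z]) inE mm'.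
  rewrite add1n ltnS; apply: subset_leq_card; apply/subsetP=> v; rewrite !inE.
  by case/andP=> /andP[Mv Zv] ->; rewrite andbT; apply: contraNneq Mv => ->.
pose U1 := [set u in U | #|[set v | plain u v]| == 1].
pose U2 := U :\: U1.
have sU1 : U1 \subset U by apply/subsetP=> u; rewrite !inE => /andP[].
have sU2 : U2 \subset U by apply: subsetDl.
have pendZ u w : u \in U1 -> plain u w -> w \in Z /\ forall v, plain w v -> v = u.
  rewrite inE => /andP[Uu /cards1P[c ec]] puw.
  have uniq v : plain u v -> v = w.
    by move=> puv; have := set11 c; rewrite -ec => _; have : v \in [set v | plain u v] by [rewrite inE]; have : w \in [set v | plain u v] by [rewrite inE]; rewrite ec !inE => /eqP-> /eqP->.
  have uniq' := plain_pendant cubicA conA irrA puw uniq.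
  split=> //; apply/negPn/negP=> Zw.
  have Uw : w \notin U by apply/negP=> Uw; have := noUU _ _ Uu Uw; rewrite puw.
  have Mw : w \in cover M by move: Uw; rewrite !inE Zw andbT negbK.
  have [m' [/uniq' e Mm']] := partner _ Mw.
  by move: Uu; rewrite !inE -e Mm'.
have deg1 (u : A) : u \in U1 -> 1 <= @dg Q [set u] Z.
  move=> U1u; have [c pc] := plain_ex cubicA conA irrA card_neq4 u.
  have [Zc _] := pendZ _ _ U1u pc.
  by apply: (@dg_le_edges Q _ _ u c); rewrite ?inE.
have deg2 (u : A) : u \in U2 -> 2 <= @dg Q [set u] (cover M) + @dg Q [set u] Z.
  rewrite inE => /andP[U1u Uu].
  have dMZ : [disjoint cover M & Z] by rewrite disjoints_subset.
  rewrite -(@dgUr Q _ _ [set u] dMZ) (@dg1 Q).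
  have -> : [set v in cover M :|: Z | @adj Q u v] = [set v | plain u v].
    apply/setP=> v; rewrite !inE -[@adj Q u v]/(plain u v).
    case: (boolP (plain u v)) => puv; last by rewrite andbF.
    rewrite andbT; apply/negPn/negP=> /norP[Mv Zv].
    have Uv : v \in U by rewrite !inE Mv.
    by have := noUU _ _ Uu Uv; rewrite puv.
  move: U1u; rewrite inE Uu /= ltn_neqAle eq_sym => -> /=.
  have [c pc] := plain_ex cubicA conA irrA card_neq4 u.
  by apply/card_gt0P; exists c; rewrite inE.
(* Weight 2 makes up for the second plain edge that vertices of [U1] lack. It fits the degree 3,
   since a vertex of [Z] next to [U1] has no other plain neighbour. *)
have degZ (z : A) : z \in Z -> @dg Q [set z] U2 + 2 * @dg Q [set z] U1 <= 3.
  move=> Zz; have [d0|dn0] := eqVneq (@dg Q [set z] U1) 0.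
    by rewrite d0 muln0 addn0; apply: dg_le3.
  have : 0 < @dg Q [set z] U1 by rewrite lt0n.
  case/dg_gt0P=> w [u []]; rewrite inE => /eqP-> U1u pzu.
  have puz : @plain A u z by rewrite plain_sym.
  have [_ uniq] := pendZ _ _ U1u puz.
  have -> : @dg Q [set z] U2 = 0.
    apply/eqP/dg_eq0P=> w' v; rewrite inE => /eqP-> U2v; apply/negP=> /uniq e.
    by move: U2v; rewrite e inE U1u.
  suff : @dg Q [set z] U1 <= 1 by rewrite add0n; case: (dg _ _) => [|[]].
  rewrite (@dg1 Q) -(cards1 u); apply: subset_leq_card; apply/subsetP=> v.
  by rewrite !inE => /andP[_ /uniq->].
have sum1 (B : sgraph) (X Y : {set B}) : dg X Y = \sum_(v in X) dg [set v] Y.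
  by rewrite /dg; apply: eq_bigr => v _; rewrite big_set1.
have s1 : #|U1| <= @dg Q U1 Z.
  by rewrite sum1 -sum1_card; apply: leq_sum.
have s2 : 2 * #|U2| <= @dg Q U2 (cover M) + @dg Q U2 Z.
  by rewrite mulnC -sum_nat_const !(sum1 Q U2) -big_split /=; apply: leq_sum.
have s3 : @dg Q Z U2 + 2 * @dg Q Z U1 <= 3 * #|Z|.
  rewrite !(sum1 Q Z) big_distrr -big_split /= [in leqRHS]mulnC -sum_nat_const.
  exact: leq_sum.
have s4 : @dg Q (cover M) U2 <= 2 * #|cover M|.
  apply: leq_trans (@dgS Q (cover M) (cover M) U2 U (subxx _) sU2) _.
  by rewrite sum1 mulnC -sum_nat_const; apply: leq_sum.
have cU12 : #|U| = #|U1| + #|U2| by rewrite -(cardsID U1 U) (setIidPr sU1).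
rewrite (@dgC Q Z) (@dgC Q Z) in s3; rewrite (@dgC Q) in s4.
rewrite cU cM cU12; rewrite cM in s4.
move: s1 s2 s3 s4.
move: (@dg Q U1 Z) (@dg Q U2 Z) (@dg Q U2 (cover M)) #|U1| #|U2| #|M| #|Z|.
clear; lia.
Qed.

(** Let [r] and [z] be the sizes of [~: Z] and [Z]. A nonempty matching from [plain_matching]
    satisfies the bound because [r + z >= 6]. If it is empty, then [2 r <= 3 z] and the single edge
    of [rem_ex] is enough. If real vertices are pairwise nonadjacent, degrees give [r <= z],
    [not_balanced] excludes equality, and parity gives [r <= z - 2], enough for the empty
    matching. *)
Theorem atom_matching (x0 : A) : exists M : {set {set A}},
  [/\ M \subset edges A, trivIset M,
      forall u v, [set u; v] \in M -> [/\ u \notin Z, v \notin Z & rem u v]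
    & #|~: Z| + 4 <= 7 * #|M| + 2 * #|Z|].
Proof.
have [A4 evA] := cubic_card x0 cubicA.
have cZ := cardsC Z.
have empty : [/\ set0 \subset edges A, trivIset (@set0 {set A}) &
    forall u v, [set u; v] \in @set0 {set A} -> [/\ u \notin Z, v \notin Z & rem u v]].
  split; rewrite ?sub0set //; first by apply/trivIsetP=> h k; rewrite inE.
  by move=> u v; rewrite inE.
have [[u [v [uv Zu Zv]]]|no_edge] := pselect (exists u v, [/\ adj u v, u \notin Z & v \notin Z]).
  have [M [sM tM rM leM]] := plain_matching.
  have [M0|Mn0] := eqVneq #|M| 0; last first.
    by exists M; split=> //; clear -leM Mn0 cZ A4 evA card_neq4; lia.
  have [u' [v' [uv' Zu' Zv' ruv']]] := rem_ex uv Zu Zv.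
  exists [set [set u'; v']]; split.
  - by rewrite sub1set in_edges.
  - by apply/trivIsetP=> h k; rewrite !inE => /eqP-> /eqP->; rewrite eqxx.
  - move=> p q; rewrite inE => /eqP/set2_inj[[-> ->]|[-> ->]] //.
    by rewrite rem_sym.
  - by rewrite cards1; move: leM cZ; rewrite M0; clear; lia.
have indep u v : u \notin Z -> v \notin Z -> ~~ adj u v.
  by move=> Zu Zv; apply/negP=> uv; apply: no_edge; exists u, v.
exists set0; case: empty => e1 e2 e3; split=> //.
have le : #|~: Z| <= #|Z|.
  rewrite -(leq_pmul2l (isT : 0 < 3)) -(dg_split cubicA Z Z) -(dg_split cubicA Z (~: Z)).
  have -> : dg (~: Z) (~: Z) = 0.
    by apply/eqP/dg_eq0P=> u v; rewrite !inE; apply: indep.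
  by rewrite addn0 (dgC (~: Z)) leq_addl.
have neq : #|~: Z| <> #|Z|.
  move=> e; apply: (not_balanced _ e) => //; rewrite -cards_eq0; apply/eqP=> Z0.
  by move: cZ A4; rewrite e Z0 => <-.
by rewrite cards0; move: le neq cZ evA A4; clear; lia.
Qed.
End AtomMatching.

Definition removable_matching (G : sgraph) (X : {set G}) (n : nat) :=
  exists M : {set {set G}}, [/\ trivIset M, forall d, d \in M -> removable d,
    cover M \subset X & #|M| = n].

Section RemovableMatching.
Variable G : sgraph.
Implicit Types X Y : {set G}.

Lemma removable_matching0 X : removable_matching X 0.
Proof.
exists set0; split; rewrite ?cards0 //; first by apply/trivIsetP=> ? ?; rewrite inE.
- by move=> d; rewrite inE.
- by apply/bigcupsP=> d; rewrite inE.
Qed.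

Lemma removable_matching1 (X : {set G}) (p q : G) : p \in X -> q \in X -> removable [set p; q] ->
  removable_matching X 1.
Proof.
move=> Xp Xq rpq; exists [set [set p; q]]; split; rewrite ?cards1 //.
- by apply/trivIsetP=> h k; rewrite !inE => /eqP-> /eqP->; rewrite eqxx.
- by move=> d; rewrite inE => /eqP->.
- by apply/bigcupsP=> d; rewrite inE => /eqP->; rewrite subUset !sub1set Xp.
Qed.

Lemma removable_matchingS X Y n : X \subset Y ->
  removable_matching X n -> removable_matching Y n.
Proof. by move=> sXY [M [tM rM cM eM]]; exists M; split=> //; apply: subset_trans sXY. Qed.

Lemma removable_matchingU X Y n k : [disjoint X & Y] ->
  removable_matching X n -> removable_matching Y k -> removable_matching (X :|: Y) (n + k).
Proof.
move=> dXY [M [tM rM cM <-]] [N [tN rN cN <-]]; exists (M :|: N).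
have sMX h : h \in M -> h \subset X by move=> Mh; apply: subset_trans cM; apply: bigcup_sup.
have sNY h : h \in N -> h \subset Y by move=> Nh; apply: subset_trans cN; apply: bigcup_sup.
have dMN h k' : h \in M -> k' \in N -> [disjoint h & k'].
  by move=> /sMX sh /sNY sk; apply: disjointWl sh (disjointWr sk dXY).
split.
- apply/trivIsetP=> h k' /setUP[Mh|Nh] /setUP[Mk|Nk] neq.
  + exact: (trivIsetP tM).
  + exact: dMN.
  + by rewrite disjoint_sym dMN.
  + exact: (trivIsetP tN).
- by move=> d /setUP[/rM|/rN].
- rewrite /cover bigcup_setU; exact: setUSS.
- rewrite cardsU (_ : M :&: N = set0) ?cards0 ?subn0 //.
  apply/setP=> h; rewrite !inE; apply/negP=> /andP[Mh Nh].
  have [/edgesP[p [q [eh _]]] _] := rM _ Mh.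
  have := dMN _ _ Mh Nh; rewrite -setI_eq0 setIid => /eqP/setP/(_ p).
  by rewrite eh !inE eqxx.
Qed.

Lemma removable_matching_bigcup (I : finType) (O : {set I}) (F : I -> {set G}) (f : I -> nat) :
  {in O &, forall i j, i != j -> [disjoint F i & F j]} ->
  {in O, forall i, removable_matching (F i) (f i)} ->
  removable_matching (\bigcup_(i in O) F i) (\sum_(i in O) f i).
Proof.
have [n] := ubnP #|O|; elim: n => // n IHn in O * => leOn dF rF.
have [->|[i Oi]] := set_0Vmem O.
  by rewrite !big_set0; apply: removable_matching0.
rewrite (big_setD1 i) //= (big_setD1 i Oi) /=; apply: removable_matchingU.
- apply/bigcup_disjointP=> j /setD1P[ji Oj].
  by rewrite dF // eq_sym.
- exact: rF.
- apply: IHn; first by move: leOn; rewrite (cardsD1 i) Oi.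
    by move=> j k /setD1P[_ Oj] /setD1P[_ Ok]; apply: dF.
  by move=> j /setD1P[_ Oj]; apply: rF.
Qed.
End RemovableMatching.

Lemma complete4 (A : sgraph) (u v : A) : cubic A -> #|A| = 4 -> u != v -> adj u v.
Proof.
move=> cubicA A4 uv; have : [set z | adj u z] = [set~ u].
  apply/eqP; rewrite eqEcard cubicA cardsC1 A4 andbT.
  by apply/subsetP=> z; rewrite !inE eq_sym => /adj_neq.
by move/setP/(_ v); rewrite !inE eq_sym uv.
Qed.

(** * Atoms of a cubic brick *)

Section AtomInBrick.
Variable G : sgraph.
Hypotheses (cubicG : cubic G) (brickG : brick G).
Let conG := brick_three_connected cubicG brickG.
Variable P : {set {set G}}.
Hypothesis atomP : atom P.
Local Notation A := (quotient P).
Local Notation blk := (blk atomP).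
Local Notation Z := (big_blocks P).
Let blkE := blkE atomP.
Let cubicA : cubic A := quotient_cubic cubicG conG atomP.
Let conA : three_connected A := quotient_three_connected cubicG conG atomP.

Lemma real_block (B : A) : B \notin Z -> exists p, val B = [set p].
Proof.
rewrite inE -leqNgt => B1; have [p eB] := block_neq0 cubicG atomP B.
have Bp : p \in val B by rewrite blkE eB.
exists p; apply/eqP; rewrite eq_sym eqEcard sub1set Bp cards1.
exact: B1.
Qed.

(** Here the edge projected by [link] is the non-removable edge itself. Its end blocks are single
    vertices outside [S], which makes [out] equal to 3 on them and excludes the bipartite
    alternative, where one of them would be big. *)
Lemma link_real (B C : A) p q : adj B C -> val B = [set p] -> val C = [set q] ->
  ~ removable [set p; q] -> exists S X Y, doubleton S X Y B C /\ #|S :&: Z| <= 1.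
Proof.
move=> BC eB eC nr.
have pB : blk p = B by apply/eqP; rewrite -blkE eB set11.
have qC : blk q = C by apply/eqP; rewrite -blkE eC set11.
have pq : adj p q.
  have [_ [p' [q' [/eqP pB' /eqP qC' pq]]]] := adj_blkP atomP BC.
  by move: pB' qC' pq; rewrite -!blkE eB eC !inE => /eqP-> /eqP->.
have npq : blk p != blk q by rewrite pB qC adj_neq.
have [x [y [S [K bar]]]] := not_removable_barrier cubicG conG pq nr.
have inpq (D : A) : (p \in val D) || (q \in val D) -> val D = [set p] \/ val D = [set q].
  by case/orP; rewrite blkE => /eqP<-; [left; rewrite pB|right; rewrite qC].
have xny := adj_neq (bar_adj bar).
have sxy (D : A) : (p \in val D) || (q \in val D) -> ~~ ((x \in val D) && (y \in val D)).
  by case/inpq=> ->; rewrite !inE; apply: contra xny => /andP[/eqP-> /eqP->].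
have := @link _ cubicG brickG _ atomP _ _ _ _ _ _ bar sxy p q pq npq.
rewrite blkE eqxx => /(_ isT (bar_b bar)) [].
- move=> D /inpq h; split.
    rewrite /out (_ : val D :\: S = val D); last first.
      apply/setDidPl; rewrite disjoint_sym disjoints_subset; apply/subsetP=> s Ss.
      rewrite inE; case: h => ->; rewrite inE; apply: contraTneq Ss => ->.
        exact: (bar_a bar).
      exact: (bar_b bar).
    by rewrite -/(bd (val D)) (atom_bd atomP (valP D)).
  move=> s t Ss; case: h => ->; rewrite inE => /eqP e; move: Ss; rewrite e.
    by rewrite (negbTE (bar_a bar)).
  by rewrite (negbTE (bar_b bar)).
- by [].
- move=> cS [[X [Y D]]|[_ _ _]]; last by rewrite inE qC eC cards1.
  by exists [set B0 : A | out S B0 <= 1], X, Y; rewrite -pB -qC.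
Qed.

Lemma card_lift (U : {set A}) : #|lift atomP U| = \sum_(B in U) #|(val B : {set G})|.
Proof.
rewrite -sum1_card (partition_big blk (mem U)) /= => [|x]; last by rewrite inE.
apply: eq_bigr => B UB; rewrite -sum1_card; apply: eq_bigl => x; rewrite inE blkE.
by case: (eqVneq (blk x) B) => [->|_]; rewrite ?andbF // andbT; exact: UB.
Qed.

Lemma card_lift_real : #|lift atomP (~: Z)| = #|~: Z|.
Proof.
rewrite card_lift -sum1_card; apply: eq_bigr => B; rewrite inE => /real_block[p ->].
by rewrite cards1.
Qed.

(* With as many real vertices as nontrivial blocks, a perfect matching matches
   each block to exactly one real vertex: the cuts of the blocks are tight. *)
Lemma not_balanced : Z != set0 -> #|~: Z| = #|Z| ->
  (forall B C : A, B \notin Z -> C \notin Z -> ~~ adj B C) -> False.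
Proof.
case/set0Pn=> B ZB eZ indR.
have indZ C D : C \in Z -> D \in Z -> ~~ adj C D.
  have : dg Z Z == 0.
    have := dg_split cubicA Z Z; have := dg_split cubicA Z (~: Z).
    have -> : dg (~: Z) (~: Z) = 0.
      by apply/eqP/dg_eq0P=> u v; rewrite !in_setC; apply: indR.
    by rewrite eZ addn0 (dgC (~: Z)) => ->; rewrite -[X in _ = X]add0n => /eqP; rewrite eqn_add2r.
  by move/dg_eq0P; apply.
have [] : #|val B : {set G}| = 1 \/ #|~: (val B : {set G})| = 1.
- apply: (brick_tight brickG) => m mP.
  pose ex (C : A) := #|[set z in val C | m z \notin val C]|.
  have oex C : odd (ex C).
    by rewrite /ex (odd_mate mP) -(odd_bd cubicG) (atom_bd atomP (valP C)).
  have sum_ex : \sum_(C in Z) ex C <= #|Z|.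
    rewrite -eZ -card_lift_real.
    have -> : \sum_(C in Z) ex C = #|[set z | (blk z \in Z) && (blk (m z) != blk z)]|.
      rewrite -sum1_card (partition_big blk (mem Z)) /= => [|x]; last by rewrite inE => /andP[].
      apply: eq_bigr => C ZC; rewrite /ex -sum1_card; apply: eq_bigl => x; rewrite !inE !blkE.
      by case: (eqVneq (blk x) C) => [->|_]; rewrite ?andbF // andbT; move: ZC; rewrite inE => ->.
    have injm : injective m by apply: can_inj (m) _ => z; case: (mP z).
    rewrite -(card_imset _ injm); apply: subset_leq_card; apply/subsetP=> w /imsetP[z].
    rewrite inE => /andP[Zz nz] -> {w}; rewrite !in_set.
    have zm : adj z (m z) by case: (mP z).
    have zm' : adj (blk z) (blk (m z)) by apply: adj_blk; rewrite // eq_sym.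
    by rewrite -leqNgt leqNgt; apply/negP=> Zm; have := indZ _ _ Zz (_ : blk (m z) \in Z); rewrite inE zm' => /(_ Zm).
  apply/eqP; rewrite eqn_leq [0 < _](_ : _ = true); last by have := oex B; rewrite /ex; case: #|_|.
  rewrite andbT; apply: contraTT sum_ex; rewrite -!ltnNge => gtB.
  rewrite (bigD1 B) //= (cardsD1 B) ZB -sum1_card -addSn; apply: leq_add.
    exact: gtB.
  rewrite (eq_bigl (fun C => (C \in Z) && (C != B))); last by move=> C; rewrite !inE andbC.
  by apply: leq_sum => C _; have := oex C; case: (ex C).
- by move=> e; move: ZB; rewrite inE e.
- by move=> e; have := card_coblock cubicG atomP B; rewrite e.
Qed.

Definition removable_blocks : rel A :=
  [rel B C | `[< exists p q, [/\ val B = [set p], val C = [set q] & removable [set p; q]] >]].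

(** For order at least 6 this is [atom_matching]. In order 4 the empty matching suffices with three
    or four big blocks, so only two big blocks require an edge. *)
Lemma atom_removable_matching : ~ (#|A| = 4 /\ #|Z| <= 1) ->
  exists n, removable_matching (lift atomP (~: Z)) n /\ #|~: Z| + 4 <= 7 * n + 2 * #|Z|.
Proof.
move=> not_exc; have cZ := cardsC Z.
have rb_not B C : adj B C -> B \notin Z -> C \notin Z -> ~~ removable_blocks B C ->
    exists S X Y, doubleton S X Y B C /\ #|S :&: Z| <= 1.
  move=> BC /real_block[p eB] /real_block[q eC] /asboolPn nr.
  by apply: (link_real BC eB eC) => r; apply: nr; exists p, q.
have [A4|An4] := eqVneq #|A| 4.
  have Z1 : 1 < #|Z| by rewrite ltnNge; apply/negP=> Z1; apply: not_exc.
  have [Z2|Zn2] := eqVneq #|Z| 2; last first.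
    exists 0; split; first exact: removable_matching0.
    by move: cZ A4 Z1 Zn2; clear; lia.
  have : 1 < #|~: Z| by move: cZ; rewrite A4 Z2; clear; lia.
  case/card_gt1P=> B [C []]; rewrite !in_setC => ZB ZC nBC.
  exists 1; split; last by move: cZ; rewrite A4 Z2; clear; lia.
  have BC := complete4 cubicA A4 nBC.
  have /asboolP[p [q [eB eC r]]] : removable_blocks B C.
    (* The side [S] avoids the only two real vertices, so [X] and [Y] would be two big blocks in
       it. *)
    apply: contraT => /(rb_not _ _ BC ZB ZC)[S [X [Y [D SZ]]]].
    have eRZ : ~: Z = [set B; C].
      apply/eqP; rewrite eq_sym eqEcard cards2 nBC subUset !sub1set !in_setC ZB ZC /=.
      by move: cZ; rewrite A4 Z2 add2n => -[->].
    have inZ W : W \in S -> W \in Z.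
      move=> SW; apply/negPn/negP=> ZW; have : W \in ~: Z by rewrite in_setC.
      rewrite eRZ !inE => /orP[]/eqP e; move: SW; rewrite e.
        by rewrite (negbTE (dbl_a D)).
      by rewrite (negbTE (dbl_b D)).
    move: SZ; rewrite leqNgt => /negP[]; apply/card_gt1P; exists X, Y.
    by rewrite !in_setI (dbl_x D) (dbl_y D) !inZ ?(dbl_x D) ?(dbl_y D) // adj_neq ?(dbl_xy D).
  have [pB qC] : blk p = B /\ blk q = C by split; apply/eqP; rewrite -blkE ?eB ?eC set11.
  by apply: removable_matching1 r; rewrite inE ?pB ?qC in_setC.
have [x0 _] : exists x0 : A, true.
  have : 0 < #|A| by rewrite card_quotient; apply: leq_trans (atom_card atomP).
  by case/card_gt0P=> x0 _; exists x0.
have rb_sym : symmetric removable_blocks.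
  move=> B C; apply/asboolP/asboolP=> -[p [q [eB eC r]]]; exists q, p; split=> //; by rewrite setUC.
have [M [sM tM rM leM]] := atom_matching cubicA conA (quotient_irr cubicG conG atomP) (elimN eqP An4) rb_sym rb_not not_balanced x0.
have injl : injective (@lift _ _ atomP).
  move=> U W e; apply/setP=> B; have [x <-] := block_neq0 cubicG atomP B.
  by have /setP/(_ x) := e; rewrite !inE.
exists #|M|; split=> //; exists [set lift atomP h | h in M]; split.
- apply/trivIsetP=> h k /imsetP[U MU ->] /imsetP[W MW ->] neq.
  have UW : U != W by apply: contraNneq neq => ->.
  rewrite -setI_eq0; apply/eqP/setP=> x; rewrite !inE; apply/negP=> /andP[Ux Wx].
  by have := trivIsetP tM _ _ MU MW UW; move/disjointFr/(_ Ux); rewrite Wx.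
- move=> d /imsetP[U MU ->]; have /edgesP[B [C [eU _]]] := subsetP sM _ MU.
  rewrite eU in MU *; have [_ _ /asboolP[p [q [eB eC r]]]] := rM _ _ MU.
  suff -> : lift atomP [set B; C] = [set p; q] by [].
  by apply/setP=> x; rewrite !inE -!blkE eB eC !inE.
- apply/bigcupsP=> d /imsetP[U MU ->]; have /edgesP[B [C [eU _]]] := subsetP sM _ MU.
  rewrite eU in MU *; have [ZB ZC _] := rM _ _ MU.
  by apply/subsetP=> x; rewrite !inE => /orP[]/eqP->; [move: ZB|move: ZC]; rewrite inE.
- by rewrite card_imset.
Qed.
End AtomInBrick.

(** * Triangles without removable edges *)

(* The only shores of 3-cuts that violate the bound of [shore_bound]. *)
Definition stuck_triangle (G : sgraph) (X : {set G}) :=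
  [/\ #|X| = 3, bd X = 3 &
    forall p q, p \in X -> q \in X -> adj p q -> ~ removable [set p; q]].

Lemma card_setD1 (T : finType) (X : {set T}) x : x \in X -> #|X :\ x| = #|X|.-1.
Proof. by move=> Xx; rewrite (cardsD1 x X) Xx. Qed.

Lemma card3P (T : finType) (X : {set T}) : #|X| = 3 -> exists t1 t2 t3,
  [/\ t1 != t2, t1 != t3, t2 != t3 & X = [set t1; t2; t3]].
Proof.
move=> X3; have : 0 < #|X| by rewrite X3.
case/card_gt0P=> t1 X1.
have /cards2P[t2 [t3 [t23 e]]] : #|X :\ t1| == 2.
  by rewrite card_setD1 ?X3.
exists t1, t2, t3.
have : t2 \in X :\ t1 by rewrite e set21.
have : t3 \in X :\ t1 by rewrite e set22.
rewrite !inE => /andP[n13 _] /andP[n12 _]; rewrite ![t1 == _]eq_sym; split=> //.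
by rewrite -setUA -e setD1K.
Qed.

Section Triangle.
Variable G : sgraph.
Hypothesis cubicG : cubic G.

Lemma triangle_adj (X : {set G}) : #|X| = 3 -> bd X = 3 ->
  forall p q, p \in X -> q \in X -> p != q -> adj p q.
Proof.
move=> X3 bX p q Xp Xq pq; apply/negPn/negP=> npq.
have dX : dg X X = 6 by have := bd_split cubicG X; rewrite X3 bX => /(@addIn 3 _ 6).
have le r : r \in X -> dg [set r] X <= 2.
  move=> Xr; rewrite dg1; have <- : #|X :\ r| = 2 by rewrite card_setD1 ?X3.
  apply: subset_leq_card; apply/subsetP=> s; rewrite !inE => /andP[-> rs].
  by rewrite andbT eq_sym (adj_neq rs).
have le1 : dg [set p] X <= 1.
  rewrite dg1; have <- : #|X :\ p :\ q| = 1.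
    by rewrite !card_setD1 ?X3 // !inE eq_sym pq.
  apply: subset_leq_card; apply/subsetP=> s; rewrite !inE => /andP[-> ps].
  rewrite [s == p]eq_sym (adj_neq ps) !andbT; apply: contraNneq npq => <-; exact: ps.
have : dg X X <= 5; last by rewrite dX.
have -> : dg X X = \sum_(r in X) dg [set r] X.
  by rewrite /dg; apply: eq_bigr => r _; rewrite big_set1.
rewrite (bigD1 p) //=; apply: (@leq_trans (1 + \sum_(r in X | r != p) 2)).
  by rewrite leq_add // leq_sum // => r /andP[Xr _]; apply: le.
rewrite sum_nat_const.
rewrite (eq_card (_ : _ =i X :\ p)); last by move=> r; rewrite !inE andbC.
by rewrite card_setD1 ?X3.
Qed.

End Triangle.

Section LinkTriangle.
Variable G : sgraph.
Hypotheses (cubicG : cubic G) (brickG : brick G).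
Let conG := brick_three_connected cubicG brickG.
Variable P : {set {set G}}.
Hypothesis atomP : atom P.
Local Notation A := (quotient P).
Local Notation blk := (blk atomP).
Local Notation Z := (big_blocks P).
Let blkE := blkE atomP.
Let cubicA : cubic A := quotient_cubic cubicG conG atomP.
Let conA : three_connected A := quotient_three_connected cubicG conG atomP.

(** The edge from [a] to [b] is hidden inside [D]; what survives of it in the atom is the edge that
    leaves [D] at the opposite vertex [u]. *)
Lemma link_triangle (D : A) (u a b u' : G) : val D = [set u; a; b] ->
  u != a -> u != b -> a != b -> adj u a -> adj u b -> adj a b -> adj u u' -> u' \notin val D ->
  ~ removable [set a; b] ->
  exists S : {set A}, #|S :&: Z| <= 1 /\
  ((exists X Y, doubleton S X Y D (blk u')) \/
   [/\ forall B C, adj B C -> (B \in S) != (C \in S), D \notin S, blk u' \in S & blk u' \in Z]).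
Proof.
move=> eD nua nub nab ua ub ab uu' u'D nr.
have [x [y [S [K bar]]]] := not_removable_barrier cubicG conG ab nr.
have Sa := bar_a bar; have Sb := bar_b bar.
have xny := adj_neq (bar_adj bar); have Sx := bar_x bar; have Sy := bar_y bar.
have inD z : z \in val D -> [\/ z = u, z = a | z = b].
  by rewrite eD !inE -orbA => /or3P[]/eqP->; [constructor 1|constructor 2|constructor 3].
have uD : u \in val D by rewrite eD !inE eqxx.
have aD : a \in val D by rewrite eD !inE eqxx orbT.
have bD : b \in val D by rewrite eD !inE eqxx orbT.
have D3 : 1 < #|(val D : {set G})|.
  by apply/card_gt1P; exists u, a.
(* A part containing [u] misses [a] or [b], so an edge of the triangle at [u] would join two parts,
   which only the edge from [a] to [b] may do. *)
have Su : u \in S.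
  apply/negPn/negP=> Su; have : u \in cover K by rewrite (bar_cover bar) inE.
  case/bigcupP=> C KC Cu; case: (boolP (a \in C)) => Ca.
    have Cb := bar_sep bar KC Ca.
    have /set2_inj[[e _]|[e _]] := bar_out bar KC Cu Cb Sb ub; first by rewrite e eqxx in nua.
    by rewrite e eqxx in nub.
  have /set2_inj[[e _]|[e _]] := bar_out bar KC Cu Ca Sa ua; first by rewrite e eqxx in nua.
  by rewrite e eqxx in nub.
have abD (B : A) : (a \in val B) || (b \in val B) -> B = D.
  by case/orP; rewrite blkE => /eqP<-; apply/eqP; rewrite -blkE.
have SD z : z \in S -> z \in val D -> z = u.
  by move=> Sz /inD[] // e; move: Sz; rewrite e ?(negbTE Sa) ?(negbTE Sb).
have sxy (B : A) : (a \in val B) || (b \in val B) -> ~~ ((x \in val B) && (y \in val B)).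
  move/abD->; apply/negP=> /andP[xD yD].
  by move: xny; rewrite (SD x Sx xD) (SD y Sy yD) eqxx.
have nbu q : adj u q -> q \notin val D -> q = u'.
  move=> uq qD; have nau' : a != u' by apply: contraNneq u'D => <-.
  have nbu' : b != u' by apply: contraNneq u'D => <-.
  case/or3P: (neighbours3 cubicG ua ub uu' nab nau' nbu' uq) => /eqP e //.
    by rewrite e aD in qD.
  by rewrite e bD in qD.
(* Otherwise the edge from [u] to [u'] is the one from [x] to [y]. A perfect matching with all three
   cut edges of [D] would contain it, hence also the edge from [a] to [b] by [bar_mate], which is
   absurd; so the cut of [D] would be tight. *)
have Su' : u' \notin S.
  apply/negP=> Su'; have exy := bar_in bar Su Su' uu'.
  have [D1|cD1] : #|val D : {set G}| = 1 \/ #|~: (val D : {set G})| = 1.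
  - apply: (brick_tight brickG) => m mP.
    have odd1 : odd #|[set z in val D | m z \notin val D]|.
      by rewrite (odd_mate mP) -(odd_bd cubicG) (atom_bd atomP (valP D)).
    have [aout|ain] := boolP (m a \notin val D); last first.
      have : #|[set z in val D | m z \notin val D]| <= 2.
        apply: leq_trans (_ : #|[set u; b]| <= 2); last by rewrite cards2; case: (_ == _).
        apply: subset_leq_card; apply/subsetP=> z; rewrite !inE => /andP[/inD[]-> zm].
        + by rewrite eqxx.
        + by rewrite zm in ain.
        + by rewrite eqxx orbT.
      by move: odd1; case: #|_| => [|[|[]]].
    have [uout|uin] := boolP (m u \notin val D); last first.
      have : #|[set z in val D | m z \notin val D]| <= 2.
        apply: leq_trans (_ : #|[set a; b]| <= 2); last by rewrite cards2; case: (_ == _).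
        apply: subset_leq_card; apply/subsetP=> z; rewrite !inE => /andP[/inD[]-> zm].
        + by rewrite zm in uin.
        + by rewrite eqxx.
        + by rewrite eqxx orbT.
      by move: odd1; case: #|_| => [|[|[]]].
    have mu : m u = u' by apply: nbu => //; case: (mP u).
    have mxy : m x = y.
      by case: (set2_inj exy) => -[<- <-] //; rewrite -mu; case: (mP u).
    by rewrite (bar_mate bar mP mxy) bD in aout.
  - by rewrite D1 in D3.
  - by have := card_coblock cubicG atomP D; rewrite cD1.
have blkD z : (z \in val D) = (blk z == D) := blkE z D.
have uDb : blk u = D by apply/eqP; rewrite -blkE.
have nuu' : blk u != blk u' by rewrite uDb eq_sym -blkE.
have := @link _ cubicG brickG _ atomP _ _ _ _ _ _ bar sxy u u' uu' nuu'.
rewrite uDb aD => /(_ isT Su') [].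
- move=> B /abD->; split; last first.
    by move=> p q Sp pD qD pq; have pu := SD _ Sp pD; split=> //; apply: nbu; rewrite // -pu.
  have ex c d : c \in val D -> c != u -> d \in val D -> d != u -> c != d -> adj u c -> adj c d ->
      exists c', c' \notin val D /\ adj c c'.
    move=> cD cu dD du cd uc cdj; have cuj : adj c u by rewrite adjC.
    have ud : u != d by rewrite eq_sym.
    have [c' [cc' c'u c'd]] := third_neighbour cubicG cuj cdj ud.
    exists c'; split=> //; apply/negP=> c'D; have nc := adj_neq cc'.
    move: c'u c'd nc cu du cd; have := inD _ c'D; have := inD _ cD; have := inD _ dD.
    by case=> -> [] -> [] ->; rewrite ?eqxx.
  have bu : b != u by rewrite eq_sym.
  have au : a != u by rewrite eq_sym.
  have ba : b != a by rewrite eq_sym.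
  have baj : adj b a by rewrite adjC.
  have [a' [a'D aa']] := ex a b aD au bD bu nab ua ab.
  have [b' [b'D bb']] := ex b a bD bu aD au ba ub baj.
  rewrite /out dgE; apply/card_gt1P; exists (a, a'), (b, b').
  rewrite !in_set /= aD bD Sa Sb a'D b'D aa' bb'; split=> //.
  by rewrite xpair_eqE (negbTE nab).
- move=> p q npq e; have pin : p \in [set a; b] by rewrite -e set21.
  have qin : q \in [set a; b] by rewrite -e set22.
  have inab z : z \in [set a; b] -> blk z = D.
    by rewrite !inE => /orP[]/eqP->; apply/eqP; rewrite -blkE.
  by rewrite (inab _ pin) (inab _ qin) eqxx in npq.
- by move=> cS h; exists [set B : A | out S B <= 1].
Qed.

(** The vertices on which the two bipartitions disagree form a set whose cut consists of edges of
    the doubleton, at most two. *)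
Lemma bipartition_no_doubleton (S S' : {set A}) X Y B C :
  (forall B C, adj B C -> (B \in S) != (C \in S)) -> doubleton S' X Y B C -> False.
Proof.
move=> bip D; pose W := [set z | (z \in S) != (z \in S')].
have BC := dbl_ab D.
have nW : (B \in W) != (C \in W).
  rewrite !inE (negbTE (dbl_a D)) (negbTE (dbl_b D)).
  by have := bip _ _ BC; do 2!case: (_ \in _).
have W0 : W != set0 by apply: contraNneq nW => ->; rewrite !inE.
have WT : W != setT by apply: contraNneq nW => ->; rewrite !inE.
have := conA W0 WT; rewrite -card_cut.
suff /subset_leq_card : cut W \subset [set [set X; Y]; [set B; C]].
  by rewrite cards2; case: (_ == _) => le /(leq_trans)/(_ le).
apply/subsetP=> h hW; have /edgesP[U [V [hE uv]]] : h \in edges A.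
  by move: hW; rewrite inE => /andP[].
move: hW; rewrite hE in_cut uv /= !inE => neq.
have e : (U \in S') = (V \in S').
  by move: neq (bip _ _ uv); do 4!case: (_ \in _).
by case: (dbl_cut D uv e) => ->; rewrite eqxx ?orbT.
Qed.

Lemma bipartition_uniq (S S' : {set A}) D : (forall B C, adj B C -> (B \in S) != (C \in S)) ->
  (forall B C, adj B C -> (B \in S') != (C \in S')) -> D \notin S -> D \notin S' -> S = S'.
Proof.
move=> bip bip' SD SD'; pose W := [set z | (z \in S) != (z \in S')].
have WD : D \notin W by rewrite inE (negbTE SD) (negbTE SD').
have [W0|W0] := eqVneq W set0.
  apply/setP=> z; have /setP/(_ z) := W0; rewrite !inE.
  by do 2!case: (_ \in _).
have := conA W0 (setT_neq WD); suff -> : bd W = 0 by [].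
apply/eqP/dg_eq0P=> U V; rewrite !inE => WU WV; apply/negP=> UV.
by move: WU WV (bip _ _ UV) (bip' _ _ UV); do 4!case: (_ \in _).
Qed.

(** Each of the three edges at [D] yields a doubleton or a bipartition of the atom. Once
    bipartitions are excluded, [three_doubletons] gives order 4. *)
Lemma stuck_triangle_atom (D : A) : stuck_triangle (val D) -> #|A| = 4 /\ #|Z| <= 2.
Proof.
case=> D3 bD nrD; have [t1 [t2 [t3 [n12 n13 n23 eD]]]] := card3P D3.
have adjD := triangle_adj cubicG D3 bD.
have [D1 D2 D4] : [/\ t1 \in val D, t2 \in val D & t3 \in val D].
  by rewrite eD !inE !eqxx !orbT.
have outer t a b : t \in val D -> a \in val D -> b \in val D -> t != a -> t != b -> a != b ->
    val D = [set t; a; b] -> exists t', [/\ t' \notin val D & adj t t'].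
  move=> tD aD bDd ta tb ab e; have [c [tc ca cb]] := third_neighbour cubicG (adjD _ _ tD aD ta) (adjD _ _ tD bDd tb) ab.
  by exists c; split=> //; rewrite e !inE (negbTE ca) (negbTE cb) eq_sym (negbTE (adj_neq tc)).
have e2 : val D = [set t2; t1; t3] by rewrite eD [[set t1; t2]]setUC.
have e3 : val D = [set t3; t1; t2] by rewrite eD setUC setUA.
have [n21 n31 n32] : [/\ t2 != t1, t3 != t1 & t3 != t2] by rewrite ![_ == t1]eq_sym n12 n13 eq_sym.
have [u1 [u1D tu1]] := outer _ _ _ D1 D2 D4 n12 n13 n23 eD.
have [u2 [u2D tu2]] := outer _ _ _ D2 D1 D4 n21 n23 n13 e2.
have [u3 [u3D tu3]] := outer _ _ _ D4 D1 D2 n31 n32 n12 e3.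
have tD t : t \in val D -> blk t = D by move=> h; apply/eqP; rewrite -blkE.
have adjB t u : t \in val D -> u \notin val D -> adj t u -> adj D (blk u).
  move=> h1 h2 tu; rewrite -(tD t h1); apply: adj_blk tu _.
  by rewrite (tD t h1) eq_sym -blkE.
have distinct t u t' u' : t \in val D -> t' \in val D -> u \notin val D -> u' \notin val D ->
    adj t u -> adj t' u' -> t != t' -> blk u != blk u'.
  move=> h h' hu hu' tu tu' tt'; apply/eqP=> e.
  have Du : D != blk u by rewrite eq_sym -blkE.
  have := dg_adj cubicG conG atomP Du; rewrite (adjB t u) // => dg1e.
  have : 1 < dg (val D) (val (blk u)); last by rewrite dg1e.
  have ub : u \in val (blk u) by rewrite blkE.
  have ub' : u' \in val (blk u) by rewrite blkE e.
  move: (val (blk u)) ub ub' => X ub ub'.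
  rewrite dgE; apply/card_gt1P; exists (t, u), (t', u'); rewrite !in_set /= h h' tu tu' ub ub'.
  by split=> //; rewrite xpair_eqE (negbTE tt').
have L1 := link_triangle eD n12 n13 n23 (adjD _ _ D1 D2 n12) (adjD _ _ D1 D4 n13)
  (adjD _ _ D2 D4 n23) tu1 u1D (nrD _ _ D2 D4 (adjD _ _ D2 D4 n23)).
have L2 := link_triangle e2 n21 n23 n13 (adjD _ _ D2 D1 n21) (adjD _ _ D2 D4 n23)
  (adjD _ _ D1 D4 n13) tu2 u2D (nrD _ _ D1 D4 (adjD _ _ D1 D4 n13)).
have L3 := link_triangle e3 n31 n32 n12 (adjD _ _ D4 D1 n31) (adjD _ _ D4 D2 n32)
  (adjD _ _ D1 D2 n12) tu3 u3D (nrD _ _ D1 D2 (adjD _ _ D1 D2 n12)).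
have b12 := distinct _ _ _ _ D1 D2 u1D u2D tu1 tu2 n12.
have b13 := distinct _ _ _ _ D1 D4 u1D u3D tu1 tu3 n13.
have b23 := distinct _ _ _ _ D2 D4 u2D u3D tu2 tu3 n23.
pose linked B := exists S : {set A}, #|S :&: Z| <= 1 /\ exists X Y, doubleton S X Y D B.
pose degenerate (S : {set A}) B := [/\ forall B C, adj B C -> (B \in S) != (C \in S), D \notin S, B \in S & B \in Z].
(* A bipartition cannot coexist with a doubleton, and two degenerate edges at [D] share their
   bipartition, whose side [S] would then have two big blocks. *)
have bad S B B' : #|S :&: Z| <= 1 -> degenerate S B -> B != B' ->
    (exists S, #|S :&: Z| <= 1 /\ ((exists X Y, doubleton S X Y D B') \/ degenerate S B')) -> False.
  move=> cS [bip SD SB ZB] nB [S' [cS' [[X [Y Dbl]]|[bip' SD' SB' ZB']]]].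
    exact: bipartition_no_doubleton bip Dbl.
  have eS := bipartition_uniq bip bip' SD SD'; rewrite -eS in SB'.
  move: cS; rewrite leqNgt => /negP[]; apply/card_gt1P; exists B, B'.
  by rewrite !in_setI SB ZB SB' ZB'.
have [K1 K2 K3] : [/\ linked (blk u1), linked (blk u2) & linked (blk u3)].
  split.
  - have [S [cS [h|h]]] := L1; first by exists S.
    by case: (bad _ _ _ cS h b12 L2).
  - have [S [cS [h|h]]] := L2; first by exists S.
    by case: (bad _ _ _ cS h b23 L3).
  - have [S [cS [h|h]]] := L3; first by exists S.
    by rewrite eq_sym in b13; case: (bad _ _ _ cS h b13 L1).
have inD B : linked B -> in_doubleton D B.
  by case=> S [_ [X [Y Dbl]]]; apply/asboolP; exists S, X, Y.
have A1 := adjB _ _ D1 u1D tu1; have A2 := adjB _ _ D2 u2D tu2; have A3 := adjB _ _ D4 u3D tu3.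
have A4 : #|A| = 4.
  by apply: (three_doubletons cubicA conA (quotient_irr cubicG conG atomP) A1 A2 A3); rewrite ?inD.
split=> //; rewrite leqNgt; apply/negP=> Z3.
have DZ : D \in Z by rewrite inE D3.
have : 1 < #|Z :\ D| by move: Z3; rewrite (cardsD1 D) DZ.
case/card_gt1P=> B [C []]; rewrite !in_setD1 => /andP[BD ZB] /andP[CD ZC] BC.
have allb E : E != D -> [|| E == blk u1, E == blk u2 | E == blk u3].
  move=> ED; apply: (neighbours3 cubicA A1 A2 A3 b12 b13 b23).
  by apply: complete4; rewrite // eq_sym.
(* [E] is the fourth vertex of the atom. In the doubleton of the edge from [D] to [E] the side [S]
   lies in [[set B; C]], so it would contain two big blocks. *)
have [E [kE EB EC ED]] : exists E, [/\ linked E, E != B, E != C & E != D].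
  have DE u : u \notin val D -> blk u != D by rewrite -blkE.
  case: (boolP ((blk u1 == B) || (blk u1 == C))) => [h1|/norP[h1 h1']]; last by exists (blk u1); rewrite DE.
  case: (boolP ((blk u2 == B) || (blk u2 == C))) => [h2|/norP[h2 h2']]; last by exists (blk u2); rewrite DE.
  exists (blk u3); rewrite DE //; split=> //.
    by apply/eqP=> e; move: h1 h2; rewrite -e (negbTE b13) (negbTE b23) /= => /eqP e1 /eqP e2'; rewrite e1 e2' eqxx in b12.
  by apply/eqP=> e; move: h1 h2; rewrite -e (negbTE b13) (negbTE b23) !orbF => /eqP e1 /eqP e2'; rewrite e1 e2' eqxx in b12.
have [S [cS [X [Y Dbl]]]] := kE.
have SX := dbl_x Dbl; have SY := dbl_y Dbl.
have four W : W \in S -> W \in Z.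
  move=> SW; have WD : W != D by apply: contraTneq SW => ->; exact: (dbl_a Dbl).
  have WE : W != E by apply: contraTneq SW => ->; exact: (dbl_b Dbl).
  have : W \in [set B; C].
    have e4 : [set D; E] :|: [set B; C] = setT.
      apply/eqP; rewrite eqEcard subsetT cardsT A4 cardsU !cards2 BC eq_sym ED.
      rewrite (_ : _ :&: _ = set0) ?cards0 //.
      apply/setP=> V; rewrite !inE; apply/negP=> /andP[/orP[]/eqP-> /orP[]/eqP e].
      + by rewrite e eqxx in BD.
      + by rewrite e eqxx in CD.
      + by rewrite e eqxx in EB.
      + by rewrite e eqxx in EC.
    by have := in_setT W; rewrite -e4 in_setU in_set2 (negbTE WD) (negbTE WE).
  by rewrite in_set2 => /orP[]/eqP->.
move: cS; rewrite leqNgt => /negP[]; apply/card_gt1P; exists X, Y.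
by rewrite !in_setI SX SY !four // adj_neq // (dbl_xy Dbl).
Qed.

End LinkTriangle.

(** * Induction over 3-cuts *)

Section Shores.
Variable G : sgraph.
Hypotheses (cubicG : cubic G) (brickG : brick G).
Let conG := brick_three_connected cubicG brickG.
Implicit Types X Y W : {set G}.

Lemma bd3_neq0 X : bd X = 3 -> exists x, x \in X.
Proof.
by move=> b3; have [X0|[x]] := set_0Vmem X; [move: b3; rewrite X0 /bd dg0l | exists x].
Qed.

Lemma bd3_card X : bd X = 3 -> 1 < #|X| -> 2 < #|X|.
Proof. by move=> b3; have := odd_bd cubicG X; rewrite b3; case: #|X| => [|[|[]]]. Qed.

(** Single vertices have cuts of size 3 too; those that are maximal here become the real vertices of
    the atom. *)
Definition inner_shores X := [set Y | maxset (fun Y => (Y \proper X) && (bd Y == 3)) Y].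
Definition shore_blocks X := ~: X |: inner_shores X.

Lemma inner_shoresP X Y : Y \in inner_shores X -> [/\ Y \proper X, bd Y = 3 &
  forall W, W \proper X -> bd W = 3 -> Y \subset W -> W = Y].
Proof.
rewrite inE => /maxsetP[/andP[pY /eqP bY] maxY]; split=> // W pW bW sYW.
by apply: maxY; rewrite // pW bW eqxx.
Qed.

Lemma inner_shore_ex X W : W \proper X -> bd W = 3 ->
  exists2 Y, Y \in inner_shores X & W \subset Y.
Proof.
move=> pW bW; have [|Y mY sWY] := @maxset_exists _ (fun Y => (Y \proper X) && (bd Y == 3)) W.
  by rewrite pW bW eqxx.
by exists Y; rewrite // inE.
Qed.

Section ShoreAtom.
Variable X : {set G}.
Hypotheses (bX : bd X = 3) (X3 : 2 < #|X|) (CX3 : 2 < #|~: X|).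

Lemma inner_shore_at x : x \in X -> exists2 Y, Y \in inner_shores X & x \in Y.
Proof.
move=> Xx; have [||Y mY] := @inner_shore_ex X [set x]; last by rewrite sub1set; exists Y.
  rewrite properEcard sub1set Xx cards1; exact: leq_trans X3.
exact: bd1.
Qed.

(** Maximal shores are disjoint by [laminar], as two proper subsets of [X] cannot cover the graph. A
    shore of a 3-cut properly inside [X] lies in a maximal one, and if saturated it equals it; other
    shores are reduced to this by complementation. *)
Lemma shore_atom : atom (shore_blocks X).
Proof.
have bdP B : B \in shore_blocks X -> bd B = 3.
  by case/setU1P=> [->|/inner_shoresP[]]; rewrite ?bdC.
have XT : X != setT by apply: contraTneq CX3 => ->; rewrite setCT cards0.
have tI : trivIset (shore_blocks X).
  have dC Y : Y \in inner_shores X -> [disjoint ~: X & Y].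
    by move=> /inner_shoresP[/proper_sub sY _ _]; rewrite disjoint_sym disjoints_subset setCK.
  apply/trivIsetP=> B C /setU1P[->|IB] /setU1P[->|IC]; rewrite ?eqxx // => neq.
  - exact: dC.
  - by rewrite disjoint_sym; apply: dC.
  - have [pB bB maxB] := inner_shoresP IB; have [pC bC maxC] := inner_shoresP IC.
    case: (laminar cubicG conG bB bC) => [e|s|s|e].
    + by rewrite -setI_eq0 e.
    + by rewrite (maxB _ pC bC s) eqxx in neq.
    + by rewrite (maxC _ pB bB s) eqxx in neq.
    + by move: XT; rewrite -subTset -e subUset !proper_sub.
have cov : cover (shore_blocks X) = setT.
  apply/setP=> x; rewrite inE; apply/bigcupP; case: (boolP (x \in X)) => Xx.
    by have [Y IY Yx] := inner_shore_at Xx; exists Y; rewrite // inE IY orbT.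
  by exists (~: X); rewrite !inE ?eqxx.
split=> //.
- apply/and3P; split=> //; first by rewrite cov.
  by apply/negP=> /bdP/bd3_neq0[x]; rewrite inE.
- have [x Xx] := bd3_neq0 bX; have [Y IY Yx] := inner_shore_at Xx.
  have [pY _ _] := inner_shoresP IY; have /properP[_ [z Xz Yz]] := pY.
  have [Y' IY' Yz'] := inner_shore_at Xz.
  have YY' : Y != Y' by apply: contraNneq Yz => ->.
  have sC V : V \in inner_shores X -> ~: X != V.
    move=> /inner_shoresP[/proper_sub sV bV _]; apply/eqP=> e.
    have [v Vv] := bd3_neq0 bV; have := subsetP sV _ Vv.
    by move: Vv; rewrite -e inE => /negbTE->.
  have <- : #|~: X |: [set Y; Y']| = 3.
    by rewrite cardsU1 cards2 YY' !inE negb_or !sC.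
  apply: subset_leq_card; rewrite subUset sub1set setU11 subUset !sub1set.
  by rewrite !(setU1r) ?IY ?IY'.
- have aux W : W \subset X -> saturated (shore_blocks X) W -> bd W = 3 ->
      W \in shore_blocks X \/ ~: W \in shore_blocks X.
    move=> sWX sat bW; case: (eqVneq W X) => [->|WX]; first by right; rewrite setU11.
    have pW : W \proper X by rewrite properEneq WX.
    have [Y IY sWY] := inner_shore_ex pW bW; left.
    have PY : Y \in shore_blocks X by rewrite inE IY orbT.
    case: (sat Y PY) => [sYW|dYW].
      by have -> : W = Y by apply/eqP; rewrite eqEsubset sWY.
    have [w Ww] := bd3_neq0 bW.
    by have := disjointFr dYW (subsetP sWY _ Ww); rewrite Ww.
  move=> W sat bW; have PC : ~: X \in shore_blocks X by rewrite setU11.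
  case: (sat _ PC) => [sCW|dCW].
    have [|||h|h] := aux (~: W); rewrite ?bdC //; last by left; rewrite setCK in h.
    + by rewrite -setCS setCK.
    + move=> B PB; case: (sat B PB) => [sB|dB]; [right|left].
        by rewrite disjoints_subset setCK.
      by rewrite -disjoints_subset.
    + by right.
  by apply: aux => //; rewrite -setCS -disjoints_subset.
Qed.
End ShoreAtom.

Lemma lift_bigcup (P : {set {set G}}) (atomP : atom P) (U : {set quotient P}) :
  lift atomP U = \bigcup_(B in U) val B.
Proof.
apply/setP=> x; rewrite inE; apply/idP/bigcupP => [Ux|[B UB]].
  by exists (blk atomP x); rewrite // blkE.
by rewrite (blkE atomP) => /eqP->.
Qed.

Lemma lift_setC1 X (atomX : atom (shore_blocks X)) (B0 : quotient (shore_blocks X)) :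
  val B0 = ~: X -> lift atomX (~: [set B0]) = X.
Proof. by move=> e; rewrite liftC lift1 e setCK. Qed.

Lemma lift_disjoint (P : {set {set G}}) (atomP : atom P) (U W : {set quotient P}) :
  [disjoint U & W] -> [disjoint lift atomP U & lift atomP W].
Proof.
move=> dUW; rewrite disjoints_subset; apply/subsetP=> x; rewrite !inE => Ux.
by rewrite (disjointFr dUW Ux).
Qed.

(* With [+ 2] on the left the bounds for the children of a shore add up, by
   [atom_removable_matching], to the bound for the shore itself. *)
Theorem shore_bound X : bd X = 3 -> 2 < #|X| -> 2 < #|~: X| ->
  stuck_triangle X \/ exists n, removable_matching X n /\ #|X| + 2 <= 7 * n.
Proof.
have [k] := ubnP #|X|; elim: k => // k IHk in X * => leX bX X3 CX3.
have atomX := shore_atom bX X3 CX3; set P := shore_blocks X in atomX.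
have [B0 eB0] := block_ex (setU11 (~: X) (inner_shores X) : ~: X \in P).
pose Z := big_blocks P.
have ZB0 : B0 \in Z by rewrite inE eB0; apply: ltnW.
have eX : lift atomX (~: [set B0]) = X by apply: lift_setC1.
pose Zc := Z :\ B0.
have splitX : ~: [set B0] = ~: Z :|: Zc.
  by apply/setP=> B; rewrite !in_setC in_setU in_setC in_setD1 in_set1; case: (eqVneq B B0) => [->|]; rewrite ?ZB0 //= orNb.
have dZ : [disjoint ~: Z & Zc].
  by rewrite disjoints_subset; apply/subsetP=> B; rewrite !in_setC in_setD1 => /negbTE->; rewrite andbF.
have liftU : X = lift atomX (~: Z) :|: lift atomX Zc.
  by rewrite -[LHS]eX splitX; apply/setP=> x; rewrite !inE.
have dlift := lift_disjoint atomX dZ.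
have cX : #|X| = #|~: Z| + \sum_(B in Zc) #|(val B : {set G})|.
  rewrite {1}liftU cardsU (eqP (_ : _ :&: _ == set0)) ?setI_eq0 // cards0 subn0.
  by rewrite (card_lift_real cubicG) card_lift.
have cZ : #|Z| = #|Zc|.+1 by rewrite (cardsD1 B0 Z) ZB0.
have childP (B : quotient P) : B \in Zc -> [/\ #|(val B : {set G})| < k, bd (val B) = 3, 2 < #|(val B : {set G})| & 2 < #|~: (val B : {set G})|].
  rewrite in_setD1 => /andP[BB0 ZB]; have := valP B.
  case/setU1P=> [e|/inner_shoresP[pB bB _]].
    by case/eqP: BB0; apply: val_inj; rewrite e eB0.
  split=> //; first exact: leq_trans (proper_card pB) _.
    by apply: bd3_card => //; move: ZB; rewrite inE.
  by apply: leq_trans CX3 (subset_leq_card _); rewrite setCS proper_sub.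
(* In this case [~: X] is the only big block, so [X] has three vertices: it is stuck, or one
   removable edge gives 3 + 2 <= 7. *)
have [[A4 Z1]|nexc] := pselect (#|quotient P| = 4 /\ #|Z| <= 1).
  have Zc0 : Zc = set0 by apply/eqP; rewrite -cards_eq0 -leqn0 -ltnS -cZ.
  have X3' : #|X| = 3.
    have cCZ := cardsC Z; rewrite cX Zc0 big_set0 addn0.
    by move: cCZ; rewrite cZ Zc0 cards0 A4 add1n => -[].
  have [st|nst] := pselect (stuck_triangle X); [by left|right; exists 1].
  split; last by rewrite X3'.
  apply: contrapT => nr; apply: nst; split=> // p q Xp Xq pq r; apply: nr.
  exact: removable_matching1 r.
have [n [rn len]] := atom_removable_matching cubicG brickG atomX nexc; right.
(* A stuck child has no bound of its own, but its atom is a [K4] with two real vertices and no other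
   child. There [len] forces [n > 0], and 2 + 3 + 2 <= 7. *)
have [[B [ZcB stB]]|nst] := pselect (exists B, B \in Zc /\ stuck_triangle (val B)).
  have [A4 Z2] := stuck_triangle_atom cubicG brickG atomX stB.
  have Zc1 : #|Zc| = 1.
    by apply/eqP; rewrite eqn_leq -ltnS -cZ Z2; apply/card_gt0P; exists B.
  have eZc : Zc = [set B].
    by apply/eqP; rewrite eq_sym eqEcard sub1set ZcB Zc1 cards1.
  have cRZ : #|~: Z| = 2.
    by have := cardsC Z; rewrite cZ Zc1 A4 !addSn add0n => -[].
  exists n; split.
    apply: removable_matchingS rn.
    by apply: subset_trans (subsetUl _ (lift atomX Zc)) _; rewrite -liftU.
  have [B3 _ _] := stB.
  rewrite cX cRZ eZc big_set1 B3; move: len; rewrite -/Z cRZ cZ Zc1; clear; lia.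
have [f fP] : exists f : quotient P -> nat, forall B, B \in Zc ->
    removable_matching (val B) (f B) /\ #|(val B : {set G})| + 2 <= 7 * f B.
  have ex (B : quotient P) : exists j, B \in Zc ->
      removable_matching (val B) j /\ #|(val B : {set G})| + 2 <= 7 * j.
    case: (boolP (B \in Zc)) => ZB; last by exists 0.
    have [lek bB B3 CB3] := childP B ZB.
    case: (IHk _ lek bB B3 CB3) => [st|[j hj]]; last by exists j.
    by case: nst; exists B.
  exact: fin_all_exists ex.
exists (n + \sum_(B in Zc) f B); split.
  apply: (@removable_matchingS _ (lift atomX (~: Z) :|: lift atomX Zc)); first by rewrite -liftU.
  apply: removable_matchingU dlift rn _.
  rewrite lift_bigcup; apply: removable_matching_bigcup => [B C ZB ZC BC|B /fP[] //].
  have [/and3P[_ tP _] _ _ _] := atomX.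
  by apply: (trivIsetP tP); rewrite ?(valP B) ?(valP C).
have sumf : \sum_(B in Zc) #|(val B : {set G})| + 2 * #|Zc| <= 7 * \sum_(B in Zc) f B.
  rewrite big_distrr mulnC -sum_nat_const -big_split /=.
  by apply: leq_sum => B /fP[].
rewrite cX; move: len sumf; rewrite -/Z cZ.
move: (\sum_(B in Zc) f B) (\sum_(B in Zc) _) => s1 s2; clear; lia.
Qed.
End Shores.

(** * The exceptional graphs *)

Section Isomorphism.
Variables (G H : sgraph) (g : H -> G).
Hypotheses (cubicG : cubic G) (inj_g : injective g) (cardGH : #|G| = #|H|).
Hypothesis adj_g : forall i j, adj i j -> adj (g i) (g j).
Hypothesis nbrH : forall i : H, exists p q r,
  [&& adj i p, adj i q, adj i r, p != q, p != r & q != r].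

(** The images of the three neighbours in [H] already fill a neighbourhood in the cubic graph [G],
    so adjacency is reflected as well as preserved. *)
Lemma isomorphic_embed : isomorphic G H.
Proof.
have [f gK fK] : bijective g by apply: inj_card_bij; rewrite // cardGH.
exists f => [|x y]; first by exists g.
rewrite -{2}(fK x) -{2}(fK y); apply/idP/idP => [/adj_g //|].
have [p [q [r /and5P[ip iq ir pq /andP[pr qr]]]]] := nbrH (f x).
move=> h; have := neighbours3 cubicG (adj_g ip) (adj_g iq) (adj_g ir) _ _ _ h.
by rewrite !(inj_eq inj_g) => /(_ pq pr qr) /or3P[]/eqP->.
Qed.
End Isomorphism.

Lemma isomorphic_K4 (G : sgraph) : cubic G -> #|G| = 4 -> isomorphic G K4.
Proof.
move=> cubicG G4; pose f (x : G) : K4 := cast_ord G4 (enum_rank x).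
have inj_f : injective f by move=> x y /cast_ord_inj/enum_rank_inj.
exists f; first by apply: inj_card_bij; rewrite // card_ord G4.
move=> x y; rewrite [LHS](_ : _ = (x != y)); last by rewrite -(inj_eq inj_f).
by apply/idP/idP => [/(complete4 cubicG G4)|/adj_neq].
Qed.

Section SeqEmbedding.
Variables (G : sgraph) (n : nat) (s : seq G) (x0 : G).
Hypotheses (size_s : size s = n) (uniq_s : uniq s).

Lemma nth_ord_inj : injective (fun i : 'I_n => nth x0 s i).
Proof.
by move=> i j /eqP; rewrite nth_uniq ?size_s // => /eqP/val_inj.
Qed.
End SeqEmbedding.

(** The list runs along the 6-cycle of nonadjacent pairs: the triangles occupy the even and the odd
    positions, and opposite positions are joined by the remaining three edges. *)
Lemma isomorphic_C6bar (G : sgraph) (a1 a2 a3 b1 b2 b3 : G) : cubic G -> #|G| = 6 ->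
  uniq [:: a1; b3; a2; b1; a3; b2] ->
  adj a1 a2 -> adj a1 a3 -> adj a2 a3 -> adj b1 b2 -> adj b1 b3 -> adj b2 b3 ->
  adj a1 b1 -> adj a2 b2 -> adj a3 b3 -> isomorphic G C6bar.
Proof.
move=> cubicG G6 us *.
pose s := [:: a1; b3; a2; b1; a3; b2].
have inj := @nth_ord_inj G 6 s a1 erefl us.
apply: (@isomorphic_embed G C6bar _ cubicG inj); first by rewrite card_ord.
- case=> [[|[|[|[|[|[|//]]]]]] ?] [[|[|[|[|[|[|//]]]]]] ?]; move=> // _ /=; by [|rewrite adjC].
- pose o k (h : k < 6) : 'I_6 := Ordinal h.
  case=> [[|[|[|[|[|[|//]]]]]] ?].
  + by exists (@o 2 isT), (@o 3 isT), (@o 4 isT).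
  + by exists (@o 3 isT), (@o 4 isT), (@o 5 isT).
  + by exists (@o 0 isT), (@o 4 isT), (@o 5 isT).
  + by exists (@o 0 isT), (@o 1 isT), (@o 5 isT).
  + by exists (@o 0 isT), (@o 1 isT), (@o 2 isT).
  + by exists (@o 1 isT), (@o 2 isT), (@o 3 isT).
Qed.

Lemma isomorphic_R8 (G : sgraph) (u v w x y z u1 v1 : G) : cubic G -> #|G| = 8 ->
  uniq [:: u; v; w; x; y; z; u1; v1] ->
  adj u v -> adj u w -> adj v w -> adj x y -> adj x z -> adj y z -> adj w z ->
  adj u u1 -> adj u1 x -> adj v v1 -> adj v1 y -> adj u1 v1 -> isomorphic G R8.
Proof.
move=> cubicG G8 us *.
pose s := [:: u; v; w; x; y; z; u1; v1].
have inj := @nth_ord_inj G 8 s u erefl us.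
have adj_s : all (fun e => adj (nth u s e.1) (nth u s e.2)) R8_edges by rewrite /=; do !(apply/andP; split=> //).
apply: (@isomorphic_embed G R8 _ cubicG inj); first by rewrite card_ord.
- move=> i j /orP[] /(allP adj_s) //=; by rewrite adjC.
- pose o k (h : k < 8) : 'I_8 := Ordinal h.
  case=> [[|[|[|[|[|[|[|[|//]]]]]]]] ?].
  + by exists (@o 1 isT), (@o 2 isT), (@o 6 isT).
  + by exists (@o 0 isT), (@o 2 isT), (@o 7 isT).
  + by exists (@o 0 isT), (@o 1 isT), (@o 5 isT).
  + by exists (@o 4 isT), (@o 5 isT), (@o 6 isT).
  + by exists (@o 3 isT), (@o 5 isT), (@o 7 isT).
  + by exists (@o 2 isT), (@o 3 isT), (@o 4 isT).
  + by exists (@o 0 isT), (@o 3 isT), (@o 7 isT).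
  + by exists (@o 1 isT), (@o 4 isT), (@o 6 isT).
Qed.

Section Triangles.
Variable G : sgraph.
Hypothesis cubicG : cubic G.

Lemma triangle_out_uniq (X : {set G}) x y z : #|X| = 3 -> bd X = 3 -> x \in X ->
  y \notin X -> z \notin X -> adj x y -> adj x z -> y = z.
Proof.
move=> X3 bX Xx Xy Xz xy xz; have adjX := triangle_adj cubicG X3 bX.
have : 1 < #|X :\ x| by rewrite card_setD1 ?X3.
case/card_gt1P=> p [q []]; rewrite !in_setD1 => /andP[px Xp] /andP[qx Xq] pq.
have xp : adj x p by apply: adjX; rewrite // eq_sym.
have xq : adj x q by apply: adjX; rewrite // eq_sym.
have py : p != y by apply: contraNneq Xy => <-.
have qy : q != y by apply: contraNneq Xy => <-.
case/or3P: (neighbours3 cubicG xp xq xy pq py qy xz) => /eqP e; last by rewrite e.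
  by rewrite e Xp in Xz.
by rewrite e Xq in Xz.
Qed.

Lemma triangle_out_ex (X : {set G}) x : #|X| = 3 -> bd X = 3 -> x \in X ->
  exists2 y, y \notin X & adj x y.
Proof.
move=> X3 bX Xx; have adjX := triangle_adj cubicG X3 bX.
have : 1 < #|X :\ x| by rewrite card_setD1 ?X3.
case/card_gt1P=> p [q []]; rewrite !in_setD1 => /andP[px Xp] /andP[qx Xq] pq.
have xp : adj x p by apply: adjX; rewrite // eq_sym.
have xq : adj x q by apply: adjX; rewrite // eq_sym.
have [y [xy yp yq]] := third_neighbour cubicG xp xq pq; exists y => //.
apply/negP=> Xy; have : #|[set x; y; p; q]| <= 3.
  by rewrite -X3; apply: subset_leq_card; rewrite !subUset !sub1set Xx Xy Xp Xq.
have -> : [set x; y; p; q] = x |: (y |: [set p; q]) by rewrite !setUA.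
by rewrite !cardsU1 cards1 !inE !negb_or (adj_neq xy) (adj_neq xp) (adj_neq xq) yp yq pq.
Qed.

Lemma isomorphic_two_triangles (X : {set G}) : #|X| = 3 -> #|~: X| = 3 -> bd X = 3 ->
  isomorphic G C6bar.
Proof.
move=> X3 CX3 bX; have bCX : bd (~: X) = 3 by rewrite bdC.
have [a1 [a2 [a3 [n12 n13 n23 eX]]]] := card3P X3.
have [A1 A2 A3] : [/\ a1 \in X, a2 \in X & a3 \in X] by rewrite eX !inE !eqxx !orbT.
have [b1 B1 ab1] := triangle_out_ex X3 bX A1.
have [b2 B2 ab2] := triangle_out_ex X3 bX A2.
have [b3 B3 ab3] := triangle_out_ex X3 bX A3.
have adjX := triangle_adj cubicG X3 bX; have adjC' := triangle_adj cubicG CX3 bCX.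
have inC b : b \notin X -> b \in ~: X by rewrite inE.
have nC a : a \in X -> a \notin ~: X by rewrite inE negbK.
have bneq a a' b b' : a \in X -> a' \in X -> b \notin X -> adj a b -> adj a' b' -> a != a' -> b != b'.
  move=> Xa Xa' Xb ab ab'; apply: contraNneq => e; rewrite -e in ab'.
  apply/eqP; apply: (triangle_out_uniq CX3 bCX (inC _ Xb) (nC _ Xa) (nC _ Xa')); by rewrite adjC.
have b12 := bneq _ _ _ _ A1 A2 B1 ab1 ab2 n12.
have b13 := bneq _ _ _ _ A1 A3 B1 ab1 ab3 n13.
have b23 := bneq _ _ _ _ A2 A3 B2 ab2 ab3 n23.
have nAB a b : a \in X -> b \notin X -> (a != b) * (b != a).
  by move=> Xa Xb; split; apply: contraNneq Xb; [move=> <-|move=> ->].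
apply: (@isomorphic_C6bar G a1 a2 a3 b1 b2 b3) => //; try exact: adjX; try by apply: adjC'; rewrite ?inC.
  by have := cardsC X; rewrite X3 CX3.
rewrite /= !inE !negb_or n12 n13 n23 (eq_sym b3 b1) b13 (eq_sym b3 b2) b23 b12.
by rewrite !(nAB _ _ A1) ?(nAB _ _ A2) ?(nAB _ _ A3) ?B1 ?B2 ?B3.
Qed.
End Triangles.

(** The vertices in a triangle are distinct because each has only one neighbour outside it, and
    these outer neighbours differ. [a] and [b] play [u1] and [v1] in [R8]. *)
Lemma isomorphic_triangles_rung (G : sgraph) (D B : {set G}) (u v w x y z a b : G) :
  cubic G -> #|G| = 8 -> #|D| = 3 -> bd D = 3 -> #|B| = 3 -> bd B = 3 -> [disjoint D & B] ->
  a \notin D -> a \notin B -> b \notin D -> b \notin B ->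
  u \in D -> v \in D -> w \in D -> x \in B -> y \in B -> z \in B ->
  adj w z -> adj u a -> adj v b -> adj x a -> adj y b -> adj a b -> isomorphic G R8.
Proof.
move=> cubicG G8 D3 bD B3 bB dDB aD aB bD' bB' Du Dv Dw Bx By Bz wz ua vb xa yb ab.
have adjD := triangle_adj cubicG D3 bD; have adjB := triangle_adj cubicG B3 bB.
have DB p : p \in B -> p \notin D by move=> Bp; rewrite (disjointFl dDB Bp).
have BD p : p \in D -> p \notin B by move=> Dp; rewrite (disjointFr dDB Dp).
have out (X : {set G}) p q r s : #|X| = 3 -> bd X = 3 -> p \in X -> q \notin X -> s \notin X ->
    adj p q -> adj r s -> q != s -> p != r.
  move=> X3 bX Xp Xq Xs pq rs; apply: contraNneq => e; rewrite -e in rs.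
  by apply/eqP; apply: (triangle_out_uniq cubicG X3 bX Xp Xq Xs).
have neq (X : {set G}) p q : p \in X -> q \notin X -> (p != q) * (q != p).
  by move=> Xp Xq; split; apply: contraNneq Xq; [move=> <-|move=> ->].
have abn := adj_neq ab.
have uv : u != v := out D u a v b D3 bD Du aD bD' ua vb abn.
have uw : u != w := out D u a w z D3 bD Du aD (DB _ Bz) ua wz (neq _ _ _ Bz aB).2.
have vw : v != w := out D v b w z D3 bD Dv bD' (DB _ Bz) vb wz (neq _ _ _ Bz bB').2.
have zw : adj z w by rewrite adjC.
have xy : x != y := out B x a y b B3 bB Bx aB bB' xa yb abn.
have xz : x != z := out B x a z w B3 bB Bx aB (BD _ Dw) xa zw (neq _ _ _ Dw aD).2.
have yz : y != z := out B y b z w B3 bB By bB' (BD _ Dw) yb zw (neq _ _ _ Dw bD').2.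
apply: (@isomorphic_R8 G u v w x y z a b) => //; try exact: adjD; try exact: adjB.
- have neqX (X : {set G}) p q (Xp : p \in X) (Xq : q \notin X) := (neq X p q Xp Xq).1.
  rewrite /= !inE !negb_or uv uw vw xy xz yz abn /=.
  have := (DB _ Bx, DB _ By, DB _ Bz); do 2!case; move=> xD yD zD.
  by rewrite !(neqX D u) ?(neqX D v) ?(neqX D w) ?(neqX B x) ?(neqX B y) ?(neqX B z).
- by rewrite adjC.
- by rewrite adjC.
Qed.

Lemma singletons_atom (G : sgraph) : cubic G -> 2 < #|G| ->
  (forall X : {set G}, bd X = 3 -> 2 < #|X| -> 2 < #|~: X| -> False) ->
  atom [set [set x] | x in G].
Proof.
move=> cubicG G3 irr; set P := [set [set x] | x in G].
have inP (x : G) : [set x] \in P by apply/imsetP; exists x.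
have card1 (X : {set G}) : bd X = 3 -> #|X| <= 2 -> X \in P.
  move=> bX; case: (ltnP 1 #|X|) => [/(bd3_card cubicG bX) X3|X1 _].
    by rewrite leqNgt X3.
  have [x Xx] := bd3_neq0 bX; suff -> : X = [set x] by [].
  by apply/eqP; rewrite eq_sym eqEcard sub1set Xx cards1.
split.
- apply/and3P; split.
  + apply/eqP/setP=> x; rewrite inE; apply/bigcupP; exists [set x] => //.
    by rewrite inE.
  + apply/trivIsetP=> _ _ /imsetP[x _ ->] /imsetP[y _ ->] neq.
    by rewrite disjoints1 inE; apply: contraNneq neq => ->.
  + by apply/negP=> /imsetP[x _ /setP/(_ x)]; rewrite !inE eqxx.
- by move=> _ /imsetP[x _ ->]; apply: bd1.
- by rewrite card_imset //; apply: set1_inj.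
- move=> X _ bX; case: (leqP #|X| 2) => [X2|X3]; first by left; apply: card1.
  case: (leqP #|~: X| 2) => [X2|CX3]; first by right; apply: card1; rewrite ?bdC.
  by case: (irr X bX X3 CX3).
Qed.

(** * Assembling the bound *)

Section Final.
Variable G : sgraph.
Hypotheses (cubicG : cubic G) (brickG : brick G).
Hypotheses (nK4 : ~ isomorphic G K4) (nC6bar : ~ isomorphic G C6bar) (nR8 : ~ isomorphic G R8).
Let conG := brick_three_connected cubicG brickG.

Lemma card_neq_4 : #|G| <> 4.
Proof. by move=> G4; apply: nK4; apply: isomorphic_K4. Qed.

Lemma irreducible_case : 2 < #|G| ->
  (forall X : {set G}, bd X = 3 -> 2 < #|X| -> 2 < #|~: X| -> False) ->
  exists n, removable_matching [set: G] n /\ #|G| <= 7 * n.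
Proof.
move=> G3 irr; have atomP := singletons_atom cubicG G3 irr.
set P := [set [set x] | x in G] in atomP.
have Z0 : big_blocks P = set0.
  apply/setP=> B; rewrite !inE; have /imsetP[x _ ->] := valP B.
  by rewrite cards1.
have cA : #|quotient P| = #|G|.
  by rewrite (card_quotient P) card_imset //; apply: set1_inj.
have [|n [rn]] := atom_removable_matching cubicG brickG atomP.
  by rewrite cA => -[/card_neq_4].
rewrite Z0 cards0 muln0 addn0 setC0 cardsT cA => len.
exists n; split; last by apply: leq_trans len; apply: leq_addr.
by apply: removable_matchingS rn; apply: subsetT.
Qed.

(** Decomposing the shore [~: D] makes [D] a block of a [K4]-atom with at most one other big block.
    Without another the graph is the prism. Otherwise it has 5 vertices besides that block [B]; they
    are paid for by the removable edge of the atom, unless [B] is stuck as well, and then the graph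
    is [R8]. *)
Lemma stuck_triangle_case (D : {set G}) : stuck_triangle D -> 2 < #|~: D| ->
  exists n, removable_matching [set: G] n /\ #|G| <= 7 * n.
Proof.
move=> stD CD3; have [D3 bD _] := stD; have bCD : bd (~: D) = 3 by rewrite bdC.
have DD3 : 2 < #|~: ~: D| by rewrite setCK D3.
have atomX := shore_atom cubicG brickG bCD CD3 DD3; set P := shore_blocks (~: D) in atomX.
have [B0 eB0] := block_ex (setU11 (~: ~: D) (inner_shores (~: D)) : ~: ~: D \in P).
rewrite setCK in eB0.
pose Z := big_blocks P.
have stB0 : stuck_triangle (val B0) by rewrite eB0.
have [A4 Z2] := stuck_triangle_atom cubicG brickG atomX stB0.
have ZB0 : B0 \in Z by rewrite inE eB0 D3.
have cubicA := quotient_cubic cubicG conG atomX.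
have cG : #|G| = #|~: Z| + \sum_(B in Z) #|(val B : {set G})|.
  rewrite -(card_lift_real cubicG atomX) -card_lift -(cardsC (lift atomX Z)) addnC.
  by rewrite -liftC.
have cCZ := cardsC Z; rewrite A4 in cCZ.
have [Z1|Zn1] := eqVneq #|Z| 1.
  have eZ : Z = [set B0] by apply/eqP; rewrite eq_sym eqEcard sub1set ZB0 Z1 cards1.
  case: nC6bar; apply: (isomorphic_two_triangles cubicG D3 _ bD).
  have := cardsC D; rewrite D3 cG eZ big_set1 eB0 D3.
  by move: cCZ; rewrite Z1 eZ => /(@addnI 1 _ 3) ->; move/(@addnI 3 _ 3).
have {}Z2 : #|Z| = 2.
  apply/eqP; rewrite eqn_leq Z2 ltn_neqAle eq_sym Zn1.
  by apply/card_gt0P; exists B0.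
have cRZ : #|~: Z| = 2 by move: cCZ; rewrite Z2 => /(@addnI 2 _ 2).
have [B eB] : exists B, Z :\ B0 = [set B].
  by apply/cards1P; rewrite card_setD1 ?Z2.
have /setD1P[BB0 ZB] : B \in Z :\ B0 by rewrite eB set11.
have sumZ : \sum_(C in Z) #|(val C : {set G})| = 3 + #|(val B : {set G})|.
  by rewrite (big_setD1 B0) //= eB big_set1 eB0 D3.
have bB : bd (val B) = 3 := atom_bd atomX (valP B).
have B3 : 2 < #|(val B : {set G})| by apply: bd3_card => //; move: ZB; rewrite inE.
have trivP : trivIset P by have [/and3P[]] := atomX.
have dDB : [disjoint D & val B].
  rewrite -eB0; apply: (trivIsetP trivP); rewrite ?(valP B) ?(valP B0) //.
  by rewrite eq_sym.
have CB3 : 2 < #|~: (val B : {set G})|.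
  by rewrite -D3 subset_leq_card // -disjoints_subset.
have [n [rn len]] : exists n, removable_matching (lift atomX (~: Z)) n /\ #|~: Z| + 4 <= 7 * n + 2 * #|Z|.
  by apply: atom_removable_matching => //; rewrite -/Z Z2 => -[].
have [stB|[k [rk lek]]] := shore_bound cubicG brickG bB B3 CB3; last first.
  exists (n + k); split; last first.
    by rewrite cG cRZ sumZ; move: len lek; rewrite cRZ Z2; clear; lia.
  apply: (@removable_matchingS _ (lift atomX (~: Z) :|: val B)); first exact: subsetT.
  apply: removable_matchingU rn rk; rewrite -(lift1 atomX); apply: lift_disjoint.
  by rewrite disjoint_sym disjoints1 in_setC negbK.
case: nR8; have [Bc3 _ _] := stB.
have : 1 < #|~: Z| by rewrite cRZ.
case/card_gt1P=> Ca [Cb []]; rewrite !in_setC => ZCa ZCb nab.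
have [a ea] := real_block cubicG atomX ZCa; have [b eb] := real_block cubicG atomX ZCb.
have edge (C E : quotient P) : C != E -> exists p q, [/\ p \in val C, q \in val E & adj p q].
  move=> CE; have [_ [p [q [eC eE pq]]]] := adj_blkP atomX (complete4 cubicA A4 CE).
  by exists p, q; rewrite !blkE eC eE !eqxx.
have nZ (C E : quotient P) : C \in Z -> E \notin Z -> C != E.
  by move=> ZC; apply: contraNneq => <-.
have B0B : B0 != B by rewrite eq_sym.
have [w [z [Dw Bz wz]]] := edge _ _ B0B.
have [u [a' [Du Ea ua]]] := edge _ _ (nZ _ _ ZB0 ZCa).
have [v [b' [Dv Eb vb]]] := edge _ _ (nZ _ _ ZB0 ZCb).
have [x [a2 [Bx Ea2 xa]]] := edge _ _ (nZ _ _ ZB ZCa).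
have [y [b2 [By Eb2 yb]]] := edge _ _ (nZ _ _ ZB ZCb).
have [a3 [b3 [Ea3 Eb3 ab]]] := edge _ _ nab.
move: Ea Eb Ea2 Eb2 Ea3 Eb3; rewrite ea eb !inE => /eqP e1 /eqP e2 /eqP e3 /eqP e4 /eqP e5 /eqP e6.
rewrite {}e1 in ua; rewrite {}e2 in vb; rewrite {}e3 in xa; rewrite {}e4 in yb; rewrite {}e5 {}e6 in ab.
have notin (C E : quotient P) c : val E = [set c] -> C \in Z -> E \notin Z -> c \notin val C.
  move=> eE ZC ZE; have : c \in val E by rewrite eE set11.
  by rewrite !blkE => /eqP->; rewrite eq_sym nZ.
apply: (@isomorphic_triangles_rung G D (val B) u v w x y z a b) => //; rewrite -?eB0 //.
- by rewrite cG cRZ sumZ Bc3.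
- exact: notin ea ZB0 ZCa.
- exact: notin ea ZB ZCa.
- exact: notin eb ZB0 ZCb.
- exact: notin eb ZB ZCb.
Qed.

(** A nontrivial 3-cut splits the graph into two shores whose bounds add up, unless one of them is a
    stuck triangle. Without such a cut the graph is its own atom and has no big block. *)
Lemma removable_matching_bound : exists n, removable_matching [set: G] n /\ #|G| <= 7 * n.
Proof.
have [[x _]|noG] := pselect (exists x : G, true); last first.
  exists 0; split; first exact: removable_matching0.
  by rewrite leqn0; apply/eqP/eq_card0 => x; case: noG; exists x.
have [G4 _] := cubic_card x cubicG.
have [[X [bX X3 CX3]]|irr] := pselect (exists X : {set G}, [/\ bd X = 3, 2 < #|X| & 2 < #|~: X|]);
    last first.
  apply: irreducible_case; first exact: ltnW.
  by move=> X bX X3 CX3; apply: irr; exists X.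
have [stX|[n [rn len]]] := shore_bound cubicG brickG bX X3 CX3.
  exact: stuck_triangle_case stX CX3.
have bCX : bd (~: X) = 3 by rewrite bdC.
have CCX3 : 2 < #|~: ~: X| by rewrite setCK.
have [stX|[k [rk lek]]] := shore_bound cubicG brickG bCX CX3 CCX3.
  exact: stuck_triangle_case stX CCX3.
exists (n + k); split.
  rewrite -(setUCr X); apply: removable_matchingU rn rk.
  by rewrite -setI_eq0 setICr.
by rewrite -(cardsC X); move: len lek; clear; lia.
Qed.
End Final.

Theorem theorem1p2 (G : sgraph) (cubicG : cubic G) (brickG : brick G)
    (nK4 : ~ isomorphic G K4) (nC6bar : ~ isomorphic G C6bar)
    (nR8 : ~ isomorphic G R8) :
  exists M : {set {set G}},
    [/\ matching M, #|G| <= 7 * #|M|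
      & forall d : {set G}, d \in M -> removable d].
Proof.
have [n [[M [tM rM _ <-]] leG]] := removable_matching_bound cubicG brickG nK4 nC6bar nR8.
by exists M; split=> //; split=> //; apply/subsetP=> d /rM[].
Qed.
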